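(* Let $X$ be a centered stationary Gaussian process on $\mathbb{R}$ whose spectral measure $\mu$ is a symmetric Borel probability measure on $\mathbb{R}$ having a nontrivial absolutely continuous part with respect to Lebesgue measure. Suppose that for some $\alpha\in(0,1)$ we have $C_n\le n^{\alpha n}$ for every $n\in\mathbb{N}$, $n\ge1$. Then for every $\kappa\in(0,1-\alpha)$: (i) there exist constants $0<c_1\le c_2<\infty$ (depending only on $\mu$ and $\kappa$) such that for every $n\in\mathbb{N}$ with $n\ge 2$ and every $T$ with $1\le T\le n^{\kappa}$, $$c_1\,n^2\log n\le -\log\mathbb{P}(\mathscr{N}_T\ge n)\le c_2\,n^2\log n;$$ (ii) there is a constant $c'>0$ (depending only on $\mu$ and $\kappa$) such that for every $T\ge1$ and every $m\in\mathbb{N}$, $m\ge1$, $$\left(\mathbb{E}[\mathscr{N}_T^m]\right)^{1/m}\le c'\max\{T^{1/\kappa},\sqrt{m}\}.$$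
   Context: The spectral measure $\mu$ of a centered stationary Gaussian process $X$ on $\mathbb{R}$ is the measure such that $\mathbb{E}[X_tX_0]=\int_{\mathbb{R}}e^{-itx}\,d\mu(x)$; a version with smooth sample paths is taken. $C_n:=\int_{\mathbb{R}}|x|^n\,d\mu(x)$. For $T>0$, $\mathscr{N}_T:=\#\{x\in[0,T]: X_x=0\}$. ''Symmetric'' means $\mu(-A)=\mu(A)$ for all Borel $A$. *)

(* Defs.v *)
From HB Require Import structures.
From mathcomp Require Import all_boot all_order all_algebra.
From mathcomp Require Import all_classical all_reals all_analysis.
Set Implicit Arguments.
Unset Strict Implicit.
Unset Printing Implicit Defensive.
Import Order.TTheory GRing.Theory Num.Theory.
Import numFieldNormedType.Exports.
Local Open Scope classical_set_scope.
Local Open Scope ring_scope.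

Definition symmetric_measure (R : realType)
    (mu : {measure set (measurableTypeR R) -> \bar R}) : Prop :=
  forall A : set (measurableTypeR R), measurable A -> mu (-%R @` A) = mu A.

Definition mutually_singular (R : realType)
    (rho lambda : {measure set (measurableTypeR R) -> \bar R}) : Prop :=
  exists N : set (measurableTypeR R),
    [/\ measurable N, lambda N = 0%E & rho (~` N) = 0%E].

(* [nu] and [rho] are the two parts of the Lebesgue decomposition of [mu]. *)
Definition nontrivial_ac_part (R : realType)
    (mu : {measure set (measurableTypeR R) -> \bar R}) : Prop :=
  exists nu rho : {measure set (measurableTypeR R) -> \bar R},
    [/\ forall A : set (measurableTypeR R),
          measurable A -> mu A = (nu A + rho A)%E,
        nu `<< (@lebesgue_measure R),
        mutually_singular rho (@lebesgue_measure R) &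
        nu [set: measurableTypeR R] <> 0%E].

Definition abs_moment (R : realType)
    (mu : {measure set (measurableTypeR R) -> \bar R}) (n : nat) : \bar R :=
  (\int[mu]_(x in [set: measurableTypeR R]) (`|x| ^+ n)%:E)%E.

(* [normal_prob m 0] is the uniform law on [0, 1], not a point mass, hence the
   separate degenerate case. *)
Definition gaussian_law (R : realType) (Q : set (measurableTypeR R) -> \bar R)
    : Prop :=
  (exists m s : R, s <> 0 /\
     forall A : set (measurableTypeR R), measurable A -> Q A = normal_prob m s A)
  \/ (exists m : R,
     forall A : set (measurableTypeR R), measurable A -> Q A = dirac m A).

Definition gaussian_process (R : realType) (d : measure_display)
    (Omega : measurableType d) (P : probability Omega R)
    (X : R -> {RV P >-> R}) : Prop :=
  forall (n : nat) (t a : 'I_n -> R),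
    gaussian_law (pushforward P (fun w => \sum_(i < n) a i * X (t i) w)).

Definition centered_process (R : realType) (d : measure_display)
    (Omega : measurableType d) (P : probability Omega R)
    (X : R -> {RV P >-> R}) : Prop :=
  forall t : R, ('E_P[X t] = 0)%E.

Definition stationary_process (R : realType) (d : measure_display)
    (Omega : measurableType d) (P : probability Omega R)
    (X : R -> {RV P >-> R}) : Prop :=
  forall (n : nat) (t : 'I_n -> R) (s : R)
    (B : set (n.-tuple (measurableTypeR R))), measurable B ->
    pushforward P (fun w => [tuple X (t i + s) w | i < n]) B =
    pushforward P (fun w => [tuple X (t i) w | i < n]) B.

Definition smooth_paths (R : realType) (d : measure_display)
    (Omega : measurableType d) (P : probability Omega R)
    (X : R -> {RV P >-> R}) : Prop :=
  forall (w : Omega) (k : nat) (t : R),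
    derivable (derive1n k (fun u => X u w)) t 1.

(* Real and imaginary parts of E[X_t X_0] = \int e^{-itx} dmu(x). *)
Definition is_spectral_measure (R : realType) (d : measure_display)
    (Omega : measurableType d) (P : probability Omega R)
    (X : R -> {RV P >-> R})
    (mu : {measure set (measurableTypeR R) -> \bar R}) : Prop :=
  forall t : R,
    ('E_P[fun w => (X t w * X 0 w)%R] =
       \int[mu]_(x in [set: measurableTypeR R]) (cos (- (t * x)))%:E)%E /\
    (0 = \int[mu]_(x in [set: measurableTypeR R]) (sin (- (t * x)))%:E)%E.

(* Valued in [\bar R]: [+oo] when there are infinitely many zeros. *)
Definition nb_zeros (R : realType) (d : measure_display)
    (Omega : measurableType d) (P : probability Omega R)
    (X : R -> {RV P >-> R}) (T : R) (w : Omega) : \bar R :=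
  counting [set x : R | x \in `[0, T] /\ X x w = 0].

Definition smooth_stationary_gaussian (R : realType)
    (mu : {measure set (measurableTypeR R) -> \bar R})
    (d : measure_display) (Omega : measurableType d) (P : probability Omega R)
    (X : R -> {RV P >-> R}) : Prop :=
  [/\ gaussian_process X, centered_process X, stationary_process X,
      is_spectral_measure X mu & smooth_paths X].

(* Main.v *)
Require Import Defs.
From HB Require Import structures.
From mathcomp Require Import all_boot all_order all_algebra.
From mathcomp Require Import all_classical all_reals all_analysis.
From mathcomp Require Import measurable_realfun.
From mathcomp Require Import complex zify ring lra.
Set Implicit Arguments.
Unset Strict Implicit.
Unset Printing Implicit Defensive.
Import Order.TTheory GRing.Theory Num.Theory.
Import numFieldNormedType.Exports.
Local Open Scope classical_set_scope.
Local Open Scope ring_scope.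


Section NormalIntegral.
Context {R : realType}.
Local Notation leb := (@lebesgue_measure R).

Lemma ge0_integral_normal_prob (m s : R) (f : measurableTypeR R -> \bar R) :
  measurable_fun setT f -> (forall x, (0 <= f x)%E) ->
  (\int[normal_prob m s]_x f x = \int[leb]_x (f x * (normal_pdf m s x)%:E))%E.
Proof.
move=> mf f0.
have dom := normal_prob_dominates m s.
rewrite -(Radon_Nikodym_SigmaFinite.change_of_variables dom f0)//.
have mpdf : measurable_fun [set: R] (EFin \o normal_pdf m s).
  by apply/measurable_EFinP; exact: measurable_normal_pdf.
apply: ae_eq_integral => //.
- apply: emeasurable_funM => //; apply: (measurable_int leb).
  exact: Radon_Nikodym_SigmaFinite.f_integrable.
- exact: emeasurable_funM.
- apply: ae_eqe_mul2l; apply: integral_ae_eq => //=.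
    exact: Radon_Nikodym_SigmaFinite.f_integrable.
  by move=> A _ mA; rewrite -Radon_Nikodym_SigmaFinite.f_integral.
Qed.

Lemma integrable_normal_prob (m s : R) (f : measurableTypeR R -> R) :
  measurable_fun setT f ->
  leb.-integrable setT (fun x => (f x * normal_pdf m s x)%:E) ->
  (normal_prob m s).-integrable setT (EFin \o f).
Proof.
move=> mf /integrableP[_ fi]; apply/integrableP; split; first exact/measurable_EFinP.
rewrite ge0_integral_normal_prob//=; last first.
  by apply/measurable_EFinP; apply: measurableT_comp.
apply: le_lt_trans fi; rewrite le_eqVlt; apply/orP; left; apply/eqP.
by apply: eq_integral => x _; rewrite abse_EFin normrM (ger0_norm (normal_pdf_ge0 _ _ _)).
Qed.

Lemma Rintegral_normal_prob (m s : R) (f : measurableTypeR R -> R) :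
  measurable_fun setT f ->
  leb.-integrable setT (fun x => (f x * normal_pdf m s x)%:E) ->
  \int[normal_prob m s]_x f x = \int[leb]_x (f x * normal_pdf m s x).
Proof.
move=> mf fi; congr fine.
have pm : forall x, 0 <= normal_pdf m s x by exact: normal_pdf_ge0.
rewrite [LHS]integralE [RHS]integralE; congr (_ - _)%E.
  rewrite ge0_integral_normal_prob//; last first.
    by apply: measurable_funepos; exact/measurable_EFinP.
  apply: eq_integral => x _; rewrite !funeposE.
  by rewrite EFinM maxeMl ?lee_fin// mul0e.
rewrite ge0_integral_normal_prob//; last first.
  by apply: measurable_funeneg; exact/measurable_EFinP.
apply: eq_integral => x _; rewrite !funenegE.
by rewrite EFinM maxeMl ?lee_fin// mul0e -mulNe.
Qed.

(* fundamental theorem of calculus on the whole line *)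
Lemma Rintegral_derivative_eq0 (F f : R -> R) :
  (forall x : R, is_derive x 1 F (f x)) -> continuous f ->
  leb.-integrable setT (EFin \o f) ->
  F n%:R @[n --> \oo] --> (0 : R) -> F (- n%:R) @[n --> \oo] --> (0 : R) ->
  \int[leb]_x f x = 0.
Proof.
move=> dF cf fi F1 F2.
pose f_ n := (fun x => (f x)%:E) \_ `[(- n%:R : R), n%:R].
have cvgf : (\int[leb]_x f_ n x @[n --> \oo] --> \int[leb]_x (f x)%:E)%E.
  have mf : measurable_fun setT f by exact: continuous_measurable_fun.
  have := @dominated_convergence _ _ _ leb _ measurableT f_ (EFin \o f) (fun x => `|f x|%:E).
  case=> //.
  - move=> n; apply/(measurable_restrictT _ _).1 => //.
    exact/measurable_funTS/measurable_EFinP.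
  - exact/measurable_EFinP.
  - apply: aeW => x _; apply: cvg_near_cst; near=> n.
    rewrite /f_ patchE ifT//; rewrite inE/= in_itv/= -ler_norml.
    near: n; exact: nbhs_infty_ger.
  - exact: integrable_norm.
  - apply: aeW => x n _; rewrite /f_ patchE; case: ifPn => _ //=.
    by rewrite lee_fin normr0.
have E n : (0 < n)%N -> (\int[leb]_x f_ n x = (F n%:R - F (- n%:R))%:E)%E.
  move=> n0; rewrite -integral_mkcond (@continuous_FTC2 _ f F)//.
  - by rewrite gtrN// ltr0n.
  - exact: continuous_subspaceT.
  - split=> [x _||].
    + exact: (@ex_derive _ _ _ _ _ _ _ (dF x)).
    + apply: cvg_at_right_filter; apply: differentiable_continuous.
      apply/derivable1_diffP; exact: (@ex_derive _ _ _ _ _ _ _ (dF _)).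
    + apply: cvg_at_left_filter; apply: differentiable_continuous.
      apply/derivable1_diffP; exact: (@ex_derive _ _ _ _ _ _ _ (dF _)).
  - move=> x _; rewrite derive1E; exact: derive_val.
have : (\int[leb]_x f_ n x @[n --> \oo] --> 0)%E.
  have : ((F n%:R - F (- n%:R))%:E @[n --> \oo] --> 0%E).
    apply: cvg_EFin; first exact: nearW.
    rewrite -[X in _ --> X]subr0; apply: cvgB; [exact: F1|exact: F2].
  apply: cvg_trans; apply: near_eq_cvg; near=> n; rewrite E//.
  near: n; exact: nbhs_infty_gt.
move=> H0; have H := cvg_unique (@ereal_hausdorff R) H0 cvgf.
by rewrite /Rintegral -H.
Unshelve. all: end_near. Qed.

End NormalIntegral.

Section NormalMoments.
Context {R : realType}.
Local Notation leb := (@lebesgue_measure R).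
Variables (m s : R).
Hypothesis s0 : s != 0.
Let p : R -> R := normal_pdf m s.

Let pE x : p x = normal_peak s * expR (- (x - m) ^+ 2 / (s ^+ 2 *+ 2)).
Proof. by rewrite /p normal_pdfE. Qed.

Let p_ge0 x : 0 <= p x. Proof. exact: normal_pdf_ge0. Qed.

Let s2 : 0 < s ^+ 2. Proof. by rewrite exprn_even_gt0. Qed.

Let continuous_p : continuous p. Proof. exact: continuous_normal_pdf. Qed.

Lemma is_derive_normal_pdf (x : R) :
  is_derive x 1 (normal_pdf m s) (- ((x - m) / s ^+ 2) * normal_pdf m s x).
Proof.
rewrite {1}(_ : normal_pdf m s =
  (fun x => normal_peak s * expR (- (x - m) ^+ 2 / (s ^+ 2 *+ 2)))); last first.
  by apply/funext => y; exact: pE.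
apply: is_derive_eq.
rewrite -/p pE /= /GRing.scale /= ; field.
by [].
Qed.

Lemma normal_pdf_wide_bound : exists C : R, 0 <= C /\
  forall x, (1 + (x - m) ^+ 2) * normal_pdf m s x <=
     C * normal_pdf m (Num.sqrt 2 * s) x.
Proof.
have t0 : Num.sqrt 2 * s != 0 :> R by rewrite mulf_neq0// gt_eqF// sqrtr_gt0.
have kt := normal_peak_gt0 t0; have ks := normal_peak_gt0 s0.
exists ((1 + 4 * s ^+ 2) * (normal_peak s / normal_peak (Num.sqrt 2 * s))); split.
  apply: mulr_ge0; last by apply: divr_ge0; exact: ltW.
  by apply: addr_ge0 => //; apply: mulr_ge0 => //; exact: ltW.
move=> x; rewrite -/p pE (normal_pdfE _ t0) /normal_fun.
set a := expR _; set b := expR _; set w := 1 + (x - m) ^+ 2.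
rewrite [leLHS](_ : _ = normal_peak s * (w * a)); last by ring.
rewrite [leRHS](_ : _ = normal_peak s * ((1 + 4 * s ^+ 2) * b)); last first.
  by field; rewrite gt_eqF.
rewrite ler_wpM2l ?normal_peak_ge0// /w /a /b {w a b}.
rewrite exprMn sqr_sqrtr//.
set y := (x - m) ^+ 2 / (s ^+ 2 * 4).
have -> : - (x - m) ^+ 2 / (s ^+ 2 *+ 2) = - y - y by rewrite /y; field; exact: s0.
have -> : - (x - m) ^+ 2 / (2 * s ^+ 2 *+ 2) = - y by rewrite /y; field; exact: s0.
have y0 : 0 <= y by rewrite divr_ge0 ?sqr_ge0// mulr_ge0// ltW.
have -> : (x - m) ^+ 2 = 4 * s ^+ 2 * y by rewrite /y; field; exact: s0.
rewrite expRD mulrA ler_wpM2r ?expR_ge0//.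
rewrite mulrC -ler_pdivlMl ?expR_gt0// -expRN opprK.
have h1 : 1 <= expR y by rewrite -[leLHS]expR0 ler_expR.
have h2 : y <= expR y by rewrite (le_trans _ (expR_ge1Dx y))// lerDr.
have := mulr_ge0 (ltW s2) (_ : 0 <= expR y - y); rewrite subr_ge0 => /(_ h2).
by move: s2 => _; nra.
Qed.

Lemma integrable_normal_weight :
  leb.-integrable setT (EFin \o (fun x => (1 + (x - m) ^+ 2) * normal_pdf m s x)).
Proof.
have [C [C0 HC]] := normal_pdf_wide_bound.
have := integrable_normal_pdf m (Num.sqrt 2 * s).
move=> /(integrableZl measurableT C)/le_integrable; apply => //.
  apply/measurable_EFinP/measurable_funM; last exact: measurable_normal_pdf.
  by apply: measurable_funD => //; apply: measurable_funX; exact: measurable_funB.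
move=> x _; rewrite -EFinM !abse_EFin lee_fin.
rewrite !ger0_norm ?mulr_ge0 ?normal_pdf_ge0// addr_ge0// sqr_ge0//.
Qed.

Lemma integrable_normal_dom (g : R -> R) (C : R) : continuous g ->
  (forall x, `|g x| <= C * (1 + (x - m) ^+ 2)) ->
  leb.-integrable setT (EFin \o (fun x => g x * normal_pdf m s x)).
Proof.
move=> cg gC.
move: integrable_normal_weight => /(integrableZl measurableT C)/le_integrable; apply => //.
  apply/measurable_EFinP/measurable_funM; last exact: measurable_normal_pdf.
  exact: continuous_measurable_fun.
move=> x _; rewrite -EFinM !abse_EFin lee_fin [leLHS]normrM [leRHS]ger0_norm.
  by rewrite mulrA (ger0_norm (normal_pdf_ge0 _ _ _)) ler_wpM2r ?normal_pdf_ge0.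
rewrite mulrA mulr_ge0 ?normal_pdf_ge0//; exact: le_trans (gC x).
Qed.

Lemma normal_tail_cvg0 (F : R -> R) (C : R) :
  (forall x, `|F x| * `|x - m| <= C * (1 + (x - m) ^+ 2) * normal_pdf m s x) ->
  F n%:R @[n --> \oo] --> (0 : R) /\ F (- n%:R) @[n --> \oo] --> (0 : R).
Proof.
move=> FC; have [D [D0 HD]] := normal_pdf_wide_bound.
have t0 : Num.sqrt 2 * s != 0 :> R by rewrite mulf_neq0// gt_eqF// sqrtr_gt0.
have [K K0 HK] : exists2 K, 0 < K & forall x, `|F x| * `|x - m| <= K.
  exists (`|C| * (D * normal_peak (Num.sqrt 2 * s)) + 1).
    by rewrite ltr_pwDr// mulr_ge0// mulr_ge0// normal_peak_ge0.
  move=> x; rewrite (le_trans (FC x))// -mulrA (@le_trans _ _ (`|C| * (D * normal_peak (Num.sqrt 2 * s))))//; last by rewrite lerDl.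
  rewrite (@le_trans _ _ (`|C| * ((1 + (x - m) ^+ 2) * normal_pdf m s x)))//.
    by rewrite ler_wpM2r ?ler_norm// mulr_ge0 ?normal_pdf_ge0// addr_ge0// sqr_ge0.
  rewrite ler_wpM2l// (le_trans (HD x))// ler_wpM2l//.
  exact: normal_pdf_ub.
have key x e : 0 < e -> K / e < `|x - m| -> `|F x| < e.
  move=> e0 h; have xm : 0 < `|x - m| by apply: lt_trans h; rewrite divr_gt0.
  have := HK x; rewrite -ler_pdivlMr// => /le_lt_trans; apply.
  by rewrite ltr_pdivrMr// mulrC -ltr_pdivrMr.
split; apply/cvgr0Pnorm_lt => e e0; near=> n; apply: key => //.
  rewrite (@lt_le_trans _ _ (n%:R - m))// ?ler_norm// ltrBrDr.
  near: n; exact: nbhs_infty_gtr.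
rewrite -normrN opprB opprK (@lt_le_trans _ _ (m + n%:R))// ?ler_norm//.
rewrite addrC -ltrBlDr; near: n; exact: nbhs_infty_gtr.
Unshelve. all: end_near. Qed.


Lemma integrable_normal_gauss (g : R -> R) (C : R) : continuous g ->
  (forall x, `|g x| <= C * (1 + (x - m) ^+ 2)) ->
  (normal_prob m s).-integrable setT (EFin \o (g : measurableTypeR R -> R)).
Proof.
move=> cg gC; apply: integrable_normal_prob.
  exact: continuous_measurable_fun.
exact: integrable_normal_dom gC.
Qed.

Lemma Rintegral_normal (g : R -> R) (C : R) : continuous g ->
  (forall x, `|g x| <= C * (1 + (x - m) ^+ 2)) ->
  \int[normal_prob m s]_x (g x) = \int[leb]_x (g x * normal_pdf m s x).
Proof.
move=> cg gC; apply: (@Rintegral_normal_prob _ m s g).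
  exact: continuous_measurable_fun.
exact: integrable_normal_dom gC.
Qed.

(** integration by parts against the normal density *)
Lemma normal_stein (g g' : R -> R) (C : R) :
  (forall x : R, is_derive x 1 g (g' x)) -> continuous g' ->
  (forall x, `|g' x| <= C * (1 + (x - m) ^+ 2)) ->
  (forall x, `|g x| * `|x - m| <= C * (1 + (x - m) ^+ 2)) ->
  \int[normal_prob m s]_x ((x - m) * g x) =
  s ^+ 2 * \int[normal_prob m s]_x (g' x).
Proof.
move=> dg cg' Cg' Cg.
have cg : continuous g.
  move=> x; apply: differentiable_continuous; apply/derivable1_diffP.
  exact: (@ex_derive _ _ _ _ _ _ _ (dg x)).
have cxg : continuous (fun x => (x - m) * g x).
  move=> x; apply: cvgM; last exact: cg.
  by apply: cvgB; [exact: cvg_id|exact: cvg_cst].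
have Cxg x : `|(x - m) * g x| <= C * (1 + (x - m) ^+ 2).
  by rewrite normrM mulrC.
rewrite (Rintegral_normal cxg Cxg) (Rintegral_normal cg' Cg').
have i1 := integrable_normal_dom cxg Cxg.
have i2 := integrable_normal_dom cg' Cg'.
apply/eqP; rewrite -subr_eq0 -RintegralZl//.
have i3 : leb.-integrable setT (EFin \o (fun x => s ^+ 2 * (g' x * p x))).
  have := integrableZl measurableT (s ^+ 2) i2.
  by apply: eq_integrable => // x _; rewrite /= EFinM.
rewrite -(RintegralB _ i1 i3)//; apply/eqP.
have [F1 F2] : (fun x => - s ^+ 2 * (g x * p x)) n%:R @[n --> \oo] --> (0 : R) /\
   (fun x => - s ^+ 2 * (g x * p x)) (- n%:R) @[n --> \oo] --> (0 : R).
  apply: (@normal_tail_cvg0 (fun x => - s ^+ 2 * (g x * p x)) (s ^+ 2 * C)) => x.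
  rewrite normrM normrN (ger0_norm (ltW s2)) normrM (ger0_norm (p_ge0 _)).
  rewrite -/p [leLHS](_ : _ = s ^+ 2 * (`|g x| * `|x - m| * p x)); last by ring.
  rewrite -(mulrA (s ^+ 2) C) -(mulrA (s ^+ 2)).
  by apply: ler_wpM2l (ltW s2) _ _ _; apply: ler_wpM2r (p_ge0 x) _ _ (Cg x).
apply: (@Rintegral_derivative_eq0 _ (fun x => - s ^+ 2 * (g x * p x)) _ _ _ _ F1 F2) => //=.
- move=> x; have dp : is_derive x 1 p (- ((x - m) / s ^+ 2) * p x) := is_derive_normal_pdf x; have dgx := dg x.
  apply: is_derive_eq; rewrite -/p /GRing.scale /=; field; exact: s0.
- move=> x; apply: cvgB; first by apply: cvgM; [exact: cxg|exact: continuous_p].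
  apply: cvgM; first exact: cvg_cst.
  by apply: cvgM; [exact: cg'|exact: continuous_p].
- have := integrableB measurableT i1 i3.
  by apply: eq_integrable => // x _; rewrite /= EFinB.
Qed.

Let le_w0 (x : R) : 1 <= 1 + (x - m) ^+ 2.
Proof. by rewrite lerDl sqr_ge0. Qed.

Let le_w1 (x : R) : `|x - m| <= 1 + (x - m) ^+ 2.
Proof. by rewrite -(real_normK (num_real (x - m))); have := normr_ge0 (x - m); nra. Qed.

Lemma normal_integrable_sqr :
  (normal_prob m s).-integrable setT
    (EFin \o ((fun x => (x - m) ^+ 2) : measurableTypeR R -> R)).
Proof.
apply: (@integrable_normal_gauss _ 1) => [x|x].
  apply: (cvg_comp (fun x => x - m) (fun x => x ^+ 2)); last exact: sqr_continuous.
  by apply: cvgB; [exact: cvg_id|exact: cvg_cst].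
by rewrite mul1r ger0_norm ?sqr_ge0// lerDr.
Qed.

Lemma normal_integrable_center :
  (normal_prob m s).-integrable setT
    (EFin \o ((fun x => (x - m)) : measurableTypeR R -> R)).
Proof.
apply: (@integrable_normal_gauss _ 1) => [x|x].
  by apply: cvgB; [exact: cvg_id|exact: cvg_cst].
by rewrite mul1r.
Qed.

Lemma normal_mean_center : \int[normal_prob m s]_x (x - m) = 0.
Proof.
have := @normal_stein (cst 1) (cst 0) 1; rewrite Rintegral_cst// mul0r mulr0.
under eq_Rintegral do rewrite mulr1; apply.
- exact: cst_continuous.
- by move=> x; rewrite normr0 mul1r addr_ge0// sqr_ge0.
- by move=> x; rewrite normr1 !mul1r.
Qed.

Lemma normal_variance_center : \int[normal_prob m s]_x ((x - m) ^+ 2) = s ^+ 2.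
Proof.
have := @normal_stein (fun x => x - m) (cst 1) 1.
rewrite Rintegral_cst// mul1r [X in fine X]probability_setT mulr1.
under eq_Rintegral do rewrite -expr2; apply.
- by move=> x; apply: is_derive_eq; rewrite subr0.
- exact: cst_continuous.
- by move=> x; rewrite normr1 mul1r.
- by move=> x; rewrite mul1r -normrM -expr2 ger0_norm ?sqr_ge0// lerDr.
Qed.

Let chf (t u : R) := \int[normal_prob m s]_x cos (u * (x - m) + t).

Let is_derive_chf t (u : R) : is_derive u 1 (chf t) (- s ^+ 2 * u * chf t u).
Proof.
have dcos (v x : R) : is_derive v 1 (fun v => cos (v * (x - m) + t))
   (- ((x - m) * sin (v * (x - m) + t))).
  by apply: is_derive_eq; rewrite /GRing.scale /=; ring.
have dsinx (v x : R) : is_derive x 1 (fun x => sin (v * (x - m) + t))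
   (v * cos (v * (x - m) + t)).
  by apply: is_derive_eq; rewrite /GRing.scale /=; ring.
have dcosx (v x : R) : is_derive x 1 (fun x => v * cos (v * (x - m) + t))
   (- v ^+ 2 * sin (v * (x - m) + t)).
  by apply: is_derive_eq; rewrite /GRing.scale /=; ring.
have dcont (g g' : R -> R) : (forall x : R, is_derive x 1 g (g' x)) -> continuous g.
  move=> dg x; apply: differentiable_continuous; apply/derivable1_diffP.
  exact: (@ex_derive _ _ _ _ _ _ _ (dg x)).
have H := @derivable_under_integral R _ _ (normal_prob m s)
   (fun v x => cos (v * (x - m) + t)) setT measurableT u (u - 1) (u + 1).
have K := @differentiation_under_integral R _ _ (normal_prob m s)
   (fun v x => cos (v * (x - m) + t)) setT measurableT u (u - 1) (u + 1).
have C1 : `]u - 1, u + 1[%classic u by rewrite /= in_itv/= ltrBlDr ltrDl ltr01.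
have C2 (x : R) : `]u - 1, u + 1[%classic x -> (normal_prob m s).-integrable setT
   (EFin \o ((fun y => cos (x * (y - m) + t)) : measurableTypeR R -> R)).
  move=> _; apply: (@integrable_normal_gauss _ 1) => [|y].
    apply: (@dcont _ (fun y => - (x * sin (x * (y - m) + t)))) => y.
    by apply: is_derive_eq; rewrite /GRing.scale /=; ring.
  by rewrite mul1r (le_trans (cos_max _)).
have C3 (x y : R) : `]u - 1, u + 1[%classic x -> [set: R] y ->
   derivable (fun v : R => cos (v * (y - m) + t)) x 1.
  by move=> _ _; exact: (@ex_derive _ _ _ _ _ _ _ (dcos x y)).
have C4 (x y : R) : `]u - 1, u + 1[%classic x -> [set: R] y ->
   `|partial1of2 (fun (v : R) (x : R) => cos (v * (x - m) + t)) x y| <= `|y - m|.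
  move=> _ _; rewrite partial1of2E derive_val normrN normrM.
  by rewrite ler_piMr// ler_norml sin_geN1 sin_le1.
have C5 : (normal_prob m s).-integrable setT
   (EFin \o ((fun x => `|x - m|) : measurableTypeR R -> R)).
  exact: (integrable_norm normal_integrable_center).
have C6 (y : R) : 0 <= `|y - m| by [].
have := H C1 C2 C3 _ C6 C5 C4; have := K C1 C2 C3 _ C6 C5 C4; rewrite -/(chf t).
move=> E D; apply: DeriveDef => //; rewrite -derive1E E.
under eq_Rintegral do rewrite partial1of2E derive_val -mulrN.
rewrite (@normal_stein (fun x => - sin (u * (x - m) + t))
   (fun x => - (u * cos (u * (x - m) + t))) (1 + `|u|)).
- under eq_Rintegral do rewrite -mulNr.
  rewrite RintegralZl//; last exact: C2.
  by rewrite /chf; ring.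
- apply: (@dcont _ (fun x => u ^+ 2 * sin (u * (x - m) + t))) => x.
  by have := dcosx u x => ?; apply: is_derive_eq; rewrite mulNr opprK.
- move=> x; rewrite normrN normrM (@le_trans _ _ (`|u| * 1))//.
    by rewrite ler_wpM2l// ler_norml cos_geN1 cos_le1.
  by have := normr_ge0 u; have := sqr_ge0 (x - m); nra.
- move=> x; rewrite normrN (@le_trans _ _ (1 * `|x - m|))//.
    by rewrite ler_wpM2r// ler_norml sin_geN1 sin_le1.
  by rewrite ler_pM// ?lerDl.
Qed.

(** the characteristic function solves a linear differential equation *)
Lemma normal_char_fun (u t : R) :
  \int[normal_prob m s]_x cos (u * (x - m) + t) =
  expR (- (s ^+ 2 * u ^+ 2) / 2) * cos t.
Proof.
rewrite -/(chf t u).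
pose h v := chf t v * expR ((s ^+ 2 * v ^+ 2) / 2).
have dh (v : R) : is_derive v 1 h 0.
  have := is_derive_chf t v => ?.
  by apply: is_derive_eq; rewrite /GRing.scale /=; field.
have := is_derive_0_is_cst u 0 dh; rewrite /h expr0n/= mulr0 mul0r expR0 mulr1.
have -> : chf t 0 = cos t.
  rewrite /chf; under eq_Rintegral do rewrite mul0r add0r.
  by rewrite Rintegral_cst// [X in fine X]probability_setT mulr1.
by move=> <-; rewrite mulrCA -expRD mulNr addNr expR0 mulr1.
Qed.

End NormalMoments.

Section Transfer.
Context {R : realType} (d : measure_display) (Omega : measurableType d)
  (P : probability Omega R).
Variables (W : Omega -> R) (mW : measurable_fun setT W)
  (Q : {measure set (measurableTypeR R) -> \bar R}).
Hypothesis WQ : forall A : set (measurableTypeR R), measurable A ->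
  pushforward P (W : Omega -> measurableTypeR R) A = Q A.

Lemma ge0_integral_law (f : measurableTypeR R -> \bar R) : measurable_fun setT f ->
  (forall x, (0 <= f x)%E) -> (\int[P]_w f (W w) = \int[Q]_x f x)%E.
Proof.
move=> mf f0.
rewrite -(@eq_measure_integral _ _ _ _ Q (pushforward P (W : Omega -> measurableTypeR R)) f)//; last by move=> A mA _; exact: WQ.
by rewrite ge0_integral_pushforward.
Qed.

Lemma integrable_law (f : measurableTypeR R -> R) :
  Q.-integrable setT (EFin \o f) -> P.-integrable setT (EFin \o (f \o W)).
Proof.
move=> /integrableP[/measurable_EFinP mf fi]; apply/integrableP; split.
  by apply/measurable_EFinP; exact: measurableT_comp.
rewrite /= -(@ge0_integral_law (fun x => `|(f x)%:E|%E)) // in fi.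
by apply/measurable_EFinP; apply: measurableT_comp.
Qed.

Lemma Rintegral_law (f : measurableTypeR R -> R) :
  Q.-integrable setT (EFin \o f) -> \int[P]_w f (W w) = \int[Q]_x f x.
Proof.
move=> iQ; have iP := integrable_law iQ.
have mf : measurable_fun setT (EFin \o f) by case/integrableP : iQ.
rewrite /Rintegral.
rewrite -(@eq_measure_integral _ _ _ _ Q (pushforward P (W : Omega -> measurableTypeR R)) (EFin \o f))//; last by move=> A mA _; exact: WQ.
by rewrite integral_pushforward.
Qed.

End Transfer.

Section NormalExp.
Context {R : realType}.
Local Notation leb := (@lebesgue_measure R).

Lemma normal_exp_sqr (s c : R) : s != 0 -> s ^+ 2 <= c ->
  (\int[normal_prob 0 s]_x (expR (x ^+ 2 / (4 * c)))%:E <= (Num.sqrt 2)%:E)%E.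
Proof.
move=> s0 sc; have s2 : 0 < s ^+ 2 by rewrite exprn_even_gt0.
have c0 : 0 < c by exact: lt_le_trans sc.
have t0 : Num.sqrt 2 * s != 0 :> R by rewrite mulf_neq0// gt_eqF// sqrtr_gt0.
have mexp (r : R) : measurable_fun [set: R] (fun x : R => expR (x ^+ 2 / r)).
  apply: measurableT_comp => //; apply: measurable_funM => //.
rewrite ge0_integral_normal_prob//; last first.
  by apply/measurable_EFinP; exact: mexp.
have -> : (Num.sqrt 2)%:E = (\int[leb]_x ((Num.sqrt 2)%:E * (normal_pdf 0 (Num.sqrt 2 * s) x)%:E))%E.
  rewrite integralZl//; last exact: integrable_normal_pdf.
  by rewrite integral_normal_pdf mule1.
apply: ge0_le_integral => //.
- by move=> x _; rewrite -EFinM lee_fin mulr_ge0 ?expR_ge0 ?normal_pdf_ge0.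
- apply/measurable_EFinP; apply: measurable_funM; first exact: mexp.
  exact: measurable_normal_pdf.
- by apply: measurable_funeM; apply/measurable_EFinP; exact: measurable_normal_pdf.
move=> x _; rewrite -!EFinM lee_fin !normal_pdfE// /normal_fun !subr0.
have kE : normal_peak s = Num.sqrt 2 * normal_peak (Num.sqrt 2 * s).
  rewrite /normal_peak exprMn sqr_sqrtr//.
  rewrite (_ : 2 * s ^+ 2 * pi *+ 2 = 2 * (s ^+ 2 * pi *+ 2)); last by ring.
  by rewrite sqrtrM// invfM mulrA divff ?mul1r// gt_eqF// sqrtr_gt0.
rewrite kE mulrCA -!mulrA ler_wpM2l ?sqrtr_ge0// ler_wpM2l ?normal_peak_ge0//.
rewrite -expRD ler_expR exprMn sqr_sqrtr//.
have -> : - x ^+ 2 / (2 * s ^+ 2 *+ 2) = x ^+ 2 / (4 * s ^+ 2) - x ^+ 2 / (s ^+ 2 *+ 2).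
  by field.
rewrite mulNr lerD2r mulrA -expr2; apply: ler_wpM2l; first exact: sqr_ge0.
rewrite lef_pV2; first by rewrite ler_pM2l.
  by rewrite posrE mulr_gt0.
by rewrite posrE mulr_gt0.
Qed.

End NormalExp.

Section GaussianLaw.
Context {R : realType} (d : measure_display) (Omega : measurableType d)
  (P : probability Omega R).
Variables (W : Omega -> R) (mW : measurable_fun setT W).

Lemma gaussian_law_facts :
  gaussian_law (pushforward P (W : Omega -> measurableTypeR R)) ->
  exists m v : R,
  [/\ 0 <= v, P.-integrable setT (EFin \o W), \int[P]_w W w = m,
     P.-integrable setT (EFin \o (fun w => (W w) ^+ 2)) &
     \int[P]_w (W w) ^+ 2 = m ^+ 2 + v] /\
  (forall t, \int[P]_w cos (W w + t) = expR (- v / 2) * cos (m + t)) /\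
  (forall c, v <= c -> 0 < c -> m = 0 ->
     (\int[P]_w (expR ((W w) ^+ 2 / (4 * c)))%:E <= (Num.sqrt 2)%:E)%E).
Proof.
have meas_exp (c : R) : measurable_fun [set: measurableTypeR R]
    (fun x : measurableTypeR R => (expR (x ^+ 2 / (4 * c)))%:E).
  apply/measurable_EFinP; apply: measurableT_comp => //; apply: measurable_funM => //.
case=> [[m [s [/eqP s0 Hlaw]]]|[m Hlaw]].
- exists m, (s ^+ 2).
  pose Q := normal_prob m s.
  have icst (r : R) : (normal_prob m s).-integrable setT (EFin \o (cst r : measurableTypeR R -> R)).
    exact: finite_measure_integrable_cst.
  have i1 : Q.-integrable setT (EFin \o ((fun x => x) : measurableTypeR R -> R)).
    have := integrableD measurableT (normal_integrable_center m s0) (icst m).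
    by apply: eq_integrable => // x _ /=; rewrite -EFinD subrK.
  have i2 : Q.-integrable setT (EFin \o ((fun x => x ^+ 2) : measurableTypeR R -> R)).
    have := integrableD measurableT (normal_integrable_sqr m s0)
      (integrableD measurableT (integrableZl measurableT (2 * m) (normal_integrable_center m s0))
       (icst (m ^+ 2))).
    apply: eq_integrable => // x _ /=; rewrite -EFinM -!EFinD; congr EFin; ring.
  split; first split.
  + exact: sqr_ge0.
  + exact: (integrable_law mW Hlaw i1).
  + rewrite (Rintegral_law mW Hlaw i1).
    have := normal_mean_center m s0.
    rewrite RintegralB//; last exact: icst.
    rewrite Rintegral_cst// [X in fine X]probability_setT mulr1 => /eqP.
    by rewrite subr_eq0 => /eqP.
  + exact: (integrable_law mW Hlaw i2).
  + rewrite (Rintegral_law mW Hlaw i2).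
    have c1 := normal_integrable_center m s0.
    have c2 := normal_integrable_sqr m s0.
    rewrite [LHS](@eq_Rintegral _ _ _ Q _ (fun x : measurableTypeR R => (x - m) ^+ 2 + (2 * m * (x - m) + m ^+ 2))); last first.
      by move=> x _; ring.
    have i3 : Q.-integrable setT (EFin \o ((fun x => 2 * m * (x - m)) : measurableTypeR R -> R)).
      by have := integrableZl measurableT (2 * m) c1; apply: eq_integrable.
    have i4 : Q.-integrable setT (EFin \o ((fun x => 2 * m * (x - m) + m ^+ 2) : measurableTypeR R -> R)).
      have := integrableD measurableT i3 (icst (m ^+ 2)).
      by apply: eq_integrable.
    rewrite RintegralD// RintegralD//; last exact: icst.
    rewrite RintegralZl// normal_mean_center// normal_variance_center//.
    rewrite Rintegral_cst// [X in fine X]probability_setT /=; ring.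
  + split.
      move=> t.
      have cc : continuous (fun x : R => cos (x + t)).
        move=> x; apply: (cvg_comp (fun x => x + t) cos); last exact: continuous_cos.
        by apply: cvgD; [exact: cvg_id|exact: cvg_cst].
      have ic : Q.-integrable setT (EFin \o ((fun x => cos (x + t)) : measurableTypeR R -> R)).
        apply: (@integrable_normal_gauss _ _ _ s0 _ 1) => // x.
        by rewrite mul1r (le_trans (cos_max _))// lerDl sqr_ge0.
      rewrite (Rintegral_law mW Hlaw ic).
      have := normal_char_fun m s0 1 (m + t); rewrite expr1n mulr1 => <-.
      by apply: eq_Rintegral => x _; congr cos; ring.
    move=> c sc c0 m0.
    rewrite (ge0_integral_law mW Hlaw (meas_exp c)) => [|x]; last by rewrite lee_fin expR_ge0.
    by move: Hlaw; rewrite m0 => _; exact: normal_exp_sqr.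
- exists m, 0.
  pose Q : {measure set (measurableTypeR R) -> \bar R} := @dirac _ (measurableTypeR R) m R.
  have ii (f : measurableTypeR R -> R) : measurable_fun setT f -> Q.-integrable setT (EFin \o f).
    move=> mf; apply/integrableP; split; first exact/measurable_EFinP.
    rewrite integral_dirac//; first by rewrite diracT mul1e ltry.
    by apply/measurableT_comp => //; exact/measurable_EFinP.
  have ie (f : measurableTypeR R -> R) : measurable_fun setT f -> \int[Q]_x f x = f m.
    move=> mf; rewrite /Rintegral integral_dirac//; first by rewrite diracT mul1e.
    exact/measurable_EFinP.
  have m1 : measurable_fun setT ((fun x => x) : measurableTypeR R -> R) by [].
  have m2 : measurable_fun setT ((fun x => x ^+ 2) : measurableTypeR R -> R).
    exact: measurable_funX.
  split; first split => //.
  + exact: (@integrable_law _ _ _ P W mW Q Hlaw _ (ii _ m1)).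
  + by rewrite (@Rintegral_law _ _ _ P W mW Q Hlaw _ (ii _ m1)) (ie _ m1).
  + exact: (@integrable_law _ _ _ P W mW Q Hlaw _ (ii _ m2)).
  + by rewrite (@Rintegral_law _ _ _ P W mW Q Hlaw _ (ii _ m2)) (ie _ m2) addr0.
  + split.
      move=> t; have m3 : measurable_fun setT ((fun x => cos (x + t)) : measurableTypeR R -> R).
        apply: continuous_measurable_fun => x.
        apply: (cvg_comp (fun x => x + t) cos); last exact: continuous_cos.
        by apply: cvgD; [exact: cvg_id|exact: cvg_cst].
      by rewrite (@Rintegral_law _ _ _ P W mW Q Hlaw _ (ii _ m3)) (ie _ m3) oppr0 mul0r expR0 mul1r.
    move=> c _ c0 m0.
    rewrite (@ge0_integral_law _ _ _ P W mW Q Hlaw _ (meas_exp c)) => [|x]; last by rewrite lee_fin expR_ge0.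
    rewrite integral_dirac//; first rewrite diracT mul1e m0 expr0n/= mul0r expR0 lee_fin.
    by rewrite -{1}(@sqrtr1 R) ler_sqrt// ler1n.
Qed.

End GaussianLaw.

Section IntegralSum.
Context {R : realType} (d : measure_display) (T : measurableType d)
  (m : {measure set T -> \bar R}) (I : Type).

Lemma integrable_sumR (s : seq I) (f : I -> T -> R) :
  (forall i, m.-integrable setT (EFin \o f i)) ->
  m.-integrable setT (EFin \o (fun x => \sum_(i <- s) f i x)).
Proof.
move=> fi; elim: s => [|a s IH].
  apply: (eq_integrable measurableT (cst 0%E)); last exact: integrable0.
  by move=> x _; rewrite /= big_nil.
have := integrableD measurableT (fi a) IH.
by apply: eq_integrable => // x _ /=; rewrite big_cons EFinD.
Qed.

Lemma Rintegral_sumR (s : seq I) (f : I -> T -> R) :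
  (forall i, m.-integrable setT (EFin \o f i)) ->
  \int[m]_x (\sum_(i <- s) f i x) = \sum_(i <- s) \int[m]_x (f i x).
Proof.
move=> fi; elim: s => [|a s IH].
  rewrite big_nil; under eq_Rintegral do rewrite big_nil.
  by rewrite /Rintegral integral0.
rewrite big_cons -IH -RintegralD//; last exact: integrable_sumR.
by apply: eq_Rintegral => x _; rewrite big_cons.
Qed.

End IntegralSum.

Section BoundedIntegral.
Context {R : realType} (d : measure_display) (T : measurableType d)
  (P : probability T R).

Lemma integrable_bounded (f : T -> R) (M : R) : measurable_fun setT f ->
  (forall x, `|f x| <= M) -> P.-integrable setT (EFin \o f).
Proof.
move=> mf fM; have : P.-integrable setT (EFin \o cst M) by exact: finite_measure_integrable_cst.
move=> /le_integrable; apply => //; first exact/measurable_EFinP.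
by move=> x _ /=; rewrite lee_fin (le_trans (fM x))// ler_norm.
Qed.

Lemma Rintegral_prob_cst (r : R) : \int[P]_x r = r.
Proof. by rewrite Rintegral_cst// [X in fine X]probability_setT mulr1. Qed.

Lemma EFin_Rintegral (f : T -> R) : P.-integrable setT (EFin \o f) ->
  (\int[P]_x (f x)%:E = (\int[P]_x f x)%:E)%E.
Proof. by move=> fi; rewrite /Rintegral fineK// integrable_fin_num. Qed.

End BoundedIntegral.

Section Functionals.
Context {R : realType}.
Implicit Types (L : seq (R * R)) (f : R -> R) (a h : R).

(** a finitely supported functional on functions of time, as a list of
    (coefficient, time) pairs *)
Definition lin L f : R := \sum_(p <- L) p.1 * f p.2.

Definition scaleL a L := [seq (a * p.1, p.2) | p <- L].

Definition shiftL h L := [seq (p.1, p.2 + h) | p <- L].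

Lemma lin_cat L L' f : lin (L ++ L') f = lin L f + lin L' f.
Proof. by rewrite /lin big_cat. Qed.

Lemma lin_scale a L f : lin (scaleL a L) f = a * lin L f.
Proof.
by rewrite /lin big_map mulr_sumr; apply: eq_bigr => p _; rewrite mulrA.
Qed.

Lemma lin_shift h L f : lin (shiftL h L) f = lin L (fun t => f (t + h)).
Proof. by rewrite /lin big_map. Qed.

Lemma linD L f g : lin L (fun t => f t + g t) = lin L f + lin L g.
Proof. by rewrite /lin -big_split; apply: eq_bigr => p _ /=; rewrite mulrDr. Qed.

Lemma linZ L a f : lin L (fun t => a * f t) = a * lin L f.
Proof. by rewrite /lin mulr_sumr; apply: eq_bigr => p _; rewrite mulrCA. Qed.

Lemma lin1 a h f : lin [:: (a, h)] f = a * f h.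
Proof. by rewrite /lin big_seq1. Qed.

Lemma lin_le L f M : (forall t, `|f t| <= M) ->
  `|lin L f| <= (\sum_(p <- L) `|p.1|) * M.
Proof.
move=> fM; rewrite /lin (le_trans (ler_norm_sum _ _ _))// mulr_suml.
by apply: ler_sum => p _; rewrite normrM ler_wpM2l.
Qed.

(** real and imaginary parts of the spectral function of a functional *)
Definition cosL L (x : R) := lin L (fun t => cos (t * x)).
Definition sinL L (x : R) := lin L (fun t => sin (t * x)).

Lemma measurable_lin (d : measure_display) (T : measurableType d) L (f : R -> T -> R) :
  (forall t, measurable_fun setT (f t)) ->
  measurable_fun setT (fun x => lin L (fun t => f t x)).
Proof.
move=> mf; rewrite /lin; apply: measurable_sum => p.
by apply: measurable_funM => //.
Qed.

Lemma measurable_cosL L : measurable_fun setT (cosL L).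
Proof.
apply: measurable_lin => t; apply: measurableT_comp => //.
exact: (continuous_measurable_fun (@continuous_cos R)).
Qed.

Lemma measurable_sinL L : measurable_fun setT (sinL L).
Proof.
apply: measurable_lin => t; apply: measurableT_comp => //.
exact: (continuous_measurable_fun (@continuous_sin R)).
Qed.

Let massL L : R := \sum_(p <- L) `|p.1|.

Lemma cosL_le L x : `|cosL L x| <= \sum_(p <- L) `|p.1|.
Proof. by rewrite (le_trans (lin_le _ (fun t => cos_max (t * x)))) ?mulr1. Qed.

Lemma sinL_le L x : `|sinL L x| <= \sum_(p <- L) `|p.1|.
Proof. by rewrite (le_trans (lin_le _ (fun t => sin_max (t * x)))) ?mulr1. Qed.

End Functionals.

Section Covariance.
Context {R : realType} (mu : probability (measurableTypeR R) R).
Implicit Types (L : seq (R * R)).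

Definition cov L L' : R :=
  \int[mu]_x (cosL L x * cosL L' x + sinL L x * sinL L' x).

Lemma integrable_cov L L' :
  mu.-integrable setT (EFin \o (fun x => cosL L x * cosL L' x + sinL L x * sinL L' x)).
Proof.
pose M : seq (R * R) -> R := fun L => \sum_(p <- L) `|p.1|.
apply: (@integrable_bounded _ _ _ _ _ (M L * M L' + M L * M L')).
  by apply: measurable_funD; apply: measurable_funM;
    solve [exact: measurable_cosL|exact: measurable_sinL].
move=> x; rewrite (le_trans (ler_normD _ _))// !normrM.
by rewrite lerD// ler_pM// ?cosL_le ?sinL_le.
Qed.

Lemma covC L L' : cov L L' = cov L' L.
Proof. by apply: eq_Rintegral => x _; ring. Qed.

Lemma cov_catl L1 L2 L' : cov (L1 ++ L2) L' = cov L1 L' + cov L2 L'.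
Proof.
rewrite /cov -RintegralD//; try exact: integrable_cov.
by apply: eq_Rintegral => x _; rewrite /cosL /sinL !lin_cat; ring.
Qed.

Lemma cov_scalel a L L' : cov (scaleL a L) L' = a * cov L L'.
Proof.
rewrite /cov -RintegralZl//; last exact: integrable_cov.
by apply: eq_Rintegral => x _; rewrite /cosL /sinL !lin_scale; ring.
Qed.

Lemma cov_ge0 L : 0 <= cov L L.
Proof. by apply: Rintegral_ge0 => x _; rewrite -!expr2 addr_ge0// sqr_ge0. Qed.

Lemma cov1 a t : cov [:: (a, t)] [:: (a, t)] = a ^+ 2.
Proof.
rewrite /cov -[RHS](Rintegral_prob_cst mu); apply: eq_Rintegral => x _.
rewrite /cosL /sinL !lin1 -[RHS]mulr1 -(cos2Dsin2 (t * x)); ring.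
Qed.

End Covariance.

Section Process.
Context {R : realType} (mu : probability (measurableTypeR R) R)
  (d : measure_display) (Omega : measurableType d) (P : probability Omega R)
  (X : R -> {RV P >-> R}).
Hypothesis hX : smooth_stationary_gaussian mu X.
Implicit Types (L : seq (R * R)).

Definition rv L (w : Omega) : R := lin L (fun t => X t w).

Let mX t : measurable_fun setT (X t : Omega -> R). Proof. exact: measurable_funP. Qed.

Lemma measurable_rv L : measurable_fun setT (rv L).
Proof. exact: measurable_lin. Qed.

Let gauss_rv L : gaussian_law (pushforward P (rv L : Omega -> measurableTypeR R)).
Proof.
case: hX => hg _ _ _ _.
have := hg (size L) (fun i => (nth (0, 0) L i).2) (fun i => (nth (0, 0) L i).1).
rewrite (_ : (fun w => _) = rv L)//; apply/funext => w.
by rewrite /rv /lin (big_nth (0, 0)) big_mkord.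
Qed.

Let facts L := gaussian_law_facts (measurable_rv L) (gauss_rv L).

Let rv1 t : rv [:: (1, t)] = X t.
Proof. by apply/funext => w; rewrite /rv lin1 mul1r. Qed.

Let int_X t : P.-integrable setT (EFin \o X t).
Proof. by have [m [v [[_ + _ _ _] _]]] := facts [:: (1, t)]; rewrite rv1. Qed.

Let int_X2 t : P.-integrable setT (EFin \o (fun w => (X t w) ^+ 2)).
Proof. by have [m [v [[_ _ _ + _] _]]] := facts [:: (1, t)]; rewrite rv1. Qed.

Let int_XX t s : P.-integrable setT (EFin \o (fun w => X t w * X s w)).
Proof.
have := integrableD measurableT (int_X2 t) (int_X2 s).
move=> /le_integrable; apply => //.
  by apply/measurable_EFinP; apply: measurable_funM.
move=> w _ /=; rewrite lee_fin normrM -(real_normK (num_real (X t w))).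
rewrite -(real_normK (num_real (X s w))) [leRHS]ger0_norm ?addr_ge0 ?sqr_ge0//.
by have := normr_ge0 (X t w); have := normr_ge0 (X s w); nra.
Qed.

Let mean_X t : \int[P]_w X t w = 0.
Proof.
case: hX => _ hc _ _ _; have := hc t; rewrite unlock => h.
by rewrite /Rintegral h.
Qed.

Let cov_X0 t : \int[P]_w (X t w * X 0 w) = \int[mu]_x cos (t * x).
Proof.
case: hX => _ _ _ hs _; have [+ _] := hs t; rewrite unlock => h.
by rewrite /Rintegral h; congr fine; apply: eq_integral => x _; rewrite cosN.
Qed.

Let cov_X t s : \int[P]_w (X t w * X s w) = \int[mu]_x cos ((t - s) * x).
Proof.
rewrite -cov_X0; case: hX => _ _ hstat _ _.
pose u (i : 'I_2) : R := if i == ord0 then t - s else 0.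
pose V0 (w : Omega) := [tuple X (u i) w | i < 2].
pose V1 (w : Omega) := [tuple X (u i + s) w | i < 2].
have mV0 : measurable_fun setT (V0 : Omega -> 2.-tuple (measurableTypeR R)).
  apply/measurable_fun_tnthP => i; have := mX (u i).
  by apply: eq_measurable_fun => w _ /=; rewrite tnth_mktuple.
have mV1 : measurable_fun setT (V1 : Omega -> 2.-tuple (measurableTypeR R)).
  apply/measurable_fun_tnthP => i; have := mX (u i + s).
  by apply: eq_measurable_fun => w _ /=; rewrite tnth_mktuple.
pose f (v : 2.-tuple (measurableTypeR R)) : \bar R :=
  ((tnth v ord0 : R) * (tnth v ord_max : R))%:E.
have mf : measurable_fun setT f.
  apply/measurable_EFinP; apply: measurable_funM; exact: measurable_tnth.
have E1 w : f (V1 w) = (X t w * X s w)%:E.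
  by rewrite /f !tnth_mktuple /u /= subrK add0r.
have E0 w : f (V0 w) = (X (t - s) w * X 0 w)%:E.
  by rewrite /f !tnth_mktuple /u.
congr fine.
transitivity (\int[pushforward P V1]_v f v)%E.
  rewrite integral_pushforward//=.
    by apply: eq_integral => w _; rewrite -E1.
  by have := int_XX t s; apply: eq_integrable => // w _; rewrite /= E1.
transitivity (\int[pushforward P V0]_v f v)%E.
  by apply: eq_measure_integral => A mA _; exact: hstat.
rewrite integral_pushforward//=.
  by apply: eq_integral => w _; rewrite -E0.
by have := int_XX (t - s) 0; apply: eq_integrable => // w _; rewrite /= E0.
Qed.

Let int_cos t : mu.-integrable setT (EFin \o (fun x => cos (t * x))).
Proof.
apply: (@integrable_bounded _ _ _ _ _ 1); last by move=> x; exact: cos_max.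
by apply: measurableT_comp => //; exact: (continuous_measurable_fun (@continuous_cos R)).
Qed.

Lemma rv_mean L : \int[P]_w rv L w = 0.
Proof.
rewrite /rv /lin Rintegral_sumR => [|p]; last first.
  by have := integrableZl measurableT p.1 (int_X p.2); apply: eq_integrable.
by rewrite big1// => p _; rewrite RintegralZl ?mean_X ?mulr0.
Qed.

Lemma rv_sqr L : \int[P]_w (rv L w) ^+ 2 = cov mu L L.
Proof.
transitivity (\sum_(p <- L) \sum_(q <- L) p.1 * q.1 * \int[mu]_x cos ((p.2 - q.2) * x)).
  have iXX (p q : R * R) : P.-integrable setT
      (EFin \o (fun w => p.1 * q.1 * (X p.2 w * X q.2 w))).
    by have := integrableZl measurableT (p.1 * q.1) (int_XX p.2 q.2); apply: eq_integrable.
  under eq_Rintegral => w _.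
    rewrite expr2 {1}/rv /lin mulr_suml.
    under eq_bigr => p _ do
      (rewrite /rv /lin mulr_sumr; under eq_bigr => q _ do rewrite mulrACA).
    over.
  rewrite Rintegral_sumR => [|p]; last by apply: integrable_sumR => q; exact: iXX.
  apply: eq_bigr => p _; rewrite Rintegral_sumR => [|q]; last exact: iXX.
  by apply: eq_bigr => q _; rewrite RintegralZl ?cov_X.
have icc (p q : R * R) : mu.-integrable setT
      (EFin \o (fun x => p.1 * q.1 * cos ((p.2 - q.2) * x))).
  by have := integrableZl measurableT (p.1 * q.1) (int_cos (p.2 - q.2)); apply: eq_integrable.
transitivity (\int[mu]_x (\sum_(p <- L) \sum_(q <- L) p.1 * q.1 * cos ((p.2 - q.2) * x))).
  rewrite Rintegral_sumR => [|p]; last by apply: integrable_sumR => q; exact: icc.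
  apply: eq_bigr => p _; rewrite Rintegral_sumR => [|q]; last exact: icc.
  by apply: eq_bigr => q _; rewrite RintegralZl.
apply: eq_Rintegral => x _; rewrite /cosL /sinL /lin !mulr_suml -big_split/=.
apply: eq_bigr => p _; rewrite !mulr_sumr -big_split/=.
apply: eq_bigr => q _; rewrite mulrBl cosB; ring.
Qed.

(** a functional of the process is a centered normal variable *)
Lemma rv_cos L t : \int[P]_w cos (rv L w + t) = expR (- cov mu L L / 2) * cos t.
Proof.
have [m [v [[_ _ Em _ Ev] [Hc _]]]] := facts L.
move: Em Ev; rewrite rv_mean rv_sqr => m0; rewrite -m0 expr0n add0r => ->.
by rewrite Hc -m0 add0r.
Qed.

Lemma rv_exp_sqr L c : cov mu L L <= c -> 0 < c ->
  (\int[P]_w (expR ((rv L w) ^+ 2 / (4 * c)))%:E <= (Num.sqrt 2)%:E)%E.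
Proof.
have [m [v [[_ _ Em _ Ev] [_ He]]]] := facts L.
move: Em Ev; rewrite rv_mean rv_sqr => m0; rewrite -m0 expr0n add0r => ->.
by move=> h1 h2; exact: He.
Qed.

Lemma rv_integrable_sqr L : P.-integrable setT (EFin \o (fun w => (rv L w) ^+ 2)).
Proof. by have [m [v [[_ _ _ + _] _]]] := facts L. Qed.

End Process.

Section FubiniBounded.
Context {R : realType} (d1 d2 : measure_display) (T1 : measurableType d1)
  (T2 : measurableType d2) (P1 : probability T1 R) (P2 : probability T2 R).

Lemma Fubini_bounded (f : T1 * T2 -> R) (M : R) : measurable_fun setT f ->
  (forall z, `|f z| <= M) ->
  \int[P1]_x \int[P2]_y f (x, y) = \int[P2]_y \int[P1]_x f (x, y).
Proof.
move=> mf fM.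
have i12 : (P1 \x P2)%E.-integrable setT (EFin \o f).
  apply/integrable12ltyP; first exact/measurable_EFinP.
  apply: (@le_lt_trans _ _ (\int[P1]_x \int[P2]_y M%:E)%E); last first.
    rewrite (_ : (fun x => _) = cst M%:E); last first.
      by apply/funext => x; rewrite integral_cst// [X in (_ * X)%E]probability_setT mule1.
    by rewrite integral_cst// [X in (_ * X)%E]probability_setT mule1 ltry.
  have mf1 : measurable_fun setT (fun z => `|(f z)%:E|%E).
    by apply: measurableT_comp => //; exact/measurable_EFinP.
  apply: ge0_le_integral => //.
  - by move=> x _; exact: integral_ge0.
  - apply: (@measurable_fun_fubini_tonelli_F _ _ _ _ _ P2 (fun z => `|(f z)%:E|%E))=> //.
  - move=> x _; apply: ge0_le_integral => //=.
    + by apply: (measurableT_comp mf1); exact: measurable_pair1.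
    + by move=> y _; rewrite lee_fin.
have mx x : measurable_fun setT (fun y => f (x, y)).
  by apply: (measurableT_comp mf); exact: measurable_pair1.
have my y : measurable_fun setT (fun x => f (x, y)).
  by apply: (measurableT_comp mf); exact: measurable_pair2.
have := Fubini i12; rewrite /= => H.
congr fine.
transitivity (\int[P1]_x \int[P2]_y (f (x, y))%:E)%E.
  by apply: eq_integral => x _; rewrite EFin_Rintegral//; exact: integrable_bounded (mx x) _.
rewrite H; apply: eq_integral => y _; rewrite EFin_Rintegral//.
exact: integrable_bounded (my y) _.
Qed.

End FubiniBounded.

Section GaussKernel.
Context {R : realType}.
Implicit Types (s a x z : R).

Lemma normal_fourier s a : 0 <= s ->
  \int[normal_prob 0 1]_x (expR (- (s * x ^+ 2)) * cos (a * x)) =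
  (Num.sqrt (1 + 2 * s))^-1 * expR (- (a ^+ 2) / (2 * (1 + 2 * s))).
Proof.
move=> s0; set c := 1 + 2 * s.
have c0 : 0 < c by rewrite /c; lra.
pose tau : R := (Num.sqrt c)^-1.
have tau0 : 0 < tau by rewrite invr_gt0 sqrtr_gt0.
have tau2 : tau ^+ 2 = c^-1 by rewrite exprVn sqr_sqrtr// ltW.
have tn0 : tau != 0 by rewrite gt_eqF.
have cfun : continuous (fun x : R => expR (- (s * x ^+ 2)) * cos (a * x)).
  move=> x; apply: cvgM.
    apply: (cvg_comp (fun x => - (s * x ^+ 2)) expR); last exact: continuous_expR.
    by apply: cvgN; apply: cvgM; [exact: cvg_cst|exact: sqr_continuous].
  apply: (cvg_comp (fun x => a * x) cos); last exact: continuous_cos.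
  by apply: cvgM; [exact: cvg_cst|exact: cvg_id].
have bfun x : `|expR (- (s * x ^+ 2)) * cos (a * x)| <= 1 * (1 + (x - 0) ^+ 2).
  rewrite normrM mul1r (@le_trans _ _ 1)//; last by rewrite lerDl sqr_ge0.
  rewrite ger0_norm ?expR_ge0// mulr_ile1 ?expR_ge0 ?cos_max//.
  by rewrite -[leRHS]expR0 ler_expR oppr_le0 mulr_ge0// sqr_ge0.
have ccos : continuous (fun x : R => cos (a * x + 0)).
  move=> x; apply: (cvg_comp (fun x => a * x + 0) cos); last exact: continuous_cos.
  by apply: cvgD; [apply: cvgM; [exact: cvg_cst|exact: cvg_id]|exact: cvg_cst].
have bcos x : `|cos (a * x + 0)| <= 1 * (1 + (x - 0) ^+ 2).
  by rewrite mul1r (@le_trans _ _ 1) ?cos_max// lerDl sqr_ge0.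
rewrite (@Rintegral_normal _ 0 1 (oner_neq0 _) _ 1 cfun bfun).
transitivity (\int[lebesgue_measure]_x (tau * (cos (a * x + 0) * normal_pdf 0 tau x))).
  apply: eq_Rintegral => x _; rewrite addr0 !normal_pdfE ?oner_neq0// /normal_fun !subr0.
  have -> : normal_peak 1 = tau * normal_peak tau :> R.
    rewrite /normal_peak expr1n mul1r tau2 -mulrnAr sqrtrM ?invr_ge0 ?(ltW c0)//.
    by rewrite invfM sqrtrV ?(ltW c0)// invrK /tau mulrA mulVf ?mul1r// gt_eqF// sqrtr_gt0.
  have -> : expR (- x ^+ 2 / (tau ^+ 2 *+ 2)) = expR (- (s * x ^+ 2)) * expR (- x ^+ 2 / (1 ^+ 2 *+ 2)).
    rewrite -expRD tau2; congr expR; rewrite /c; field.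
    by rewrite gt_eqF//; lra.
  ring.
rewrite RintegralZl//; last exact: (integrable_normal_dom tn0 ccos bcos).
congr (_ * _); rewrite -(@Rintegral_normal _ 0 tau tn0 _ 1 ccos bcos).
have := normal_char_fun 0 tn0 a 0; under eq_Rintegral do rewrite subr0.
by move=> ->; rewrite cos0 mulr1 tau2; congr expR; rewrite invfM; field; rewrite gt_eqF.
Qed.

Context (d : measure_display) (Omega : measurableType d) (P : probability Omega R).

(** the Gaussian kernel is a mixture of characters *)
Lemma gauss_linearize (g Y : Omega -> R) s z M : measurable_fun setT g ->
  measurable_fun setT Y -> (forall w, `|g w| <= M) -> 0 <= s ->
  \int[P]_w (g w * expR (- (s * (Y w - z) ^+ 2))) =
  \int[normal_prob 0 1]_x \int[P]_w (g w * cos (Num.sqrt (2 * s) * x * (Y w - z))).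
Proof.
move=> mg mY gM s0.
have mcos : measurable_fun setT (@cos R) by exact: (continuous_measurable_fun (@continuous_cos R)).
pose f (q : Omega * measurableTypeR R) : R := g q.1 * cos (Num.sqrt (2 * s) * q.2 * (Y q.1 - z)).
have mf : measurable_fun setT f.
  apply: measurable_funM; first by apply: measurableT_comp.
  apply: measurableT_comp => //; apply: measurable_funM.
    by apply: measurable_funM => //; exact: measurable_snd.
  by apply: measurable_funB => //; apply: measurableT_comp.
have fM q : `|f q| <= M.
  by rewrite /f normrM -[leRHS]mulr1 ler_pM ?cos_max.
have := @Fubini_bounded _ _ _ _ _ P (normal_prob 0 1) f M mf fM; rewrite /f /= => <-.
apply: eq_Rintegral => w _.
have h := normal_char_fun 0 (oner_neq0 R) (Num.sqrt (2 * s) * (Y w - z)) 0.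
have ic : (normal_prob 0 1).-integrable setT
   (EFin \o ((fun x => cos (Num.sqrt (2 * s) * (Y w - z) * (x - 0) + 0)) : measurableTypeR R -> R)).
  apply: (@integrable_bounded _ _ _ _ _ 1); last by move=> x; exact: cos_max.
  apply: measurableT_comp => //; apply: measurable_funD => //; apply: measurable_funM => //.
  by apply: measurable_funB.
rewrite (@eq_Rintegral _ _ _ (normal_prob 0 1) setT
   (fun x : measurableTypeR R => g w * cos (Num.sqrt (2 * s) * (Y w - z) * (x - 0) + 0))); last first.
  by move=> x _; congr (_ * cos _); ring.
rewrite RintegralZl// h cos0 mulr1 exprMn sqr_sqrtr ?mulr_ge0//.
by congr (_ * expR _); field.
Qed.

End GaussKernel.

Section GaussProduct.
Context {R : realType} (mu : probability (measurableTypeR R) R)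
  (d : measure_display) (Omega : measurableType d) (P : probability Omega R)
  (X : R -> {RV P >-> R}).
Hypothesis hX : smooth_stationary_gaussian mu X.
Local Notation rv := (rv X).
Local Notation cov := (cov mu).

Lemma rv_cat L L' w : rv (L ++ L') w = rv L w + rv L' w.
Proof. exact: lin_cat. Qed.

Lemma rv_scale a L w : rv (scaleL a L) w = a * rv L w.
Proof. exact: lin_scale. Qed.

Section Family.
Variables (I : eqType) (Z : I -> seq (R * R)) (z : I -> R) (s : R).
Hypothesis s0 : 0 <= s.
Hypothesis Zorth : forall i j, cov (Z i) (Z j) = (i == j)%:R.

Definition gker (l : seq I) (w : Omega) : R :=
  \prod_(i <- l) expR (- (s * (rv (Z i) w - z i) ^+ 2)).

Lemma measurable_gker l : measurable_fun setT (gker l).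
Proof.
elim: l => [|i l IH].
  by rewrite (_ : gker _ = cst 1)//; apply/funext => w; rewrite /gker big_nil.
rewrite (_ : gker _ = (fun w => expR (- (s * (rv (Z i) w - z i) ^+ 2)) * gker l w)).
  apply: measurable_funM => //; apply: measurableT_comp => //.
  apply: measurableT_comp => //; apply: measurable_funM => //.
  by apply: measurable_funX; apply: measurable_funB => //; exact: measurable_rv.
by apply/funext => w; rewrite /gker big_cons.
Qed.

Lemma gker_ge0 l w : 0 <= gker l w.
Proof. by apply: prodr_ge0 => i _; exact: expR_ge0. Qed.

Lemma gker_le1 l w : gker l w <= 1.
Proof.
apply: prodr_ile1 => i _; rewrite expR_ge0/= -[leRHS]expR0 ler_expR oppr_le0.
by rewrite mulr_ge0// sqr_ge0.
Qed.

Let gker_norm l w : `|gker l w| <= 1.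
Proof. by rewrite ger0_norm ?gker_ge0 ?gker_le1. Qed.

Lemma measurable_cos_rv W t : measurable_fun setT (fun w => cos (rv W w + t)).
Proof.
apply: measurableT_comp; first exact: (continuous_measurable_fun (@continuous_cos R)).
by apply: measurable_funD => //; exact: measurable_rv.
Qed.

Lemma integrable_gker_cos l W t :
  P.-integrable setT (EFin \o (fun w => gker l w * cos (rv W w + t))).
Proof.
apply: (@integrable_bounded _ _ _ _ _ 1).
  by apply: measurable_funM; [exact: measurable_gker|exact: measurable_cos_rv].
by move=> w; rewrite normrM mulr_ile1 ?cos_max.
Qed.

(** joint Fourier transform of independent Gaussian kernels *)
Lemma gker_cos l : uniq l -> forall W, (forall i, i \in l -> cov (Z i) W = 0) ->
  forall t, \int[P]_w (gker l w * cos (rv W w + t)) =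
   (\prod_(i <- l) ((Num.sqrt (1 + 2 * s))^-1 * expR (- (s * z i ^+ 2) / (1 + 2 * s))))
   * (expR (- cov W W / 2) * cos t).
Proof.
elim: l => [|i l IH] /=.
  move=> _ W _ t; rewrite big_nil mul1r -(rv_cos hX).
  by apply: eq_Rintegral => w _; rewrite /gker big_nil mul1r.
case/andP => il ul W Worth t.
have c0 : 0 < 1 + 2 * s by rewrite ltr_pwDl// mulr_ge0.
rewrite big_cons; set K := \prod_(j <- l) _.
have {}IH := IH ul.
have iW : cov (Z i) W = 0 by apply: Worth; rewrite mem_head.
transitivity (\int[P]_w ((gker l w * cos (rv W w + t)) *
    expR (- (s * (rv (Z i) w - z i) ^+ 2)))).
  by apply: eq_Rintegral => w _; rewrite /gker big_cons; ring.
rewrite (@gauss_linearize _ _ _ _ _ _ s (z i) 1)//; last 3 first.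
- by apply: measurable_funM; [exact: measurable_gker|exact: measurable_cos_rv].
- exact: measurable_rv.
- by move=> w; rewrite normrM mulr_ile1 ?cos_max.
pose a (x : R) : R := Num.sqrt (2 * s) * x.
have a2 x : a x ^+ 2 = 2 * s * x ^+ 2.
  by rewrite /a exprMn sqr_sqrtr// mulr_ge0.
have covW x : cov (W ++ scaleL x (Z i)) (W ++ scaleL x (Z i)) = cov W W + x ^+ 2.
  rewrite cov_catl cov_scalel !(covC mu _ (W ++ _)) !cov_catl !cov_scalel.
  by rewrite iW (covC mu W (Z i)) iW Zorth eqxx /=; ring.
have orthW x j : j \in l -> cov (Z j) (W ++ scaleL x (Z i)) = 0.
  move=> jl; rewrite covC cov_catl cov_scalel covC Worth ?inE ?jl ?orbT//.
  by rewrite Zorth [i == j](_ : _ = false) ?mulr0 ?addr0//; apply: contraNF il => /eqP ->.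
have E (x : R) : \int[P]_w (gker l w * cos (rv W w + t) * cos (Num.sqrt (2 * s) * x * (rv (Z i) w - z i))) =
   (K * (expR (- cov W W / 2) * cos t)) * (expR (- (s * x ^+ 2)) * cos (Num.sqrt (2 * s) * z i * x)).
  transitivity (\int[P]_w (2^-1 * (gker l w * cos (rv (W ++ scaleL (a x) (Z i)) w + (t - a x * z i))
    + gker l w * cos (rv (W ++ scaleL (- a x) (Z i)) w + (t + a x * z i))))).
    apply: eq_Rintegral => w _; rewrite !rv_cat !rv_scale -/(a x).
    set A := rv W w + t; set B := a x * (rv (Z i) w - z i).
    rewrite (_ : _ + _ + (t - _) = A + B); last by rewrite /A /B; ring.
    rewrite (_ : _ + _ + (t + _) = A - B); last by rewrite /A /B; ring.
    by move: A B => A B; rewrite cosD cosB; field.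
  have i1 := integrable_gker_cos l (W ++ scaleL (a x) (Z i)) (t - a x * z i).
  have i2 := integrable_gker_cos l (W ++ scaleL (- a x) (Z i)) (t + a x * z i).
  have i12 := integrableD measurableT i1 i2.
  rewrite RintegralZl// RintegralD// !IH; try by move=> j; exact: orthW.
  rewrite -!/K !covW sqrrN a2 cosB cosD.
  rewrite (_ : - (cov W W + 2 * s * x ^+ 2) / 2 = - cov W W / 2 - s * x ^+ 2); last by field.
  by rewrite expRD (_ : a x * z i = Num.sqrt (2 * s) * z i * x); [field|rewrite /a; ring].
rewrite (@eq_Rintegral _ _ _ _ _ (fun x : measurableTypeR R => (K * (expR (- cov W W / 2) * cos t)) * (expR (- (s * x ^+ 2)) * cos (Num.sqrt (2 * s) * z i * x)))); last first.
  by move=> x _; exact: E.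
rewrite RintegralZl//; last first.
  apply: (@integrable_bounded _ _ _ _ _ 1).
    apply: measurable_funM.
      by apply: measurableT_comp => //; apply: measurableT_comp => //; apply: measurable_funM => //.
    apply: measurableT_comp; first exact: (continuous_measurable_fun (@continuous_cos R)).
    by apply: measurable_funM.
  move=> x; rewrite normrM mulr_ile1 ?cos_max// ger0_norm ?expR_ge0//.
  by rewrite -[leRHS]expR0 ler_expR oppr_le0 mulr_ge0// sqr_ge0.
rewrite normal_fourier//.
rewrite (_ : - (Num.sqrt (2 * s) * z i) ^+ 2 / (2 * (1 + 2 * s)) = - (s * z i ^+ 2) / (1 + 2 * s)); first by ring.
by rewrite exprMn sqr_sqrtr ?mulr_ge0//; field; rewrite gt_eqF.
Qed.

Lemma gker_mean l : uniq l -> \int[P]_w gker l w =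
  \prod_(i <- l) ((Num.sqrt (1 + 2 * s))^-1 * expR (- (s * z i ^+ 2) / (1 + 2 * s))).
Proof.
move=> ul; have n0 L : cov L [::] = 0.
  by rewrite covC -[[::]](_ : scaleL 0 [::] = _)// cov_scalel mul0r.
have := gker_cos ul (W := [::]) (fun i _ => n0 (Z i)) 0.
rewrite n0 cos0 oppr0 mul0r expR0 !mulr1 => <-.
by apply: eq_Rintegral => w _; rewrite /rv /lin big_nil addr0 cos0 mulr1.
Qed.

End Family.

End GaussProduct.

Section GaussBounds.
Context {R : realType} (mu : probability (measurableTypeR R) R)
  (d : measure_display) (Omega : measurableType d) (P : probability Omega R)
  (X : R -> {RV P >-> R}).
Hypothesis hX : smooth_stationary_gaussian mu X.
Local Notation rv := (rv X).
Local Notation cov := (cov mu).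
Variables (m : nat) (Z : 'I_m -> seq (R * R)).
Hypothesis Zorth : forall i j, cov (Z i) (Z j) = (i == j)%:R.

Let D (z : 'I_m -> R) w := \sum_(i < m) (rv (Z i) w - z i) ^+ 2.

Let measurable_D z : measurable_fun setT (D z).
Proof.
apply: measurable_sum => i; apply: measurable_funX.
by apply: measurable_funB => //; exact: measurable_rv.
Qed.

Let D_ge0 z w : 0 <= D z w.
Proof. by apply: sumr_ge0 => i _; exact: sqr_ge0. Qed.

Let expD (z : 'I_m -> R) s : 0 <= s ->
  P.-integrable setT (EFin \o (fun w => expR (- (s * D z w)))) /\
  \int[P]_w expR (- (s * D z w)) =
  (Num.sqrt (1 + 2 * s))^-1 ^+ m * expR (- (s * \sum_(i < m) z i ^+ 2) / (1 + 2 * s)).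
Proof.
move=> s0; split.
  apply: (@integrable_bounded _ _ _ _ _ 1).
    by apply: measurableT_comp => //; apply: measurableT_comp => //; apply: measurable_funM.
  by move=> w; rewrite ger0_norm ?expR_ge0// -[leRHS]expR0 ler_expR oppr_le0 mulr_ge0.
have := gker_mean hX z s0 Zorth (index_enum_uniq 'I_m).
rewrite big_split/= prodr_const card_ord -expR_sum.
rewrite [X in _ * expR X](_ : _ = - (s * \sum_(i < m) z i ^+ 2) / (1 + 2 * s)); last first.
  by rewrite mulr_sumr -sumrN mulr_suml.
move=> <-; apply: eq_Rintegral => w _.
by rewrite /gker -expR_sum sumrN -mulr_sumr.
Qed.

Let fineP (A : set Omega) : measurable A -> P A = (\int[P]_w \1_A w)%:E.
Proof.
move=> mA; rewrite /Rintegral integral_indic// setIT fineK//.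
exact: fin_num_measure.
Qed.

(** small ball estimate for independent standard normal variables *)
Lemma small_ball (r : R) (A : set Omega) : 0 < r -> measurable A ->
  (forall w, A w -> forall i, `|rv (Z i) w| <= r) ->
  (P A <= ((2 * r) ^+ m)%:E)%E.
Proof.
move=> r0 mA HA; pose s := (2 * r ^+ 2)^-1.
have r2 : 0 < r ^+ 2 by rewrite exprn_gt0.
have s0 : 0 <= s by rewrite invr_ge0 mulr_ge0// ltW.
have [iD ED] := expD (fun=> 0) s0.
rewrite fineP// lee_fin.
apply: (@le_trans _ _ (\int[P]_w (expR (2^-1) ^+ m * expR (- (s * D (fun=> 0) w))))).
  apply: le_Rintegral => //.
  - apply: (@integrable_bounded _ _ _ _ _ 1) => //.
    by move=> w; rewrite indicE; case: (_ \in _); rewrite ?normr1 ?normr0.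
  - by have := integrableZl measurableT (expR (2^-1) ^+ m) iD; apply: eq_integrable.
  - move=> w _; rewrite indicE; have [/set_mem wA|_] := boolP (w \in A); last first.
      by rewrite mulr_ge0 ?exprn_ge0 ?expR_ge0.
    rewrite -expRM_natl -expRD -[leLHS]expR0 ler_expR /D /=.
    rewrite mulr_sumr -sumrN (_ : m%:R * 2^-1 = \sum_(i < m) 2^-1); last first.
      by rewrite sumr_const card_ord mulr_natl.
    rewrite -big_split/=; apply: sumr_ge0 => i _; rewrite subr0 subr_ge0.
    have h : rv (Z i) w ^+ 2 <= r ^+ 2.
      rewrite -(real_normK (num_real _)) lerXn2r ?nnegrE ?(ltW r0)//.
      exact: HA.
    by rewrite /s invfM -mulrA ler_piMr// mulrC ler_pdivrMr// mul1r.
rewrite RintegralZl// ED big1 ?mulr0 ?oppr0 ?mul0r ?expR0 ?mulr1; last first.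
  by move=> i _; rewrite expr0n.
rewrite -exprMn lerXn2r ?nnegrE ?mulr_ge0 ?invr_ge0 ?sqrtr_ge0 ?expR_ge0 ?(ltW r0)//.
have h1 : r^-1 <= Num.sqrt (1 + 2 * s).
  rewrite -[leLHS]gtr0_norm ?invr_gt0// -sqrtr_sqr ler_wsqrtr//.
  by rewrite /s invfM mulrA divff// mul1r exprVn lerDr.
have h2 : expR (2^-1) <= 2 :> R.
  rewrite -[leRHS]invrK -[leLHS]invrK lef_pV2 ?posrE ?invr_gt0 ?expR_gt0// -expRN.
  by apply: le_trans (expR_ge1Dx _); lra.
rewrite ler_pdivrMr ?sqrtr_gt0 ?ltr_pwDl ?mulr_ge0//.
apply: (le_trans h2); rewrite -mulrA ler_peMr// mulrC -ler_pdivrMr//.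
by rewrite mul1r.
Qed.

(** independent standard normal variables come close to any target of norm at
    most 1 *)
Lemma near_target (rho : R) (z : 'I_m -> R) (A : set Omega) : 0 < rho ->
  \sum_(i < m) z i ^+ 2 <= 1 -> measurable A ->
  (forall w, \sum_(i < m) (rv (Z i) w - z i) ^+ 2 <= rho ^+ 2 -> A w) ->
  ((8^-1 * (Num.sqrt (1 + 4 * m.+1%:R / rho ^+ 2))^-1 ^+ m)%:E <= P A)%E.
Proof.
move=> rho0 z1 mA HA; pose s := 2 * m.+1%:R / rho ^+ 2.
have r2 : 0 < rho ^+ 2 by rewrite exprn_gt0.
have s0 : 0 <= s by rewrite divr_ge0// ltW.
have s20 : 0 <= s / 2 by rewrite divr_ge0.
have [i1 E1] := expD z s0; have [i2 E2] := expD z s20.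
have c0 : 0 < 1 + 2 * s by rewrite ltr_pwDl// mulr_ge0.
have c0' : 0 < 1 + s by rewrite ltr_pwDl.
have Z0 : 0 <= \sum_(i < m) z i ^+ 2 by apply: sumr_ge0 => i _; exact: sqr_ge0.
rewrite fineP// lee_fin.
have iA : P.-integrable setT (EFin \o (\1_A : Omega -> R)).
  apply: (@integrable_bounded _ _ _ _ _ 1) => //.
  by move=> w; rewrite indicE; case: (_ \in _); rewrite ?normr1 ?normr0.
pose e : R := expR (- m.+1%:R).
have i3 : P.-integrable setT (EFin \o (fun w => e * expR (- (s / 2 * D z w)))).
  by have := integrableZl measurableT e i2; apply: eq_integrable.
have H : \int[P]_w expR (- (s * D z w)) <= \int[P]_w (\1_A w + e * expR (- (s / 2 * D z w))).
  apply: le_Rintegral => //.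
    by have := integrableD measurableT iA i3; apply: eq_integrable.
  move=> w _; have [Dr|Dr] := leP (D z w) (rho ^+ 2).
    rewrite indicE mem_set; last exact: HA.
    rewrite (@le_trans _ _ 1)//; last by rewrite lerDl mulr_ge0 ?expR_ge0.
    by rewrite -[leRHS]expR0 ler_expR oppr_le0 mulr_ge0.
  rewrite (@le_trans _ _ (e * expR (- (s / 2 * D z w))))//; last by rewrite lerDr indicE.
  rewrite /e -expRD ler_expR.
  rewrite -subr_ge0 (_ : _ - _ = s / 2 * (D z w - rho ^+ 2)); last first.
    by rewrite /s; field; rewrite gt_eqF.
  by rewrite mulr_ge0// subr_ge0 ltW.
move: H; rewrite RintegralD// RintegralZl// E1 E2 => H.
set A1 := \int[P]_w \1_A w in H *.
set b := (Num.sqrt (1 + 2 * s))^-1 ^+ m.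
have b0 : 0 < b by rewrite exprn_gt0// invr_gt0 sqrtr_gt0.
have h1 : b * expR (- 2^-1) <= b * expR (- (s * \sum_(i < m) z i ^+ 2) / (1 + 2 * s)).
  rewrite ler_wpM2l ?(ltW b0)// ler_expR mulNr lerN2 ler_pdivrMr//.
  by rewrite (@le_trans _ _ (s * 1)) ?ler_wpM2l//; lra.
have h2 : e * ((Num.sqrt (1 + 2 * (s / 2)))^-1 ^+ m * expR (- (s / 2 * \sum_(i < m) z i ^+ 2) / (1 + 2 * (s / 2)))) <= b * expR (- 1).
  rewrite (_ : 2 * (s / 2) = s); last by field.
  apply: (@le_trans _ _ (e * ((Num.sqrt (1 + s))^-1 ^+ m * 1))).
    rewrite ler_wpM2l ?expR_ge0// ler_wpM2l ?exprn_ge0 ?invr_ge0 ?sqrtr_ge0//.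
    by rewrite -[leRHS]expR0 ler_expR mulNr oppr_le0; apply: divr_ge0; [exact: mulr_ge0|exact: ltW].
  rewrite mulr1 /e -natr1 opprD expRD mulrC mulrA ler_wpM2r ?expR_ge0//.
  rewrite -(mulr1 m%:R) -mulrN expRM_natl -exprMn.
  rewrite lerXn2r ?nnegrE ?mulr_ge0 ?invr_ge0 ?sqrtr_ge0 ?expR_ge0//.
  have e2 : expR (- 1) <= 2^-1 :> R.
    rewrite expRN lef_pV2 ?posrE ?expR_gt0//.
    by apply: le_trans (expR_ge1Dx _); lra.
  apply: (@le_trans _ _ (2^-1 * (Num.sqrt (1 + s))^-1)).
    by rewrite [leLHS]mulrC ler_wpM2r// invr_ge0 sqrtr_ge0.
  rewrite -invfM lef_pV2 ?posrE ?mulr_gt0 ?sqrtr_gt0//.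
  have -> : 2 * Num.sqrt (1 + s) = Num.sqrt (2 ^+ 2 * (1 + s)).
    by rewrite sqrtrM ?sqr_ge0// sqrtr_sqr ger0_norm.
  by rewrite ler_wsqrtr// mulrDr expr2; move: s0; lra.
have -> : 4 * m.+1%:R / rho ^+ 2 = 2 * s by rewrite /s; ring.
rewrite -/b.
have u1 : 2^-1 <= expR (- 2^-1) :> R by apply: le_trans (expR_ge1Dx _); lra.
have u2 : expR (- 2^-1) <= 2 / 3 :> R.
  rewrite expRN -[leRHS]invf_div lef_pV2 ?posrE ?expR_gt0//.
  by apply: le_trans (expR_ge1Dx _); lra.
have u3 : expR (- 1) = expR (- 2^-1) ^+ 2 :> R.
  by rewrite -expRM_natl; congr expR; field.
rewrite u3 in h2; move: (expR (- 2^-1)) u1 u2 h1 h2 => u u1 u2 h1 h2.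
have : b * u <= A1 + b * u ^+ 2 by apply: (le_trans h1); apply: (le_trans H); rewrite lerD2l.
rewrite -lerBlDr => /(le_trans _); apply.
rewrite -mulrBr mulrC ler_wpM2l ?(ltW b0)//; nra.
Qed.

End GaussBounds.

Section AbsoluteContinuity.
Context d (T : measurableType d) (R : realType).
Variables (nu : {measure set T -> \bar R}) (lam : {measure set T -> \bar R}).
Hypothesis nufin : (nu setT < +oo)%E.
Hypothesis numu : nu `<< lam.

Lemma abs_cont_eps_delta (e : R) : 0 < e -> exists2 delta : R, 0 < delta &
  forall S : set T, measurable S -> (lam S < delta%:E)%E -> (nu S < e%:E)%E.
Proof.
move=> e0; apply: contrapT => H.
have {}H (n : nat) : exists S : set T, [/\ measurable S,
    (lam S < ((1 / (2 ^ n.+1)%:R))%:E)%E & (e%:E <= nu S)%E].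
  apply: contrapT => Hn; apply: H; exists (1 / (2 ^ n.+1)%:R) => [|S mS lS]; first by rewrite divr_gt0// ltr0n expn_gt0.
  by rewrite ltNge; apply/negP => eS; apply: Hn; exists S.
have [F HF] := choice H.
have mF n : measurable (F n) by have [] := HF n.
have lF n : (lam (F n) <= ((1 / (2 ^ n.+1)%:R))%:E)%E by have [_ /ltW] := HF n.
have nF n : (e%:E <= nu (F n))%E by have [_ _] := HF n.
have fU n : (nu (\bigcup_(k >= n) F k) < +oo)%E.
  by apply: le_lt_trans nufin; apply: le_measure; rewrite ?inE//; exact: bigcup_measurable.
have l0 : lam (lim_sup_set F) = 0%E.
  apply: lim_sup_set_cvg0 => //.
  apply: (@le_lt_trans _ _ (\sum_(n <oo) (1 / (2 ^ n.+1)%:R)%:E)%E); first exact: lee_nneseries.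
  by apply: le_lt_trans (epsilon_trick0 _ (@ler01 R)) _; rewrite ltry.
have n0 : nu (lim_sup_set F) = 0%E.
  move/null_content_dominatesP : numu; apply => //.
  by apply: bigcap_measurable => // k _; exact: bigcup_measurable.
have : (e%:E <= nu (lim_sup_set F))%E.
  have h := lim_sup_set_cvg nu F mF (fU 0).
  rewrite -(cvg_lim _ h)//; apply: lime_ge; first by apply/cvg_ex; exists (nu (lim_sup_set F)).
  apply: nearW => n; apply: (le_trans (nF n)); apply: le_measure; rewrite ?inE//.
    exact: bigcup_measurable.
  by move=> x Fx; exists n => /=.
by rewrite n0 lee_fin leNgt e0.
Qed.

End AbsoluteContinuity.

Section SeparatedPoints.
Context {R : realType} (mu : probability (measurableTypeR R) R).
Local Notation leb := (@lebesgue_measure R).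

Lemma separated_points : nontrivial_ac_part mu ->
  exists A delta c : R, [/\ 0 < A, 0 < delta, delta <= 1, 0 < c &
  forall (f : R -> R) (M I' : R), measurable_fun setT f ->
    (forall x, 0 <= f x <= M) -> \int[mu]_x f x < I' ->
    forall m : nat, exists s : seq R, [/\ size s = m,
      forall x, x \in s -> `|x| <= A /\ f x <= c * I' &
      pairwise (fun x y => delta / m%:R <= `|x - y|) s]].
Proof.
move=> [nu [rho [mudec nudom _ nu0]]].
have numu S : measurable S -> (nu S <= mu S)%E by move=> mS; rewrite mudec// leeDl.
have nufin : (nu setT < +oo)%E.
  by apply: le_lt_trans (numu _ measurableT) _; rewrite [X in (X < _)%E]probability_setT ltry.
pose V (n : nat) : set (measurableTypeR R) := `[- n%:R, n%:R]%classic.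
have mV n : measurable (V n) by exact: measurable_itv.
have [n nV] : exists n, (0 < nu (V n))%E.
  apply: contrapT => H; apply: nu0.
  have V0 n : nu (V n) = 0%E.
    apply/eqP; rewrite eq_le measure_ge0 andbT leNgt; apply/negP => h.
    by apply: H; exists n.
  have VT : setT = \bigcup_n V n.
    apply/seteqP; split => // x _.
    exists (Num.bound `|x|) => //=; rewrite /V/= in_itv/= -ler_norml ltW//.
    exact: archi_boundP.
  rewrite VT; apply/eqP; rewrite eq_le measure_ge0 andbT.
  have mUV : measurable (\bigcup_n V n) by exact: bigcup_measurable.
  have H1 : (nu (\bigcup_n V n) <= \sum_(k <oo) nu (V k))%E by exact: measure_sigma_subadditive.
  by apply: (le_trans H1); rewrite eseries0// => i _ _; rewrite V0.
have fV : nu (V n) \is a fin_num.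
  by rewrite ge0_fin_numE//; apply: le_lt_trans nufin; apply: le_measure; rewrite ?inE.
pose a0 := fine (nu (V n)).
have a00 : 0 < a0 by rewrite fine_gt0// nV ltey_eq fV.
have [d0 d00 Hd] := abs_cont_eps_delta nufin nudom (divr_gt0 a00 (ltr0n _ 2)).
pose delta := Num.min 1 (d0 / 2).
have delta0 : 0 < delta by rewrite lt_min ltr01 divr_gt0.
have n0 : (0 < n)%N.
  rewrite lt0n; apply/eqP => nE; move: nV; rewrite nE.
  have : (nu (V 0%N) <= 0)%E; last by rewrite leNgt => /negP.
  have l0 : leb (V 0%N) = 0%E by rewrite /V lebesgue_measure_itv/= oppr0 ltxx.
  by have /null_content_dominatesP/(_ _ (mV 0%N) l0) -> := nudom.
exists n%:R, delta, (2 / a0); split.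
- by rewrite ltr0n.
- by [].
- by rewrite ge_min lexx.
- by rewrite divr_gt0.
move=> f M I' mf f0M fI' m; set c := 2 / a0; set h := delta / m%:R.
have I'0 : 0 < I'.
  by apply: le_lt_trans fI'; apply: Rintegral_ge0 => x _; have /andP[] := f0M x.
pose E := [set x : measurableTypeR R | c * I' < f x].
have mE : measurable E.
  rewrite (_ : E = f @^-1` `]c * I', +oo[); last first.
    by apply/seteqP; split => x /=; rewrite in_itv/= andbT.
  by rewrite -[X in measurable X]setTI; exact: mf.
have c0 : 0 < c by rewrite divr_gt0.
have muE : (mu E < (a0 / 2)%:E)%E.
  have -> : mu E = (\int[mu]_x \1_E x)%:E.
    by rewrite /Rintegral integral_indic// setIT fineK// fin_num_measure.
  rewrite lte_fin (_ : a0 / 2 = c^-1); last by rewrite invf_div.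
  have ifM : mu.-integrable setT (EFin \o f).
    apply: (@integrable_bounded _ _ _ _ _ M) => // x.
    by have /andP[h1 h2] := f0M x; rewrite ger0_norm.
  have iE : mu.-integrable setT (EFin \o (\1_E : measurableTypeR R -> R)).
    apply: (@integrable_bounded _ _ _ _ _ 1) => // x.
    by rewrite indicE; case: (_ \in _); rewrite ?normr1 ?normr0.
  have : \int[mu]_x (c * I' * \1_E x) <= \int[mu]_x f x.
    apply: le_Rintegral => //.
      by have := integrableZl measurableT (c * I') iE; apply: eq_integrable.
    move=> x _; rewrite indicE; have [/set_mem|_] := boolP (x \in E).
      by rewrite mulr1 => /ltW.
    by rewrite mulr0; have /andP[] := f0M x.
  rewrite RintegralZl// => /le_lt_trans/(_ fI').
  rewrite mulrAC -ltr_pdivlMr// divff ?gt_eqF// mulrC => h1.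
  by rewrite -[ltRHS]mul1r ltr_pdivlMr.
have nuE : (nu E < (a0 / 2)%:E)%E by apply: le_lt_trans (numu _ mE) _.
suff Hs k : (k <= m)%N -> exists s : seq R, [/\ size s = k,
    forall x, x \in s -> `|x| <= n%:R /\ f x <= c * I' &
      pairwise (fun x y => h <= `|x - y|) s] by exact: Hs.
elim: k => [_|k IH km]; first by exists [::].
have [s [sk sP pw]] := IH (ltnW km).
have m0 : 0 < m%:R :> R by rewrite ltr0n (leq_ltn_trans _ km).
have h0 : 0 < h by rewrite divr_gt0.
have [U [mU lU UP]] : exists U : set (measurableTypeR R), [/\ measurable U,
    (leb U <= ((size s)%:R * (h *+ 2))%:E)%E &
    forall x, ~ U x -> forall y, y \in s -> h <= `|x - y|].
  elim: (s) => [|y t [U [mU lU UP]]].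
    by exists set0; split => //; rewrite ?measure0 ?mul0r.
  exists (ball y h `|` U); split.
  - by apply: measurableU => //; exact: measurable_ball.
  - have lb : leb (ball y h) = (h *+ 2)%:E by apply: lebesgue_measure_ball; exact: ltW.
    have H1 : (leb (ball y h `|` U) <= leb (ball y h) + leb U)%E.
      by apply: measureU2 => //; exact: measurable_ball.
    apply: (le_trans H1); rewrite lb.
    apply: (@le_trans _ _ ((h *+ 2)%:E + ((size t)%:R * (h *+ 2))%:E)%E); first exact: leeD2l.
    by rewrite lee_fin [size (_ :: _)]/= -natr1 mulrDl mul1r addrC.
  - move=> x /not_orP[xy xU] z; rewrite inE => /predU1P[->|]; last exact: UP.
    by rewrite leNgt; apply/negP => hh; apply: xy; rewrite /ball/= distrC.
have nuU : (nu U < (a0 / 2)%:E)%E.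
  apply: Hd => //; apply: le_lt_trans lU _; rewrite lte_fin sk.
  apply: (@lt_le_trans _ _ (m%:R * (h *+ 2))).
    by rewrite ltr_pM2r ?ltr_nat// mulrn_wgt0.
  rewrite mulrnAr /h mulrC divfK ?gt_eqF// -mulr_natr -ler_pdivlMr//.
  by rewrite ge_min lexx orbT.
have [x [Vx Ex Ux]] : exists x, [/\ V n x, ~ E x & ~ U x].
  apply: contrapT => H.
  have VEU : V n `<=` E `|` U.
    move=> x Vx; apply: contrapT => /not_orP[Ex Ux]; apply: H.
    by exists x.
  have : (nu (V n) < a0%:E)%E.
    apply: (@le_lt_trans _ _ (nu E + nu U)%E).
      apply: le_trans (measureU2 _ mE mU); apply: le_measure; rewrite ?inE//.
      exact: measurableU.
    by rewrite (splitr a0) EFinD; exact: lteD.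
  by rewrite fineK// ltxx.
exists (x :: s); split => /=; first by rewrite sk.
  move=> y; rewrite inE => /predU1P[->|]; last exact: sP.
  split; first by move: Vx; rewrite /V/= in_itv/= -ler_norml.
  by rewrite leNgt; apply/negP.
by rewrite pw andbT; apply/allP => y ys; exact: UP.
Qed.

End SeparatedPoints.


Section LagrangeBound.
Context {C : numFieldType}.

Lemma coef_prodXsubC_le (r : seq C) (j : nat) : (forall x, x \in r -> `|x| <= 1) ->
  `|(\prod_(x <- r) ('X - x%:P))`_j| <= 2 ^+ size r.
Proof.
elim: r j => [|y r IH] j Hr.
  by rewrite big_nil coef1; case: (j == _); rewrite ?normr1 ?normr0 ?ler01.
rewrite big_cons mulrBl coefB coefXM coefCM.
have {}IH i : `|(\prod_(x <- r) ('X - x%:P))`_i| <= 2 ^+ size r.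
  by apply: IH => x xr; apply: Hr; rewrite inE xr orbT.
rewrite (le_trans (ler_normB _ _))//= exprS mulrDl mul1r lerD//.
  by case: ifP => _; rewrite ?normr0 ?exprn_ge0.
by rewrite normrM -[leRHS]mul1r ler_pM// Hr ?mem_head.
Qed.

(** a polynomial that is small at well separated points of the unit disk has
    small coefficients, by Lagrange interpolation *)
Lemma lagrange_coef_le (m : nat) (z : 'I_m -> C) (q : {poly C}) (M eta : C) :
  (size q <= m)%N -> 0 < eta -> eta <= 1 -> 0 <= M -> (forall k, `|z k| <= 1) ->
  (forall k l, k != l -> eta <= `|z k - z l|) -> (forall k, `|q.[z k]| <= M) ->
  forall j, `|q`_j| <= m%:R * (M * (2 / eta) ^+ m).
Proof.
move=> sq e0 e1 M0 z1 zsep qM j.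
pose p k := \prod_(l | l != k) ('X - (z l)%:P).
have pk k : p k = \prod_(x <- [seq z l | l <- enum 'I_m & l != k]) ('X - x%:P).
  by rewrite big_map big_filter big_enum_cond.
have szs k : size [seq z l | l <- enum 'I_m & l != k] = m.-1.
  rewrite size_map -sum1_size big_filter big_enum_cond sum1_card.
  by rewrite -[RHS](_ : #|predC1 k| = _)// cardC1 card_ord.
pose L := \sum_k (q.[z k] / (p k).[z k]) *: p k.
have pkk k : eta ^+ m.-1 <= `|(p k).[z k]|.
  rewrite /p horner_prod normr_prod.
  have -> : eta ^+ m.-1 = \prod_(l | l != k) eta.
    rewrite prodr_const; congr (_ ^+ _).
    by rewrite -[RHS](_ : #|predC1 k| = _)// cardC1 card_ord.
  apply: ler_prod => l lk; rewrite hornerXsubC (ltW e0)/=.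
  by apply: zsep; rewrite eq_sym.
have pk0 k : (p k).[z k] != 0.
  by rewrite -normr_gt0; apply: lt_le_trans (pkk k); rewrite exprn_gt0.
have pkl k l : l != k -> (p k).[z l] = 0.
  by move=> lk; rewrite /p (bigD1 l)//= hornerM hornerXsubC subrr mul0r.
have Lz k : L.[z k] = q.[z k].
  rewrite /L horner_sum (bigD1 k)//= big1 ?addr0.
    by rewrite hornerZ divfK.
  by move=> l lk; rewrite hornerZ (pkl l k) ?mulr0 1?eq_sym.
have szL : (size L <= m)%N.
  apply: (leq_trans (size_sum _ _ _)); apply/bigmax_leqP => k _.
  apply: (leq_trans (size_scale_leq _ _)).
  rewrite pk size_prod_XsubC szs prednK//.
  exact: leq_ltn_trans (ltn_ord k).
have zinj : injective z.
  move=> k l zkl; apply/eqP; apply: contraT => kl.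
  by have := zsep _ _ kl; rewrite zkl subrr normr0 (lt_geF e0).
have qL : q = L.
  apply/eqP; rewrite -subr_eq0; apply/eqP.
  apply: (@roots_geq_poly_eq0 _ _ [seq z k | k <- enum 'I_m]).
  - apply/allP => x /mapP[k _ ->]; rewrite /root hornerD hornerN Lz subrr//.
  - by rewrite map_inj_uniq// enum_uniq.
  - rewrite size_map size_enum_ord (leq_trans (size_polyD _ _))// size_polyN.
    by rewrite geq_max sq szL.
rewrite qL /L coef_sum (le_trans (ler_norm_sum _ _ _))//.
rewrite -[X in X%:R * _](card_ord m) mulr_natl -sumr_const.
apply: ler_sum => k _; rewrite coefZ normrM normrM normfV.
rewrite -mulrA; apply: ler_pM => //.
have m0 : (0 < m)%N by exact: leq_ltn_trans (ltn_ord k).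
apply: (@le_trans _ _ ((2 / eta) ^+ m.-1)).
  rewrite exprMn mulrC ler_pM ?invr_ge0//.
    by rewrite pk -(szs k); apply: coef_prodXsubC_le => x /mapP[l _ ->].
  by rewrite exprVn lef_pV2 ?posrE ?normr_gt0 ?exprn_gt0.
apply: ler_weXn2l; last exact: leq_pred.
by rewrite ler_pdivlMr// mul1r (le_trans e1)// ler1n.
Qed.

End LagrangeBound.


Section TrigSeparation.
Context {R : realType}.
Implicit Types x y : R.

Lemma cos_ge_half x : `|x| <= 2^-1 -> 2^-1 <= cos x.
Proof.
move=> xh; suff : `|cos x - cos 0| <= `|x|.
  by rewrite cos0 distrC => /(le_trans (ler_norm _)) h; move: (le_trans h xh); lra.
wlog x0 : x xh / 0 < x => [H|].
  have [x0|x0|->] := ltgtP x 0; last 1 first.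
  - by rewrite subrr.
  - by rewrite -(cosN x) -(normrN x); apply: H; rewrite ?normrN ?oppr_gt0.
  - exact: H.
have [xi _ ->] := @MVT _ cos (fun y => - sin y) 0 x x0 (fun y _ => is_derive_cos y)
  (continuous_subspaceT (@continuous_cos R)).
by rewrite normrM normrN subr0 ler_piMl// sin_max.
Qed.

Lemma sin_separation x y : `|x| <= 2^-1 -> `|y| <= 2^-1 ->
  2^-1 * `|x - y| <= `|sin x - sin y|.
Proof.
wlog xy : x y / y < x => [H|].
  have [xy|xy|->] := ltgtP x y; last 1 first.
  - by rewrite !subrr normr0 mulr0.
  - by move=> hx hy; rewrite distrC [leRHS]distrC; exact: H.
  - by move=> hx hy; exact: H.
move=> hx hy.
have [xi xiP ->] := @MVT _ sin cos y x xy (fun y _ => is_derive_sin y)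
  (continuous_subspaceT (@continuous_sin R)).
rewrite normrM ler_wpM2r// (le_trans _ (ler_norm _))// cos_ge_half//.
move: xiP; rewrite in_itv/= => /andP[h1 h2]; move: hx hy.
by rewrite !ler_norml => /andP[h3 h4] /andP[h5 h6]; apply/andP; lra.
Qed.

End TrigSeparation.

Section SpectralLower.
Context {R : realType} (mu : probability (measurableTypeR R) R).

Definition grid_functional (B N m : nat) (a : 'I_m -> R) : seq (R * R) :=
  [seq (a i, i%:R / (B%:R * N%:R)) | i <- enum 'I_m].

Lemma lin_grid B N m (a : 'I_m -> R) f :
  lin (grid_functional B N a) f = \sum_i a i * f (i%:R / (B%:R * N%:R)).
Proof. by rewrite /lin /grid_functional big_map big_enum. Qed.

Local Open Scope complex_scope.

Let expi (t : R) : R[i] := cos t +i* sin t.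

Let expiX t n : expi t ^+ n = expi (n%:R * t).
Proof.
elim: n => [|n IH]; first by rewrite expr0 mul0r /expi cos0 sin0.
rewrite exprSr IH /expi -natr1 mulrDl mul1r cosD sinD.
by apply/eqP; rewrite eq_complex /=; apply/andP; split; apply/eqP; ring.
Qed.

Let norm_expi t : `|expi t| = 1.
Proof. by rewrite normc_def /= cos2Dsin2 sqrtr1. Qed.

Lemma spectral_lower : nontrivial_ac_part mu ->
  exists B C : nat, (0 < B)%N /\
  forall (N m : nat) (a : 'I_m -> R), (2 <= N)%N -> (m <= N.+1)%N ->
    \sum_i `|a i| <= N%:R ^+ (C * m) *
      Num.sqrt (cov mu (grid_functional B N a) (grid_functional B N a)).
Proof.
move=> /separated_points[A [delta [c [A0 d0 d1 c0 Hsep]]]].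
pose B := (Num.bound (2 * A)).+1.
have BA : 2 * A <= B%:R.
  by rewrite (le_trans (ltW (archi_boundP _)))// ?mulr_ge0 ?ler_nat// ltW.
have pow2 (x : R) : 0 <= x -> exists k : nat, x <= 2 ^+ k.
  move=> x0; exists (Num.bound x); rewrite (le_trans (ltW (archi_boundP x0)))//.
  by rewrite -natrX ler_nat ltnW// ltn_expl.
have B0 : 0 < B%:R :> R by rewrite ltr0n.
have [D0 HD0] := pow2 (16 * B%:R / delta) (divr_ge0 (mulr_ge0 (ler0n _ _) (ler0n _ _)) (ltW d0)).
have [D1 HD1] := pow2 (Num.sqrt c) (sqrtr_ge0 c).
exists B, (D0 + D1 + 7)%N; split=> // N [|m'] a N2 mN.
  by rewrite big_ord0 mulr_ge0 ?exprn_ge0 ?sqrtr_ge0.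
set m := m'.+1 in a mN *.
set L := grid_functional B N a.
have N0 : 0 < N%:R :> R by rewrite ltr0n (leq_trans _ N2).
have m0 : 0 < m%:R :> R by rewrite ltr0n.
have m1 : 1 <= m%:R :> R by rewrite ler1n.
have N1 : 1 <= N%:R :> R by rewrite ler1n (leq_trans _ N2).
pose eta := delta / m%:R / (2 * B%:R * N%:R).
have eta0 : 0 < eta by rewrite !divr_gt0// !mulr_gt0.
have eta1 : eta <= 1.
  rewrite /eta ler_pdivrMr ?mulr_gt0// mul1r ler_pdivrMr//.
  apply: (le_trans d1); rewrite -!natrM ler1n !muln_gt0/=.
  by rewrite (leq_trans _ N2).
pose f x := cosL L x ^+ 2 + sinL L x ^+ 2.
have covE : cov mu L L = \int[mu]_x f x by apply: eq_Rintegral => x _; rewrite -!expr2.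
have key I' : \int[mu]_x f x < I' ->
    \sum_i `|a i| <= m%:R * (m%:R * (Num.sqrt (c * I') * (2 / eta) ^+ m)).
  move=> fI'.
  have mf : measurable_fun setT f.
    by apply: measurable_funD; apply: measurable_funX; [exact: measurable_cosL|exact: measurable_sinL].
  pose S := \sum_(p <- L) `|p.1|.
  have fb x : 0 <= f x <= S ^+ 2 + S ^+ 2.
    rewrite addr_ge0 ?sqr_ge0//= lerD// -(real_normK (num_real _)) lerXn2r ?nnegrE//.
    - by rewrite /S sumr_ge0.
    - exact: cosL_le.
    - by rewrite /S sumr_ge0.
    - exact: sinL_le.
  have [s [ss sP spw]] := Hsep f _ I' mf fb fI' m.
  pose th (k : 'I_m) := nth 0 s k / (B%:R * N%:R).
  pose q : {poly R[i]} := \poly_(i < m) (if insub i is Some j then (a j)%:C else 0).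
  have qz (k : 'I_m) : q.[expi (th k)] = cosL L (nth 0 s k) +i* sinL L (nth 0 s k).
    rewrite /q horner_poly /cosL /sinL !lin_grid.
    transitivity (\sum_(i < m) ((a i * cos (i%:R / (B%:R * N%:R) * nth 0 s k)) +i*
      (a i * sin (i%:R / (B%:R * N%:R) * nth 0 s k)))).
      apply: eq_bigr => i _; rewrite valK expiX /expi.
      rewrite (_ : i%:R * th k = i%:R / (B%:R * N%:R) * nth 0 s k); last by rewrite /th; ring.
      by apply/eqP; rewrite eq_complex /= !mul0r subr0 addr0 !eqxx.
    by elim/big_rec3 : _ => // i u v w _ ->.
  have hsk (k : 'I_m) : nth 0 s k \in s by rewrite mem_nth// ss.
  have thb k : `|th k| <= 2^-1.
    have [hA _] := sP _ (hsk k).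
    rewrite /th normrM normfV (@ger0_norm _ (B%:R * _)) ?mulr_ge0//.
    rewrite ler_pdivrMr ?mulr_gt0// (le_trans hA)//.
    rewrite (@le_trans _ _ (2^-1 * B%:R))//; first by move: BA; lra.
    by rewrite ler_wpM2l// ler_peMr.
  have sep_lt (k l : 'I_m) : (k < l)%N -> delta / m%:R <= `|nth 0 s k - nth 0 s l|.
    move=> kl; have /(pairwiseP 0) H := spw; apply: H => //; rewrite -topredE /= ss; exact: ltn_ord.
  have sep (k l : 'I_m) : k != l -> delta / m%:R <= `|nth 0 s k - nth 0 s l|.
    by rewrite -val_eqE neq_ltn => /orP[|] kl; [|rewrite distrC]; exact: sep_lt.
  have thsep (k l : 'I_m) : k != l -> eta%:C <= `|expi (th k) - expi (th l)|.
    move=> kl; rewrite normc_def /= lecR.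
    apply: (@le_trans _ _ `|sin (th k) - sin (th l)|); last first.
      by rewrite -sqrtr_sqr ler_wsqrtr// lerDr sqr_ge0.
    apply: le_trans (sin_separation (thb k) (thb l)).
    rewrite /th -mulrBl normrM normfV (@ger0_norm _ (B%:R * _)) ?mulr_ge0//.
    rewrite /eta (_ : _ / (2 * _ * _) = 2^-1 * (delta / m%:R / (B%:R * N%:R))); last first.
      by field; rewrite !gt_eqF.
    rewrite ler_wpM2l//.
    by rewrite ler_wpM2r ?invr_ge0 ?mulr_ge0// sep.
  have qM k : `|q.[expi (th k)]| <= (Num.sqrt (c * I'))%:C.
    rewrite qz normc_def /= lecR ler_wsqrtr//.
    by have [_] := sP _ (hsk k).
  have sq : (size q <= m)%N by exact: size_poly.
  have M0 : 0 <= (Num.sqrt (c * I'))%:C by rewrite ler0c sqrtr_ge0.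
  have eta0' : 0 < eta%:C by rewrite ltcR.
  have eta1' : eta%:C <= 1 by rewrite lecR.
  have z1 (k : 'I_m) : `|expi (th k)| <= 1 by rewrite norm_expi.
  have H := lagrange_coef_le sq eta0' eta1' M0 z1 thsep qM.
  rewrite [leRHS]mulr_natl -[X in _ *+ X](card_ord m) -sumr_const.
  apply: ler_sum => i _; have := H i.
  rewrite coef_poly ltn_ord valK normc_def /= expr0n/= addr0 sqrtr_sqr.
  have cast (x e : R) : m%:R * (x%:C * (2 / e%:C) ^+ m) = (m%:R * (x * (2 / e) ^+ m))%:C.
    by rewrite !rmorphM rmorphXn rmorphM fmorphV !rmorph_nat.
  by rewrite cast lecR.
have cov0 := cov_ge0 mu L.
have S0 : 0 <= \sum_i `|a i| by apply: sumr_ge0.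
pose K := m%:R * (m%:R * (2 / eta) ^+ m).
have K0 : 0 <= K by rewrite !mulr_ge0// exprn_ge0// divr_ge0// ltW.
have le1 : \sum_i `|a i| <= K * (Num.sqrt c * Num.sqrt (cov mu L L)).
  rewrite -sqrtrM ?(ltW c0)// -[leLHS]ger0_norm// -[X in X * _]ger0_norm// -!sqrtr_sqr.
  rewrite -sqrtrM ?sqr_ge0// ler_wsqrtr//.
  apply/ler_addgt0Pr => e e0.
  have Kc0 : 0 <= K ^+ 2 * c by rewrite mulr_ge0 ?sqr_ge0// ltW.
  pose I' := cov mu L L + e / (K ^+ 2 * c + 1).
  have I'0 : cov mu L L < I' by rewrite ltrDl divr_gt0// ltr_wpDl.
  have := key I'; rewrite -covE => /(_ I'0) h.
  have I'p : 0 <= c * I' by rewrite mulr_ge0 ?(ltW c0)//; exact: le_trans (ltW I'0).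
  have {}h : \sum_i `|a i| <= K * Num.sqrt (c * I') by apply: (le_trans h); rewrite /K; lra.
  apply: (@le_trans _ _ (K ^+ 2 * (c * I'))).
    rewrite -[X in _ * X]sqr_sqrtr// -exprMn lerXn2r ?nnegrE//.
    exact: mulr_ge0 K0 (sqrtr_ge0 _).
  rewrite /I' !mulrDr mulrA lerD2l mulrA mulrCA ger_pMr// ler_pdivrMr ?mul1r ?lerDl//.
  by rewrite ltr_wpDl.
apply: (le_trans le1); rewrite mulrA ler_wpM2r ?sqrtr_ge0//.
have mN2 : m%:R <= N%:R ^+ 2 :> R.
  rewrite -natrX ler_nat (leq_trans mN)// expnS expn1.
  by rewrite -addn1 (leq_trans (leq_add (leqnn N) (ltnW N2)))// addnn -mul2n leq_mul2r N2 orbT.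
have eN : 2 / eta <= N%:R ^+ (D0 + 3).
  have -> : 2 / eta = 4 * B%:R / delta * (m%:R * N%:R).
    by rewrite /eta; field; rewrite !gt_eqF.
  rewrite exprD ler_pM ?mulr_ge0 ?invr_ge0 ?(ltW d0)//.
    apply: (@le_trans _ _ (16 * B%:R / delta)).
      by rewrite ler_wpM2r ?invr_ge0 ?(ltW d0)// ler_wpM2r// ler_nat.
    by apply: (le_trans HD0); rewrite lerXn2r ?nnegrE// ler_nat.
  by rewrite exprSr ler_pM.
have -> : K * Num.sqrt c = (m%:R * m%:R) * Num.sqrt c * (2 / eta) ^+ m by rewrite /K; ring.
rewrite (_ : (D0 + D1 + 7) * m = 4 * m + D1 * m + (D0 + 3) * m)%N; last first.
  rewrite -2!mulnDl; congr (_ * _)%N; rewrite (addnC D0 3) addnA (addnAC 4 D1 3) -addnA.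
  by rewrite (addnC D1) addnC.
rewrite !exprD; apply: ler_pM.
- by rewrite !mulr_ge0// sqrtr_ge0.
- by rewrite exprn_ge0// divr_ge0// ltW.
- apply: ler_pM; rewrite ?mulr_ge0 ?sqrtr_ge0//.
    apply: (@le_trans _ _ (N%:R ^+ 2 * N%:R ^+ 2)); first exact: ler_pM.
    by rewrite -exprD ler_weXn2l// leq_pmulr.
  apply: (le_trans HD1); apply: (@le_trans _ _ (N%:R ^+ D1)).
    by rewrite lerXn2r ?nnegrE// ler_nat.
  by rewrite ler_weXn2l// leq_pmulr.
- rewrite exprM lerXn2r ?nnegrE ?exprn_ge0// divr_ge0// ltW//.
Qed.

End SpectralLower.

Section Orthonormalize.
Context {R : realType}.

(** a symmetric positive definite form has an orthonormal basis *)
Lemma posdef_orthonormal (m : nat) (S : 'M[R]_m) : S^T = S ->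
  (forall v : 'rV[R]_m, v != 0 -> 0 < (v *m S *m v^T) ord0 ord0) ->
  exists B : 'M[R]_m, B *m S *m B^T = 1%:M.
Proof.
move=> Ssym Spos.
suff H k : (k <= m)%N -> exists B : 'M[R]_(k, m), B *m S *m B^T = 1%:M by exact: H.
elim: k => [_|k IH km]; first by exists 0; apply/matrixP => -[].
have [B HB] := IH (ltnW km).
have [v v0 vB] : exists2 v : 'rV[R]_m, v != 0 & v *m (B *m S)^T = 0.
  have rk : (\rank (B *m S)^T < m)%N by apply: leq_ltn_trans (rank_leq_col _) km.
  have : kermx (B *m S)^T != 0 by rewrite kermx_eq0 /row_free ltn_eqF.
  by move=> /rowV0Pn[v /sub_kermxP vk v0]; exists v.
pose q := (v *m S *m v^T) ord0 ord0.
have q0 : 0 < q by exact: Spos.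
pose w := (Num.sqrt q)^-1 *: v.
have BSw : B *m S *m w^T = 0.
  by rewrite /w linearZ/= -scalemxAr -[B *m S]trmxK -trmx_mul vB trmx0 scaler0.
have wSB : w *m S *m B^T = 0.
  by apply: trmx_inj; rewrite trmx0 trmx_mul trmxK trmx_mul Ssym mulmxA.
have wSw : w *m S *m w^T = 1%:M.
  have -> : w *m S *m w^T = (Num.sqrt q)^-1 *: ((Num.sqrt q)^-1 *: (v *m S *m v^T)).
    by rewrite /w linearZ/= -scalemxAr -!scalemxAl.
  apply/matrixP => i j; rewrite !ord1 [LHS]mxE [X in _ * X]mxE -/q mxE eqxx.
  by rewrite mulrA -invfM -expr2 sqr_sqrtr ?ltW// mulVf// gt_eqF.
have E : (col_mx w B) *m S *m (col_mx w B)^T = 1%:M.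
  by rewrite mul_col_mx tr_col_mx mul_col_row wSw BSw wSB HB -scalar_mx_block.
by exists (col_mx w B).
Qed.

End Orthonormalize.

Section OrthonormalGrid.
Context {R : realType} (mu : probability (measurableTypeR R) R).
Local Notation cov := (cov mu).

Lemma cov_expand L L' : cov L L' = \sum_(p <- L) p.1 * cov [:: (1, p.2)] L'.
Proof.
elim: L => [|p L IH].
  rewrite big_nil -[X in cov X _](_ : scaleL 0 [::] = _)// cov_scalel mul0r//.
rewrite big_cons -IH -cov_scalel -cov_catl; congr (cov _ _).
by rewrite /scaleL /= mulr1; case: p.
Qed.

Lemma orthonormal_grid : nontrivial_ac_part mu ->
  exists B C : nat, (0 < B)%N /\ forall N m : nat, (2 <= N)%N -> (m <= N.+1)%N ->
  exists b c : 'I_m -> 'I_m -> R,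
  [/\ forall i j, cov (grid_functional B N (b i)) (grid_functional B N (b j)) = (i == j)%:R,
     forall i, \sum_j `|b i j| <= N%:R ^+ (C * m),
     forall i, \sum_j c i j ^+ 2 = 1 &
     forall (f : R -> R) (i : 'I_m), f (i%:R / (B%:R * N%:R)) =
        \sum_j c i j * lin (grid_functional B N (b j)) f].
Proof.
move=> /spectral_lower[B [C [B0 H]]]; exists B, C; split => // N m N2 mN.
pose t (i : 'I_m) : R := i%:R / (B%:R * N%:R).
pose S : 'M[R]_m := \matrix_(i, j) cov [:: (1, t i)] [:: (1, t j)].
have SE (a a' : 'I_m -> R) :
    cov (grid_functional B N a) (grid_functional B N a') =
    \sum_i \sum_j a i * a' j * S i j.
  rewrite cov_expand big_map big_enum/=; apply: eq_bigr => i _.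
  rewrite covC cov_expand big_map big_enum/= mulr_sumr; apply: eq_bigr => j _.
  by rewrite /S mxE covC mulrA.
have mxE3 k (A : 'M[R]_(k, m)) i j : (A *m S *m A^T) i j =
    cov (grid_functional B N (A i)) (grid_functional B N (A j)).
  rewrite SE mxE exchange_big/=; apply: eq_bigr => l _.
  rewrite mxE mulr_suml; apply: eq_bigr => l' _.
  by rewrite [A^T _ _]mxE mulrAC.
have Ssym : S^T = S by apply/matrixP => i j; rewrite !mxE covC.
have Spos (v : 'rV[R]_m) : v != 0 -> 0 < (v *m S *m v^T) ord0 ord0.
  move=> v0; rewrite mxE3 lt0r cov_ge0 andbT; apply/negP => /eqP E.
  have := H N m (v ord0) N2 mN; rewrite E sqrtr0 mulr0 => h.
  have hs : 0 <= \sum_i `|v ord0 i| by apply: sumr_ge0.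
  have : \sum_i `|v ord0 i| == 0 by rewrite eq_le h hs.
  rewrite psumr_eq0// => /allP hv.
  case/negP: v0; apply/eqP/matrixP => i j; rewrite ord1 mxE.
  by have := hv j (mem_index_enum _); rewrite normr_eq0 => /eqP.
have [M HM] := posdef_orthonormal Ssym Spos.
pose c := S *m M^T.
have Mc : M *m c = 1%:M by rewrite /c mulmxA.
have cM : c *m M = 1%:M by exact: mulmx1C Mc.
have ccT : c *m c^T = S.
  by rewrite {2}/c trmx_mul trmxK Ssym mulmxA cM mul1mx.
have Morth i j : cov (grid_functional B N (M i)) (grid_functional B N (M j)) = (i == j)%:R.
  by rewrite -mxE3 HM mxE.
exists (fun i j => M i j), (fun i j => c i j); split.
- exact: Morth.
- move=> i; have := H N m (M i) N2 mN.
  by rewrite Morth eqxx sqrtr1 mulr1.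
- move=> i; have := congr1 (fun A : 'M[R]_m => A i i) ccT.
  rewrite !mxE cov1 expr1n => <-; apply: eq_bigr => j _.
  by rewrite !mxE expr2.
- move=> f i.
  pose F : 'cV[R]_m := \col_j f (t j).
  have : c *m (M *m F) = F by rewrite mulmxA cM mul1mx.
  move=> /(congr1 (fun A : 'cV[R]_m => A i ord0)); rewrite [RHS]mxE -/(t i) => <-.
  rewrite mxE; apply: eq_bigr => j _; rewrite lin_grid [X in _ * X]mxE.
  by congr (_ * _); apply: eq_bigr => k _; rewrite [X in _ * X]mxE.
Qed.

End OrthonormalGrid.

Section SmoothPaths.
Context {R : realType}.
Implicit Types (f g : R -> R) (x t h : R).

Definition smooth f := forall k (t : R), derivable (derive1n k f) t 1.

Lemma smooth_is_derive f k (t : R) : smooth f ->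
  is_derive t 1 (derive1n k f) (derive1n k.+1 f t).
Proof. by move=> sf; apply: DeriveDef; [exact: sf|rewrite derive1nS derive1E]. Qed.

Lemma smooth_continuous f k : smooth f -> continuous (derive1n k f).
Proof.
move=> sf x; apply: differentiable_continuous; apply/derivable1_diffP; exact: sf.
Qed.

Lemma derive1n_ext f (F : nat -> R -> R) : F 0%N = f ->
  (forall k (t : R), is_derive t 1 (F k) (F k.+1 t)) ->
  forall k, derive1n k f = F k.
Proof.
move=> F0 dF; elim=> [//|k IH]; rewrite derive1nS IH; apply/funext => t.
by rewrite derive1E; have := dF k t => ?; rewrite derive_val.
Qed.

Lemma smooth_ext f (F : nat -> R -> R) : F 0%N = f ->
  (forall k (t : R), is_derive t 1 (F k) (F k.+1 t)) -> smooth f.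
Proof.
move=> F0 dF k t; rewrite (derive1n_ext F0 dF).
by have := dF k t => -[].
Qed.

Lemma rolle_step f x (s : seq R) : (forall t : R, derivable f t 1) ->
  path <%R x s -> (forall z, z \in x :: s -> f z = 0) ->
  exists s', [/\ size s' = size s, path <%R x s', (forall z, z \in s' -> z <= last x s)
     & forall z, z \in s' -> f^`()%classic z = 0].
Proof.
move=> df; elim: s x => [|y s IH] x /=; first by move=> _ _; exists [::].
move=> /andP[xy ys] fz.
have [|s' [ss ps ls dz]] := IH y ys; first by move=> z zy; apply: fz; rewrite inE zy orbT.
have cf : {within `[x, y], continuous f}.
  by apply: derivable_within_continuous => u _; exact: df.
have fxy : f x = f y by rewrite !fz// !inE eqxx ?orbT.
have [c cxy dc] := Rolle xy (fun u _ => df u) cf fxy.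
move: cxy; rewrite in_itv/= => /andP[xc cy].
have yl : y <= last y s.
  have := mem_last y s; rewrite inE => /predU1P[->//|].
  by move/(order_path_min lt_trans)/allP : ys => H /H /ltW.
exists (c :: s'); split => /=.
- by rewrite ss.
- rewrite xc/=; case: (s') ps => //= u s'' /andP[yu ->].
  by rewrite (lt_trans cy yu).
- move=> z; rewrite inE => /predU1P[->|/ls//].
  exact: le_trans (ltW cy) yl.
- move=> z; rewrite inE => /predU1P[->|/dz//].
  by rewrite derive1E derive_val.
Qed.

Lemma rolle_iter f (a b : R) k (s : seq R) : smooth f ->
  sorted <%R s -> (forall z, z \in s -> a <= z <= b) ->
  (forall z, z \in s -> f z = 0) -> (k < size s)%N ->
  exists s', [/\ size s' = (size s - k)%N, sorted <%R s',
    (forall z, z \in s' -> a <= z <= b)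
     & forall z, z \in s' -> derive1n k f z = 0].
Proof.
move=> sf; elim: k s => [|k IH] s ss sab sz ks.
  by exists s; rewrite subn0.
have [[|x s'] [ss' os' abs' zs']] := IH s ss sab sz (ltnW ks).
  by exfalso; move: ss' ks => /=; lia.
have [s'' [h1 h2 h3 h4]] := rolle_step (sf k) os' zs'.
exists s''; split => //.
- by rewrite h1; move: ss' => /=; lia.
- exact: path_sorted h2.
- move=> z zs; have /andP[ax _] := abs' x (mem_head _ _).
  have /allP/(_ _ zs) xz := order_path_min lt_trans h2.
  have /andP[_ lb] := abs' _ (mem_last x s').
  by rewrite (le_trans ax (ltW xz)) (le_trans (h3 _ zs) lb).
Qed.

Lemma rolle_zero f (a b : R) k (s : seq R) : smooth f -> uniq s ->
  (forall z, z \in s -> a <= z <= b) ->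
  (forall z, z \in s -> f z = 0) -> (k < size s)%N ->
  exists2 xi, a <= xi <= b & derive1n k f xi = 0.
Proof.
move=> sf us sab sz ks.
have ms z : z \in sort <=%R s = (z \in s) by rewrite mem_sort.
have [||||[|x s'] [h1 h2 h3 h4]] := @rolle_iter f a b k (sort <=%R s) sf.
- by rewrite sort_lt_sorted.
- by move=> z; rewrite ms; exact: sab.
- by move=> z; rewrite ms; exact: sz.
- by rewrite size_sort.
- by exfalso; move: h1; rewrite size_sort/=; lia.
- by exists x; [apply: h3|apply: h4]; rewrite mem_head.
Qed.

Lemma derive1n_horner (p : {poly R}) k : derive1n k (horner p) = horner (p^`(k)).
Proof.
elim: k => [|k IH]; first by rewrite derivn0.
by rewrite derive1nS IH derivnS derivE.
Qed.

Lemma smooth_sub_poly f (p : {poly R}) (c : R) : smooth f ->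
  smooth (fun t => f t - c * p.[t]) /\
  forall k, derive1n k (fun t => f t - c * p.[t]) = (fun t => derive1n k f t - c * (p^`(k)).[t]).
Proof.
move=> sf; pose F k (t : R) := derive1n k f t - c * (p^`(k)).[t].
have F0 : F 0%N = (fun t => f t - c * p.[t]) by [].
have dF k (t : R) : is_derive t 1 (F k) (F k.+1 t).
  have := smooth_is_derive k t sf => d1.
  have d2 : is_derive t 1 (horner (p^`(k))) ((p^`(k.+1)).[t]).
    by apply: DeriveDef; [exact: derivable_horner|rewrite -derive1E -derivE derivnS].
  by rewrite /F; apply: is_derive_eq.
by split; [exact: smooth_ext dF|move=> k; exact: derive1n_ext dF k].
Qed.

Lemma derivn_monic (p : {poly R}) m : p \is monic -> size p = m.+1 ->
  p^`(m) = (m`!%:R)%:P.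
Proof.
move=> mp sp; apply/polyP => i; rewrite coef_derivn coefC; case: i => [|i].
  rewrite addn0 ffactnn (_ : p`_m = 1) ?eqxx//.
  by move/monicP : mp; rewrite /lead_coef sp.
by rewrite nth_default ?mul0rn// sp addnS ltnS leq_addr.
Qed.

(** remainder in polynomial interpolation at the zeros of [f] *)
Lemma interpolation_remainder f (a b t : R) (s : seq R) : smooth f -> uniq s ->
  (forall z, z \in s -> a <= z <= b) -> a <= t <= b ->
  (forall z, z \in s -> f z = 0) ->
  exists2 xi, a <= xi <= b &
    `|f t| <= (b - a) ^+ size s / (size s)`!%:R * `|derive1n (size s) f xi|.
Proof.
move=> sf us sab tab sz; set m := size s.
have ba : 0 <= b - a by rewrite subr_ge0; case/andP: tab; exact: le_trans.
have [ts|ts] := boolP (t \in s).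
  by exists t => //; rewrite sz// normr0 !mulr_ge0// exprn_ge0.
pose p : {poly R} := \prod_(z <- s) ('X - z%:P).
have pt0 : p.[t] != 0.
  rewrite /p horner_prod prodf_seq_neq0; apply/allP => z zs /=.
  by rewrite hornerXsubC subr_eq0; apply: contraNneq ts => ->.
pose c := f t / p.[t].
have [sF dF] := @smooth_sub_poly f p c sf.
have [|z|z||xi xab] := @rolle_zero (fun u => f u - c * p.[u]) a b m (t :: s) sF.
- by rewrite /= ts us.
- by rewrite inE => /predU1P[->//|]; exact: sab.
- rewrite inE => /predU1P[->|zs]; first by rewrite /c divfK ?subrr.
  have : root p z by rewrite root_prod_XsubC.
  by rewrite sz// => /rootP ->; rewrite mulr0 subrr.
- by rewrite /=.
rewrite dF derivn_monic ?monic_prod_XsubC ?size_prod_XsubC// hornerC => /eqP.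
rewrite subr_eq0 => /eqP E; exists xi => //.
rewrite E normrM (ger0_norm (ler0n _ _)) mulrACA mulVf ?mulr1; last first.
  by rewrite pnatr_eq0 -lt0n fact_gt0.
rewrite /c normrM normfV mulrCA -[leLHS]mulr1 ler_wpM2l//.
rewrite ler_pdivlMr ?normr_gt0// mul1r /p horner_prod normr_prod.
have {}sab z : z \in s -> `|('X - z%:P).[t]| <= b - a.
  move=> zs; rewrite hornerXsubC; have := sab _ zs; move: tab.
  by move=> /andP[h1 h2] /andP[h3 h4]; rewrite ler_norml; apply/andP; lra.
rewrite /m; elim: (s) sab => [|z r IH] H; first by rewrite big_nil expr0.
rewrite big_cons exprS ler_pM ?prodr_ge0// ?H ?mem_head//.
by apply: IH => u ur; apply: H; rewrite inE ur orbT.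
Qed.

End SmoothPaths.

Section FiniteDifferences.
Context {R : realType}.
Implicit Types (f g : R -> R) (x s t h : R).

Fixpoint diffL h (k : nat) t : seq (R * R) :=
  if k is k'.+1 then diffL h k' (t + h) ++ scaleL (- 1) (diffL h k' t)
  else [:: (1, t)].

Lemma lin_diffS h k t f :
  lin (diffL h k.+1 t) f = lin (diffL h k (t + h)) f - lin (diffL h k t) f.
Proof. by rewrite /= lin_cat lin_scale mulN1r. Qed.

Lemma lin_diff_shift h k t f :
  lin (diffL h k (t + h)) f = lin (diffL h k t) (fun u => f (u + h)).
Proof.
elim: k t => [|k IH] t; first by rewrite /= !lin1.
by rewrite !lin_diffS !IH.
Qed.

Lemma smooth_diff f h : smooth f ->
  smooth (fun u => f (u + h) - f u) /\
  forall k, derive1n k (fun u => f (u + h) - f u) =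
    (fun u => derive1n k f (u + h) - derive1n k f u).
Proof.
move=> sf; pose F k (t : R) := derive1n k f (t + h) - derive1n k f t.
have F0 : F 0%N = (fun t => f (t + h) - f t) by [].
have dF k (t : R) : is_derive t 1 (F k) (F k.+1 t).
  have := smooth_is_derive k t sf => d1.
  have := smooth_is_derive k (t + h) sf => d2.
  have d3 : is_derive t 1 (fun u => derive1n k f (u + h)) (derive1n k.+1 f (t + h)).
    have d4 : is_derive t 1 (fun u : R => u + h) 1 by apply: is_derive_eq; rewrite addr0.
    have := @is_derive1_comp R (derive1n k f) (fun u => u + h) t _ _ d2 d4.
    by rewrite mulr1.
  exact: is_deriveB.
by split; [exact: smooth_ext dF|move=> k; exact: derive1n_ext dF k].
Qed.

(** mean value theorem for iterated differences *)
Lemma diff_mean_value f h k t : 0 < h -> smooth f ->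
  exists2 xi, t <= xi <= t + k%:R * h & lin (diffL h k t) f = h ^+ k * derive1n k f xi.
Proof.
move=> h0; elim: k f => [|k IH] f sf.
  by exists t; rewrite ?mul0r ?addr0 ?lexx// lin1 expr0.
have [sg dg] := smooth_diff h sf.
have [xi /andP[x1 x2] E] := IH _ sg.
have xh : xi < xi + h by rewrite ltrDl.
have [c cxi Ec] := @MVT _ (derive1n k f) (derive1n k.+1 f) xi (xi + h) xh
  (fun y _ => smooth_is_derive k y sf) (continuous_subspaceT (@smooth_continuous R f k sf)).
exists c.
  move: cxi; rewrite in_itv/= => /andP[c1 c2]; rewrite (le_trans x1 (ltW c1))/=.
  by rewrite -natr1 mulrDl mul1r addrA (le_trans (ltW c2))// lerD2r.
rewrite lin_diffS lin_diff_shift.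
have -> : lin (diffL h k t) (fun u => f (u + h)) - lin (diffL h k t) f =
    lin (diffL h k t) (fun u => f (u + h) - f u).
  by rewrite linD (_ : (fun u => - f u) = (fun u => - 1 * f u)) ?linZ ?mulN1r//; apply/funext => u; rewrite mulN1r.
by rewrite E dg Ec (addrC xi) addrK exprSr mulrA mulrAC.
Qed.

(** the variation of the k-th difference quotient on a grid of [0, T] *)
Definition grid_variation (T : R) (n : nat) f (N : nat) : R :=
  let h := T / N.+1%:R in
  \sum_(i < N.+1) `|lin (diffL h n (i%:R * h)) f| / h ^+ n.-1.

Lemma grid_variation_ge f (T : R) k s t (e : R) : smooth f -> 0 < T -> 0 < e ->
  0 <= s <= T -> 0 <= t <= T ->
  \forall N \near \oo, `|derive1n k f s - derive1n k f t| - e <= grid_variation T k.+1 f N.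
Proof.
move=> sf T0 e0.
have approx (u : R) : 0 <= u <= T -> \forall N \near \oo,
    let h := T / N.+1%:R in exists2 i, (i <= N.+1)%N &
    `|derive1n k f u - lin (diffL h k (i%:R * h)) f / h ^+ k| <= e / 2.
  move=> /andP[u0 uT].
  have /cvgrPdist_le/(_ (e / 2)) := @smooth_continuous R f k sf u.
  rewrite divr_gt0// => /(_ isT) /nbhs_ballP[r /= r0 Hr].
  near=> N; set h := T / N.+1%:R.
  have h0 : 0 < h by rewrite divr_gt0.
  have hN : N.+1%:R * h = T by rewrite /h mulrC divfK.
  pose i := Num.truncn (u / h).
  have uh0 : 0 <= u / h by rewrite divr_ge0// ltW.
  have /andP[i1 i2] := truncn_itv uh0.
  have i1' : i%:R * h <= u by rewrite -ler_pdivlMr.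
  have i2' : u < i.+1%:R * h by rewrite -ltr_pdivrMr.
  exists i.
    rewrite -(@ler_nat R) -(ler_pM2r h0) hN; exact: le_trans i1' uT.
  have [xi /andP[x1 x2] ->] := diff_mean_value k (i%:R * h) h0 sf.
  rewrite mulrC mulKf ?expf_neq0 ?gt_eqF//.
  apply: Hr; rewrite /ball/=.
  have krN : k.+1%:R * h < r.
    rewrite /h mulrA ltr_pdivrMr// -ltr_pdivrMl//.
    apply: (@lt_trans _ _ N%:R); last by rewrite ltr_nat.
    near: N; exact: nbhs_infty_gtr.
  move: krN i2'; rewrite -!natr1 !mulrDl !mul1r => krN i2'.
  have kh : 0 <= k%:R * h by rewrite mulr_ge0// ltW.
  by rewrite ltr_norml; apply/andP; split; lra.
move=> /approx As /approx At; near=> N.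
have [i iN Hi] : exists2 i, (i <= N.+1)%N &
    `|derive1n k f s - lin (diffL (T / N.+1%:R) k (i%:R * (T / N.+1%:R))) f / (T / N.+1%:R) ^+ k| <= e / 2.
  by near: N.
have [j jN Hj] : exists2 i, (i <= N.+1)%N &
    `|derive1n k f t - lin (diffL (T / N.+1%:R) k (i%:R * (T / N.+1%:R))) f / (T / N.+1%:R) ^+ k| <= e / 2.
  by near: N.
rewrite /grid_variation/=; set h := T / N.+1%:R in Hi Hj *.
have h0 : 0 < h by rewrite divr_gt0.
pose D (i : nat) := lin (diffL h k (i%:R * h)) f / h ^+ k.
have DS (l : nat) : `|lin (diffL h k.+1 (l%:R * h)) f| / h ^+ k = `|D l.+1 - D l|.
  have lh : l.+1%:R * h = l%:R * h + h by rewrite -natr1 mulrDl mul1r.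
  rewrite /D -mulrBl lh -lin_diffS normrM (@gtr0_norm _ _^-1)//.
  by rewrite invr_gt0 exprn_gt0.
have tele (a b : nat) : (a <= b)%N -> (b <= N.+1)%N ->
    `|D b - D a| <= \sum_(l < N.+1) `|D l.+1 - D l|.
  move=> ab bN; rewrite -(telescope_sumr D ab).
  rewrite (le_trans (ler_norm_sum _ _ _))// big_nat -(big_mkord xpredT (fun l => `|D l.+1 - D l|)).
  rewrite -big_nat [leRHS](big_cat_nat (n := b))//= [leRHS]addrC -[leLHS]add0r lerD ?sumr_ge0//.
  by rewrite [leRHS](big_cat_nat (n := a))//= lerDr sumr_ge0.
under eq_bigr do rewrite DS.
have {}tele : `|D i - D j| <= \sum_(l < N.+1) `|D l.+1 - D l|.
  by have [ij|/ltnW ij] := leqP i j; [rewrite distrC|]; exact: tele.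
rewrite lerBlDr (le_trans _ (lerD tele (lexx _)))//.
rewrite -/(D i) -/(D j) in Hi Hj.
have -> : derive1n k f s - derive1n k f t = (derive1n k f s - D i) + ((D i - D j) + (D j - derive1n k f t)) by ring.
rewrite (le_trans (ler_normD _ _))// (le_trans (lerD (lexx _) (ler_normD _ _)))//.
rewrite (distrC (D j)); move: Hi Hj; set A := `|_ - D i|; set B := `|_ - D j|; lra.
Unshelve. all: end_near. Qed.

Lemma zeros_variation f (T : R) (s : seq R) t (e : R) : smooth f -> 0 < T -> 0 < e ->
  uniq s -> (0 < size s)%N -> (forall z, z \in s -> 0 <= z <= T) ->
  (forall z, z \in s -> f z = 0) -> 0 <= t <= T ->
  \forall N \near \oo,
    `|f t| * ((size s).-1`!%:R / T ^+ (size s).-1) - e <= grid_variation T (size s) f N.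
Proof.
move=> sf T0 e0 us s0 sT sz tT; set n := size s.
have nE : n = n.-1.+1 by rewrite prednK.
have nn : (n.-1 < size s)%N by rewrite ltn_predL.
have [z0 z0T fz0] := rolle_zero sf us sT sz nn.
have [xi xiT E] : exists2 xi, 0 <= xi <= T &
    `|f t| <= T ^+ n.-1 / n.-1`!%:R * `|derive1n n.-1 f xi|.
  have := @interpolation_remainder R f 0 T t (behead s) sf.
  rewrite size_behead subr0 => /(_ _ _ tT)[|z zs|z zs|xi xiT E].
  - by move: us; case: (s) => //= a r /andP[].
  - by apply: sT; exact: mem_behead.
  - by apply: sz; exact: mem_behead.
  - by exists xi.
rewrite nE; have := grid_variation_ge n.-1 sf T0 e0 xiT z0T.
apply: filterS => N; apply: le_trans; rewrite fz0 subr0 lerD2r.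
rewrite -ler_pdivlMr; last by rewrite divr_gt0 ?exprn_gt0// ltr0n fact_gt0.
by rewrite invf_div mulrC.
Qed.

End FiniteDifferences.

Section DiffSpectral.
Context {R : realType} (mu : probability (measurableTypeR R) R).
Implicit Types (x t h : R).

Lemma sin_le_norm x : `|sin x| <= `|x|.
Proof.
wlog x0 : x / 0 < x => [H|].
  have [x0|x0|->] := ltgtP x 0; last by rewrite sin0 normr0.
  - by have := H (- x); rewrite sinN !normrN oppr_gt0; exact.
  - exact: H.
have [xi _ ] := @MVT _ sin cos 0 x x0 (fun y _ => is_derive_sin y)
  (continuous_subspaceT (@continuous_sin R)).
by rewrite sin0 !subr0 => ->; rewrite normrM ler_piMl// cos_max.
Qed.

Lemma cosB1_le x : 2 * (1 - cos x) <= x ^+ 2.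
Proof.
have sq : sin (x / 2) ^+ 2 <= (x / 2) ^+ 2.
  rewrite -(real_normK (num_real (sin _))) -(real_normK (num_real (x / 2))).
  by rewrite lerXn2r ?nnegrE//; exact: sin_le_norm.
have E : cos x = 1 - 2 * sin (x / 2) ^+ 2.
  rewrite {1}(splitr x) cosD -!expr2; have := cos2Dsin2 (x / 2); lra.
rewrite E; move: sq; rewrite expr_div_n; lra.
Qed.

Lemma diff_spectral h k t x :
  cosL (diffL h k t) x ^+ 2 + sinL (diffL h k t) x ^+ 2 <= ((h * x) ^+ 2) ^+ k.
Proof.
elim: k t => [|k IH] t; first by rewrite /cosL /sinL /= !lin1 !mul1r cos2Dsin2 expr0.
set L := diffL h k t; set c := cosL L x; set s := sinL L x.
have Ec : cosL (diffL h k.+1 t) x = (cos (h * x) - 1) * c - sin (h * x) * s.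
  rewrite /cosL lin_diffS lin_diff_shift -/L.
  rewrite (_ : (fun u => cos ((u + h) * x)) =
    (fun u => cos (h * x) * cos (u * x) + (- sin (h * x)) * sin (u * x))); last first.
    by apply/funext => u; rewrite mulrDl cosD; ring.
  by rewrite linD !linZ -/(cosL L x) -/(sinL L x) -/c -/s; ring.
have Es : sinL (diffL h k.+1 t) x = sin (h * x) * c + (cos (h * x) - 1) * s.
  rewrite /sinL lin_diffS lin_diff_shift -/L.
  rewrite (_ : (fun u => sin ((u + h) * x)) =
    (fun u => sin (h * x) * cos (u * x) + cos (h * x) * sin (u * x))); last first.
    by apply/funext => u; rewrite mulrDl sinD; ring.
  by rewrite linD !linZ -/(cosL L x) -/(sinL L x) -/c -/s; ring.
rewrite Ec Es.
have -> : ((cos (h * x) - 1) * c - sin (h * x) * s) ^+ 2 +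
   (sin (h * x) * c + (cos (h * x) - 1) * s) ^+ 2 =
   (2 * (1 - cos (h * x))) * (c ^+ 2 + s ^+ 2).
  have E2 : (cos (h * x) - 1) ^+ 2 + sin (h * x) ^+ 2 = 2 * (1 - cos (h * x)).
    have := cos2Dsin2 (h * x); rewrite sqrrB1; lra.
  by rewrite -E2; ring.
rewrite [leRHS]exprS; apply: ler_pM; rewrite ?cosB1_le ?IH ?addr_ge0 ?sqr_ge0// mulr_ge0// subr_ge0 cos_le1.
Qed.

Lemma cov_diff_le h n t (M : R) : (abs_moment mu (2 * n) <= M%:E)%E ->
  cov mu (diffL h n t) (diffL h n t) <= h ^+ (2 * n) * M.
Proof.
move=> HM.
pose g (x : measurableTypeR R) : R := `|x| ^+ (2 * n).
have mg : measurable_fun setT g.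
  apply: measurable_funX; exact: (continuous_measurable_fun (@norm_continuous _ R)).
have ig : mu.-integrable setT (EFin \o g).
  apply/integrableP; split; first exact/measurable_EFinP.
  apply: (@le_lt_trans _ _ M%:E); last exact: ltry.
  apply: le_trans HM; rewrite /abs_moment le_eqVlt; apply/orP; left; apply/eqP.
  by apply: eq_integral => x _; rewrite /= ger0_norm// exprn_ge0.
have gM : \int[mu]_x g x <= M.
  by rewrite -lee_fin -EFin_Rintegral.
apply: (@le_trans _ _ (\int[mu]_x (h ^+ (2 * n) * g x))).
  apply: le_Rintegral => //; first exact: integrable_cov.
    by have := integrableZl measurableT (h ^+ (2 * n)) ig; apply: eq_integrable.
  move=> x _; rewrite -!expr2 (le_trans (diff_spectral _ _ _ _))//.
  by rewrite -exprM exprMn /g ![x ^+ _]exprM ![`|x| ^+ _]exprM real_normK ?num_real.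
rewrite RintegralZl// ler_wpM2l// exprM exprn_ge0// sqr_ge0//.
Qed.

End DiffSpectral.

Section Eventually.
Context {R : realType} (d : measure_display) (T : measurableType d)
  (P : probability T R).

Lemma eventually_measure_le (E : nat -> set T) (A : set T) (p : \bar R) :
  (forall N, measurable (E N)) -> measurable A ->
  (forall w, A w -> \forall N \near \oo, E N w) ->
  (\forall N \near \oo, (P (E N) <= p)%E) -> (P A <= p)%E.
Proof.
move=> mE mA AE Ep.
pose F K := \bigcap_(N in [set N | (K <= N)%N]) E N.
have mF K : measurable (F K) by apply: bigcap_measurable => //; exists K => /=.
have mU : measurable (\bigcup_K F K) by exact: bigcup_measurable.
apply: (@le_trans _ _ (P (\bigcup_K F K))).
  have AU : A `<=` \bigcup_K F K.
    move=> w Aw; have [K _ HK] := AE w Aw.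
    by exists K => // N /= KN; exact: HK.
  by apply: le_measure; rewrite ?inE.
have ndF : nondecreasing_seq F.
  move=> a b ab; apply/subsetPset => w Fw N /= bN; apply: Fw => /=.
  exact: leq_trans bN.
have cF := @nondecreasing_cvg_mu _ _ _ P F mF mU ndF.
rewrite -(cvg_lim _ cF)//; apply: lime_le; first by apply/cvg_ex; exists (P (\bigcup_K F K)).
apply: filterS Ep => K; apply: le_trans.
have FE : F K `<=` E K by move=> w Fw; apply: Fw => /=.
by apply: le_measure; rewrite ?inE.
Qed.

Lemma markov_ge0 (g : T -> \bar R) (E : set T) (a : R) (B : \bar R) : 0 < a ->
  measurable E -> measurable_fun setT g -> (forall w, (0 <= g w)%E) ->
  (forall w, E w -> (a%:E <= g w)%E) -> (\int[P]_w g w <= B)%E ->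
  (P E <= (a^-1)%:E * B)%E.
Proof.
move=> a0 mE mg g0 Eg HB.
have H : (a%:E * P E <= B)%E.
  apply: le_trans HB.
  have -> : P E = (\int[P]_w (\1_E w)%:E)%E by rewrite integral_indic// setIT.
  rewrite -ge0_integralZl//; last first.
  - by rewrite lee_fin ltW.
  - exact/measurable_EFinP.
  apply: ge0_le_integral => //.
  - by move=> w _; rewrite mule_ge0// lee_fin ?ltW.
  - by apply: measurable_funeM; apply/measurable_EFinP.
  - move=> w _; rewrite indicE; have [/set_mem wE|_] := boolP (w \in E).
      by rewrite mule1 Eg.
    by rewrite mule0.
have -> : P E = ((a^-1)%:E * (a%:E * P E))%E.
  by rewrite muleA -EFinM mulVf ?mul1e// gt_eqF.
by apply: lee_wpmul2l => //; rewrite lee_fin invr_ge0 ltW.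
Qed.

End Eventually.

Section Convexity.
Context {R : realType}.

Lemma expR_mean_le (n : nat) (y : 'I_n.+1 -> R) :
  expR ((n.+1%:R)^-1 * \sum_i y i) <= (n.+1%:R)^-1 * \sum_i expR (y i).
Proof.
set m := _^-1 * \sum_i y i.
have n0 : 0 < n.+1%:R :> R by rewrite ltr0n.
rewrite ler_pdivlMl//.
have H i : expR m * (1 + (y i - m)) <= expR (y i).
  have -> : expR (y i) = expR m * expR (y i - m) by rewrite -expRD; congr expR; ring.
  by rewrite ler_wpM2l ?expR_ge0// expR_ge1Dx.
apply: (@le_trans _ _ (\sum_i expR m * (1 + (y i - m)))); last exact: ler_sum.
rewrite -mulr_sumr big_split/= sumr_const card_ord sumrB sumr_const card_ord.
rewrite -[m *+ _]mulr_natl /m mulrA divff ?gt_eqF// mul1r subrr addr0.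
by rewrite mulrC.
Qed.

Lemma sqr_mean_le (n : nat) (y : 'I_n.+1 -> R) :
  ((n.+1%:R)^-1 * \sum_i y i) ^+ 2 <= (n.+1%:R)^-1 * \sum_i y i ^+ 2.
Proof.
set m := _^-1 * \sum_i y i.
have n0 : 0 < n.+1%:R :> R by rewrite ltr0n.
rewrite ler_pdivlMl//.
have H i : m ^+ 2 + 2 * m * (y i - m) <= y i ^+ 2.
  by rewrite -subr_ge0 (_ : _ - _ = (y i - m) ^+ 2) ?sqr_ge0//; ring.
apply: (@le_trans _ _ (\sum_i (m ^+ 2 + 2 * m * (y i - m)))); last exact: ler_sum.
rewrite big_split/= sumr_const card_ord -mulr_sumr sumrB sumr_const card_ord.
have -> : \sum_i y i = n.+1%:R * m by rewrite /m mulrA divff ?gt_eqF// mul1r.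
by rewrite -[m *+ _]mulr_natl subrr mulr0 addr0 mulr_natl.
Qed.

End Convexity.

Section VariationTail.
Context {R : realType} (mu : probability (measurableTypeR R) R)
  (d : measure_display) (Omega : measurableType d) (P : probability Omega R)
  (X : R -> {RV P >-> R}).
Hypothesis hX : smooth_stationary_gaussian mu X.
Local Notation path w := (fun t => X t w).

Lemma measurable_grid_variation T n N :
  measurable_fun setT (fun w => grid_variation T n (path w) N).
Proof.
apply: measurable_sum => i; apply: measurable_funM => //.
apply: measurableT_comp; first exact: (continuous_measurable_fun (@norm_continuous _ R)).
exact: measurable_rv.
Qed.

Lemma grid_variation_exp (T M : R) n N : 0 < T -> 0 < M -> (0 < n)%N ->
  (abs_moment mu (2 * n) <= M%:E)%E ->
  (\int[P]_w (expR (grid_variation T n (path w) N ^+ 2 / (4 * (T ^+ 2 * M))))%:E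
     <= (Num.sqrt 2)%:E)%E.
Proof.
move=> T0 M0 n0 HM; set c := T ^+ 2 * M.
have c0 : 0 < c by rewrite mulr_gt0// exprn_gt0.
pose h := T / N.+1%:R.
have h0 : 0 < h by rewrite divr_gt0.
have hn0 : 0 < h ^+ n.-1 by rewrite exprn_gt0.
pose L (i : 'I_N.+1) := scaleL (N.+1%:R / h ^+ n.-1) (diffL h n (i%:R * h)).
have covL i : cov mu (L i) (L i) <= c.
  rewrite /L cov_scalel covC cov_scalel mulrA -expr2.
  apply: (@le_trans _ _ ((N.+1%:R / h ^+ n.-1) ^+ 2 * (h ^+ (2 * n) * M))).
    by rewrite ler_wpM2l ?sqr_ge0//; exact: cov_diff_le.
  rewrite mulrA /c ler_wpM2r ?(ltW M0)//.
  have hn : h ^+ n = h * h ^+ n.-1 by rewrite -exprS prednK.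
  rewrite mulnC exprM -exprMn hn.
  rewrite (_ : N.+1%:R / h ^+ n.-1 * (h * h ^+ n.-1) = T)//.
  by rewrite mulrCA divfK ?gt_eqF// /h divfK.
have VE w : grid_variation T n (path w) N = (N.+1%:R)^-1 * \sum_i `|rv X (L i) w|.
  rewrite /grid_variation mulr_sumr; apply: eq_bigr => i _.
  rewrite /L /rv lin_scale normrM (@ger0_norm _ (_ / _)); last by rewrite divr_ge0// ltW.
  by rewrite -/h !mulrA mulVf ?mul1r 1?mulrC// gt_eqF// ltr0n.
have mrv i : measurable_fun setT (fun w => expR (rv X (L i) w ^+ 2 / (4 * c))).
  apply: measurableT_comp => //; apply: measurable_funM => //.
  by apply: measurable_funX; exact: measurable_rv.
apply: (@le_trans _ _ (\int[P]_w ((N.+1%:R^-1)%:E *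
   \sum_(i < N.+1) (expR (rv X (L i) w ^+ 2 / (4 * c)))%:E)%E)%E).
  apply: ge0_le_integral => //.
  - apply/measurable_EFinP; apply: measurableT_comp => //; apply: measurable_funM => //.
    by apply: measurable_funX; exact: measurable_grid_variation.
  - apply: measurable_funeM; apply: emeasurable_sum => i; exact/measurable_EFinP.
  - move=> w _; rewrite sumEFin -EFinM lee_fin VE.
    apply: le_trans (expR_mean_le _); rewrite ler_expR.
    rewrite -mulr_suml [leRHS]mulrA; apply: ler_wpM2r.
      by rewrite invr_ge0 mulr_ge0 ?(ltW c0).
    apply: le_trans (sqr_mean_le _) _; rewrite ler_wpM2l//.
    by apply: ler_sum => i _; rewrite real_normK ?num_real.
rewrite ge0_integralZl//; last first.
- by move=> w _; apply: sume_ge0 => i _; rewrite lee_fin expR_ge0.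
- apply: emeasurable_sum => i; exact/measurable_EFinP.
rewrite ge0_integral_sum//; last by move=> i; exact/measurable_EFinP.
apply: (@le_trans _ _ ((N.+1%:R^-1)%:E * (\sum_(i < N.+1) (Num.sqrt 2)%:E))%E).
  apply: lee_wpmul2l; first by rewrite lee_fin.
  by apply: lee_sum => i _; apply: (rv_exp_sqr hX).
rewrite sumEFin -EFinM lee_fin sumr_const card_ord -[X in _ * X]mulr_natl mulrA.
by rewrite mulVf ?mul1r.
Qed.

Lemma grid_variation_tail (T M S : R) n (A : set Omega) : 0 < T -> 0 < M ->
  (0 < n)%N -> 0 <= S -> (abs_moment mu (2 * n) <= M%:E)%E -> measurable A ->
  (forall w, A w -> \forall N \near \oo, S <= grid_variation T n (path w) N) ->
  (P A <= (expR (- (S ^+ 2 / (4 * (T ^+ 2 * M)))) * Num.sqrt 2)%:E)%E.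
Proof.
move=> T0 M0 n0 S0 HM mA HA.
pose E N := [set w | S <= grid_variation T n (path w) N].
have mE N : measurable (E N).
  rewrite (_ : E N = (fun w => grid_variation T n (path w) N) @^-1` `[S, +oo[); last first.
    by apply/seteqP; split => w /=; rewrite in_itv/= andbT.
  by rewrite -[X in measurable X]setTI; exact: measurable_grid_variation.
apply: (@eventually_measure_le _ _ _ _ E) => //.
apply: nearW => N; rewrite EFinM expRN.
apply: (@markov_ge0 _ _ _ _ (fun w => (expR (grid_variation T n (path w) N ^+ 2 / (4 * (T ^+ 2 * M))))%:E)) => //.
- exact: expR_gt0.
- apply/measurable_EFinP; apply: measurableT_comp => //; apply: measurable_funM => //.
  by apply: measurable_funX; exact: measurable_grid_variation.
- move=> w Ew; rewrite lee_fin ler_expR; apply: ler_wpM2r.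
    by rewrite invr_ge0; apply: mulr_ge0 => //; apply: mulr_ge0; [exact: sqr_ge0|exact: ltW].
  by rewrite lerXn2r ?nnegrE//; exact: le_trans Ew.
- exact: grid_variation_exp.
Qed.

End VariationTail.

Section Counting.
Context {R : realType}.

Lemma le_countingP (A : set R) (n : nat) :
  (n%:R%:E <= counting A :> \bar R)%E <->
  exists s : seq R, [/\ uniq s, size s = n & forall x, x \in s -> A x].
Proof.
rewrite /counting; case: asboolP => fA; split.
- rewrite lee_fin ler_nat => nA.
  exists (take n (finmap.enum_fset (fset_set A))); split.
  + exact/take_uniq/finmap.fset_uniq.
  + by rewrite size_takel.
  + by move=> x /mem_take; rewrite in_fset_set// => /set_mem.
- move=> [s [us <- sA]]; rewrite lee_fin ler_nat.
  by apply: uniq_leq_size => // x /sA Ax; rewrite in_fset_set// mem_set.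
- move=> _; have [B BA nB] := infinite_set_fset n fA.
  exists (take n (finmap.enum_fset B)); split.
  + exact/take_uniq/finmap.fset_uniq.
  + by rewrite size_takel.
  + by move=> x /mem_take xB; exact: BA.
- by move=> _; rewrite leey.
Qed.

Lemma seq_gap (s : seq R) : exists2 delta : R, 0 < delta &
  forall x y, x \in s -> y \in s -> x != y -> delta <= `|x - y|.
Proof.
suff [delta d0 H] : exists2 delta : R, 0 < delta &
    forall q, q \in [seq `|p.1 - p.2| | p <- [seq (x, y) | x <- s, y <- s] & p.1 != p.2] -> delta <= q.
  exists delta => // x y xs ys xy; apply: H; apply/mapP; exists (x, y) => //.
  by rewrite mem_filter /= xy; apply/allpairsP; exists (x, y).
have : all (fun q => 0 < q) [seq `|p.1 - p.2| | p <- [seq (x, y) | x <- s, y <- s] & p.1 != p.2].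
  by apply/allP => q /mapP[p]; rewrite mem_filter => /andP[pn _] ->; rewrite normr_gt0 subr_eq0.
elim: [seq _ | _ <- _ & _] => [|q t IH] /=; first by exists 1.
case/andP => q0 /IH[delta d0 H]; exists (Num.min q delta); first by rewrite lt_min q0.
move=> r; rewrite inE => /predU1P[->|/H]; first by rewrite ge_min lexx.
by apply: le_trans; rewrite ge_min lexx orbT.
Qed.

Lemma alternation_zeros (t : nat -> R) (g : R -> R) (n : nat) : continuous g ->
  (forall i, (i < n)%N -> t i < t i.+1) ->
  (forall i, (i <= n)%N -> 0 < (- 1) ^+ i * g (t i)) ->
  exists s : seq R, [/\ uniq s, size s = n &
    forall x, x \in s -> t 0%N <= x <= t n /\ g x = 0].
Proof.
move=> cg tlt galt.
have tle i j : (i <= j)%N -> (j <= n)%N -> t i <= t j.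
  elim: j => [|j IH]; first by rewrite leqn0 => /eqP ->.
  rewrite leq_eqVlt => /predU1P[->//|ij] jn.
  by rewrite (le_trans (IH ij (ltnW jn)))// ltW// tlt.
have Z i : exists z, (i < n)%N -> t i < z < t i.+1 /\ g z = 0.
  have [iltn|_] := boolP (i < n)%N; last by exists 0.
  have h1 := galt i (ltnW iltn); have h2 := galt i.+1 iltn.
  have nz1 : g (t i) != 0 by apply: contraTneq h1 => ->; rewrite mulr0 ltxx.
  have nz2 : g (t i.+1) != 0 by apply: contraTneq h2 => ->; rewrite mulr0 ltxx.
  have opp : g (t i) * g (t i.+1) < 0.
    have := mulr_gt0 h1 h2; rewrite exprS mulN1r mulNr mulrN oppr_gt0.
    by rewrite mulrACA -expr2 sqrr_sign mul1r.
  have [z zi gz] : exists2 z, z \in `[t i, t i.+1] & g z = 0.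
    apply: IVT.
    - by rewrite ltW// tlt.
    - exact: continuous_subspaceT.
    - rewrite ge_min le_max; have [h|h] := ltP (g (t i)) 0.
        by move: opp; rewrite nmulr_rlt0// => /ltW ->; rewrite ?orbT ?(ltW h) ?h /= ?orbT.
      have hp : 0 < g (t i) by rewrite lt_neqAle eq_sym nz1.
      by move: opp; rewrite pmulr_rlt0// => /ltW ->; rewrite ?orbT ?h ?(ltW hp) /= ?orbT.
  exists z => _; split => //; move: zi; rewrite in_itv/= => /andP[a b].
  rewrite !lt_neqAle a b !andbT; apply/andP; split.
    by apply: contra_neq nz1 => ->.
  by apply: contra_neq nz2 => <-.
have [z Hz] := choice Z.
have zlt i j : (i < j)%N -> (j < n)%N -> z i < z j.
  move=> ij jn; have [/andP[_ h1] _] := Hz i (ltn_trans ij jn).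
  have [/andP[h2 _] _] := Hz j jn.
  by rewrite (lt_trans h1)// (le_lt_trans _ h2)// tle// ltnW.
exists [seq z i | i <- iota 0 n]; split.
- rewrite map_inj_in_uniq ?iota_uniq// => i j; rewrite !mem_iota !add0n /= => iltn jn zij.
  have [ij|ij|//] := ltngtP i j.
    by have := zlt _ _ ij jn; rewrite zij ltxx.
  by have := zlt _ _ ij iltn; rewrite zij ltxx.
- by rewrite size_map size_iota.
- move=> x /mapP; case=> i; rewrite mem_iota add0n /= => iltn ->.
  have [/andP[h1 h2] gz] := Hz i iltn; split => //; apply/andP; split.
    by rewrite (le_trans _ (ltW h1))// tle// ltnW.
  by rewrite (le_trans (ltW h2))// tle.
Qed.

End Counting.

Section ZeroCells.
Context {R : realType}.
Implicit Types (f : R -> R).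

Lemma zero_in_cell f (a b : R) : continuous f -> a <= b ->
  (exists2 x, a <= x <= b & f x = 0) <->
  (forall l : nat, exists M i : nat, (i <= M.+1)%N /\
     `|f (a + i%:R / M.+1%:R * (b - a))| < l.+1%:R^-1).
Proof.
move=> cf ab; split.
- move=> [x /andP[ax xb] fx] l.
  move: ab; rewrite le_eqVlt => /predU1P[ab|ab].
    exists 0%N, 0%N; split => //; rewrite mul0r mul0r addr0.
    by rewrite (_ : a = x) ?fx ?normr0 ?invr_gt0//; apply/eqP; rewrite eq_le ax ab xb.
  have l0 : 0 < l.+1%:R^-1 :> R by rewrite invr_gt0.
  have /cvgrPdist_lt/(_ _ l0)/nbhs_ballP[r /= r0 Hr] := cf x.
  have ba : 0 < b - a by rewrite subr_gt0.
  pose M := Num.bound ((b - a) / r).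
  have HM : (b - a) / M.+1%:R < r.
    rewrite ltr_pdivrMr// mulrC -ltr_pdivrMr//.
    apply: lt_trans (archi_boundP _) _; first by rewrite divr_ge0 ?ltW.
    by rewrite ltr_nat.
  pose h := (b - a) / M.+1%:R.
  have h0 : 0 < h by rewrite divr_gt0.
  have u0 : 0 <= (x - a) / h by rewrite divr_ge0 ?subr_ge0// ltW.
  have /andP[i1 i2] := truncn_itv u0.
  exists M, (Num.truncn ((x - a) / h)); split.
    rewrite -(@ler_nat R) (le_trans i1)// ler_pdivrMr// /h mulrCA divff ?gt_eqF// mulr1.
    by rewrite lerD2r.
  have -> : (Num.truncn ((x - a) / h))%:R / M.+1%:R * (b - a) = (Num.truncn ((x - a) / h))%:R * h.
    by rewrite /h mulrAC mulrA.
  set k := Num.truncn _ in i1 i2 *.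
  have := Hr (a + k%:R * h); rewrite /ball/= fx sub0r normrN; apply.
  rewrite -/h in HM; have E : k.+1%:R * h = k%:R * h + h by rewrite -natr1 mulrDl mul1r.
  move: i1 i2; rewrite ler_pdivlMr// ltr_pdivrMr// E => i1 i2.
  by rewrite ltr_norml; apply/andP; split; move: HM i1 i2; lra.
- move=> H.
  have cnf : {within `[a, b], continuous (fun x => `|f x|)}.
    apply: continuous_subspaceT => x.
    by apply: (cvg_comp f (fun y => `|y|)); [exact: cf|exact: norm_continuous].
  have [c cab cmin] := EVT_min ab cnf.
  exists c; first by move: cab; rewrite in_itv.
  apply/eqP; rewrite -normr_le0 leNgt; apply/negP => fc.
  pose l := Num.bound (`|f c|^-1).
  have Hl : l.+1%:R^-1 < `|f c|.
    rewrite -[ltRHS]invrK ltf_pV2 ?posrE ?invr_gt0//.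
    apply: lt_trans (archi_boundP _) _; first by rewrite invr_ge0.
    by rewrite ltr_nat.
  have [M [i [iM Hi]]] := H l.
  suff pin : a + i%:R / M.+1%:R * (b - a) \in `[a, b].
    by have := cmin _ pin; rewrite leNgt (lt_trans Hi Hl).
  have q0 : 0 <= i%:R / M.+1%:R :> R by rewrite divr_ge0.
  have q1 : i%:R / M.+1%:R <= 1 :> R by rewrite ler_pdivrMr// mul1r ler_nat.
  rewrite in_itv/= lerDl mulr_ge0 ?subr_ge0//= -lerBrDl ler_piMl// subr_ge0//.
Qed.

Definition separated (K : nat) (J : {set 'I_K}) :=
  forall i j : 'I_K, i \in J -> j \in J -> i != j -> (i.+1 < j)%N \/ (j.+1 < i)%N.

Lemma zeros_cells f (T : R) (n : nat) : 0 < T ->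
  (exists s : seq R, [/\ uniq s, size s = n & forall x, x \in s -> x \in `[0, T] /\ f x = 0]) <->
  (exists K : nat, exists J : {set 'I_K.+1}, [/\ #|J| = n, separated J &
     forall i : 'I_K.+1, i \in J ->
       exists2 x, i%:R * (T / K.+1%:R) <= x <= i.+1%:R * (T / K.+1%:R) & f x = 0]).
Proof.
move=> T0; split.
- move=> [s [us ss sz]].
  have [delta d0 gap] := seq_gap s.
  pose K := Num.bound (2 * T / delta).
  pose h := T / K.+1%:R.
  have h0 : 0 < h by rewrite divr_gt0.
  have hK : K.+1%:R * h = T by rewrite /h mulrC divfK.
  have hd : 2 * h < delta.
    rewrite /h mulrA ltr_pdivrMr// [ltRHS]mulrC -ltr_pdivrMr//.
    apply: lt_trans (archi_boundP _) _; first by rewrite divr_ge0 ?mulr_ge0 ?ltW.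
    by rewrite ltr_nat.
  have idx x : exists i : 'I_K.+1, x \in s -> i%:R * h <= x <= i.+1%:R * h.
    have [xs|_] := boolP (x \in s); last by exists ord0.
    have [+ _] := sz x xs; rewrite in_itv/= => /andP[x0 xT].
    have u0 : 0 <= x / h by rewrite divr_ge0// ltW.
    have /andP[i1 i2] := truncn_itv u0.
    move: i1 i2; rewrite ler_pdivlMr// ltr_pdivrMr// => i1 i2.
    have [iK|iK] := ltnP (Num.truncn (x / h)) K.+1.
      by exists (Ordinal iK) => _ /=; rewrite i1 ltW.
    exists ord_max => _ /=; rewrite hK xT andbT.
    apply: le_trans i1; rewrite ler_wpM2r ?(ltW h0)// ler_nat ltnW//.
  have [g Hg] := choice idx.
  have gsep x y : x \in s -> y \in s -> x != y -> ((g x).+1 < g y)%N \/ ((g y).+1 < g x)%N.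
    move=> xs ys xy; have := gap _ _ xs ys xy => dxy.
    have /andP[a1 a2] := Hg x xs; have /andP[b1 b2] := Hg y ys.
    apply/orP; rewrite !ltnNge -negb_and; apply/negP => /andP[h1 h2].
    have h1' : (g y)%:R * h <= (g x).+1%:R * h by rewrite ler_wpM2r ?(ltW h0)// ler_nat.
    have h2' : (g x)%:R * h <= (g y).+1%:R * h by rewrite ler_wpM2r ?(ltW h0)// ler_nat.
    move: (lt_le_trans hd dxy); apply/negP; rewrite -leNgt.
    move: a2 b2 h1' h2'; rewrite -!natr1 !mulrDl !mul1r => a2 b2 h1' h2'.
    by rewrite ler_norml; apply/andP; split; lra.
  have ginj : {in s &, injective g}.
    move=> x y xs ys gxy; apply/eqP; apply: contraT => /(gsep _ _ xs ys); rewrite gxy.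
    by case; rewrite ltnNge leqnSn.
  exists K, [set i | i \in [seq g x | x <- s]]%SET; split.
  + by rewrite cardsE (card_uniqP _) ?size_map// map_inj_in_uniq.
  + move=> i j; rewrite !inE => /mapP[x xs ->] /mapP[y ys ->] gxy.
    by apply: gsep => //; apply: contra_neq gxy => ->.
  + move=> i; rewrite inE => /mapP[x xs ->]; exists x; first exact: Hg.
    by have [] := sz x xs.
- move=> [K [J [cJ sepJ HJ]]].
  set h := T / K.+1%:R in HJ.
  have h0 : 0 < h by rewrite divr_gt0.
  have hK : K.+1%:R * h = T by rewrite /h mulrC divfK.
  have zx (i : 'I_K.+1) : exists x, i \in J -> i%:R * h <= x <= i.+1%:R * h /\ f x = 0.
    have [iJ|_] := boolP (i \in J); last by exists 0.
    by have [x x1 x2] := HJ i iJ; exists x.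
  have [z Hz] := choice zx.
  have zlt (i j : 'I_K.+1) : i \in J -> j \in J -> (i.+1 < j)%N -> z i < z j.
    move=> iJ jJ ij; have [/andP[_ a] _] := Hz i iJ; have [/andP[b _] _] := Hz j jJ.
    by rewrite (le_lt_trans a)// (lt_le_trans _ b)// ltr_pM2r// ltr_nat.
  exists [seq z i | i <- enum J]; split.
  + rewrite map_inj_in_uniq ?enum_uniq// => i j; rewrite !mem_enum => iJ jJ zij.
    apply/eqP; apply: contraT => /(sepJ _ _ iJ jJ)[] h1.
      by have := zlt _ _ iJ jJ h1; rewrite zij ltxx.
    by have := zlt _ _ jJ iJ h1; rewrite zij ltxx.
  + by rewrite size_map -cardE.
  + move=> x /mapP; case=> i; rewrite mem_enum => iJ ->.
    have [/andP[a b] fz] := Hz i iJ; split => //; rewrite in_itv/=; apply/andP; split.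
      by apply: le_trans a; rewrite mulr_ge0// ltW.
    by apply: (le_trans b); rewrite -hK ler_wpM2r ?(ltW h0)// ler_nat.
Qed.

End ZeroCells.

Section MeasurableZeros.
Context {R : realType} (d : measure_display) (Omega : measurableType d)
  (P : probability Omega R) (X : R -> {RV P >-> R}).
Hypothesis cX : forall w, continuous (fun t => X t w).

Lemma measurable_zero_in_cell (a b : R) : a <= b ->
  measurable [set w | exists2 x, a <= x <= b & X x w = 0].
Proof.
move=> ab.
rewrite (_ : [set w | _] = \bigcap_(l : nat) \bigcup_(M : nat)
   \bigcup_(i in [set i : nat | (i <= M.+1)%N])
   [set w | `|X (a + i%:R / M.+1%:R * (b - a)) w| < l.+1%:R^-1]); last first.
  apply/seteqP; split => w /=.
    move=> /(@zero_in_cell R (fun t => X t w) a b (@cX w) ab) H l _.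
    by have [M [i [iM Hi]]] := H l; exists M => //; exists i.
  move=> H; apply/(@zero_in_cell R (fun t => X t w) a b (@cX w) ab) => l.
  by have [M _ [i iM Hi]] := H l I; exists M, i.
apply: bigcap_measurable => [|l _]; first by exists 0%N.
apply: bigcup_measurable => M _; apply: bigcup_measurable => i _.
set t := a + _; rewrite (_ : [set w | _] = (fun w => `|X t w|) @^-1` `]-oo, l.+1%:R^-1[); last first.
  by apply/seteqP; split => w /=; rewrite in_itv.
rewrite -[X in measurable X]setTI.
have mn : measurable_fun setT (fun w => `|X t w|).
  apply: measurableT_comp; first exact: (continuous_measurable_fun (@norm_continuous _ R)).
  exact: measurable_funP.
by apply: mn => //; exact: measurable_itv.
Qed.

Lemma measurable_nb_zeros (T : R) (n : nat) : 0 < T ->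
  measurable [set w | (n%:R%:E <= nb_zeros X T w)%E].
Proof.
move=> T0.
rewrite (_ : [set w | _] = \bigcup_(K : nat)
   \bigcup_(J in [set J : {set 'I_K.+1} | #|J| = n /\ separated J])
   \bigcap_(i in [set i : 'I_K.+1 | i \in J])
     [set w | exists2 x, i%:R * (T / K.+1%:R) <= x <= i.+1%:R * (T / K.+1%:R) & X x w = 0]); last first.
  apply/seteqP; split => w /=.
    move=> /le_countingP/(zeros_cells _ _ T0)[K [J [cJ sJ HJ]]].
    by exists K => //; exists J.
  move=> [K _ [J [cJ sJ] HJ]]; apply/le_countingP/(zeros_cells _ _ T0).
  by exists K, J.
apply: bigcup_measurable => K _; apply: fin_bigcup_measurable => // J _.
apply: fin_bigcap_measurable => // i _; apply: measurable_zero_in_cell.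
by rewrite ler_wpM2r ?divr_ge0 ?(ltW T0)// ler_nat.
Qed.

End MeasurableZeros.

Section LowerProbability.
Context {R : realType} (mu : probability (measurableTypeR R) R).

Lemma smooth_path (d : measure_display) (Omega : measurableType d)
    (P : probability Omega R) (X : R -> {RV P >-> R}) (w : Omega) :
  smooth_stationary_gaussian mu X -> smooth (fun t => X t w).
Proof. by case=> _ _ _ _ h k t; exact: h. Qed.

Lemma measurable_zeros (d : measure_display) (Omega : measurableType d)
    (P : probability Omega R) (X : R -> {RV P >-> R}) (T : R) (n : nat) :
  smooth_stationary_gaussian mu X -> 0 < T ->
  measurable [set w | (n%:R%:E <= nb_zeros X T w)%E].
Proof.
move=> hX T0; apply: measurable_nb_zeros => // w.
exact: (@smooth_continuous R _ 0 (smooth_path (w:=w) hX)).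
Qed.

Lemma weighted_sum_le (m : nat) (c v : 'I_m -> R) (r : R) : 0 < r ->
  \sum_i c i ^+ 2 = 1 -> \sum_i v i ^+ 2 <= r ^+ 2 -> `|\sum_i c i * v i| <= r.
Proof.
move=> r0 c1 vr.
suff H (v' : 'I_m -> R) : \sum_i v' i ^+ 2 <= r ^+ 2 -> \sum_i c i * v' i <= r.
  rewrite ler_norml H// andbT lerNl -sumrN.
  under eq_bigr do rewrite -mulrN.
  by apply: H; under eq_bigr do rewrite sqrrN.
move=> vr'; rewrite -(ler_pM2l (mulr_gt0 (ltr0n R 2) r0)) mulr_sumr.
apply: (@le_trans _ _ (\sum_i (r ^+ 2 * c i ^+ 2 + v' i ^+ 2))).
  apply: ler_sum => i _; rewrite -subr_ge0.
  by rewrite (_ : _ - _ = (r * c i - v' i) ^+ 2) ?sqr_ge0//; ring.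
rewrite big_split/= -mulr_sumr c1 mulr1; move: vr'; lra.
Qed.

Lemma zeros_prob_lower : nontrivial_ac_part mu -> exists C : nat,
  forall (d : measure_display) (Omega : measurableType d)
    (P : probability Omega R) (X : R -> {RV P >-> R}),
  smooth_stationary_gaussian mu X -> forall (n : nat) (T : R),
  (2 <= n)%N -> 1 <= T ->
  ((n%:R ^- (C * n ^ 2))%:E <= P [set w | (n%:R%:E <= nb_zeros X T w)%E])%E.
Proof.
move=> /orthonormal_grid[B [C [B0 H]]]; exists (7 + 4 * C)%N.
move=> d Omega P X hX n T n2 T1.
have [b [c [Zorth bL c1 recon]]] := H n n.+1 n2 (leqnn _).
have n0 : (0 < n)%N by exact: ltn_trans n2.
have nR0 : 0 < n%:R :> R by rewrite ltr0n.
have nR1 : 1 <= n%:R :> R by rewrite ler1n.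
have nR2 : 2 <= n%:R :> R by rewrite ler_nat.
pose L : R := n%:R ^+ (C * n.+1).
have L1 : 1 <= L by rewrite exprn_ege1.
have L0 : 0 < L by exact: lt_le_trans L1.
pose e : R := (n.+1%:R * L)^-1.
have e0 : 0 < e by rewrite invr_gt0 mulr_gt0.
pose t (i : nat) : R := i%:R / (B%:R * n%:R).
have BN0 : 0 < B%:R * n%:R :> R by rewrite mulr_gt0 ?ltr0n.
pose f (u : R) : R := e * (-1) ^+ (Num.truncn (u * (B%:R * n%:R))).
have ft i : f (t i) = e * (-1) ^+ i by rewrite /f /t divfK ?gt_eqF// natrK.
pose Z j := grid_functional B n (b j).
pose z j := lin (Z j) f.
have zle j : `|z j| <= n.+1%:R^-1.
  rewrite /z /Z lin_grid; apply: le_trans (ler_norm_sum _ _ _) _.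
  under eq_bigr => i _ do rewrite -/(t i) ft normrM normrM normrX normrN1 expr1n mulr1 (gtr0_norm e0).
  rewrite -mulr_suml /e invfM mulrCA ler_piMr ?invr_ge0// ler_pdivrMr// mul1r.
  exact: bL.
have z1 : \sum_j z j ^+ 2 <= 1.
  apply: (@le_trans _ _ (\sum_(j < n.+1) n.+1%:R^-1)).
    apply: ler_sum => j _; rewrite -real_normK ?num_real// expr2.
    apply: le_trans (ler_pM _ _ (zle j) (zle j)) _ => //.
    by rewrite ler_piMr ?invr_ge0// invf_le1// ler1n.
  by rewrite sumr_const card_ord -[_ *+ n.+1]mulr_natr mulVf.
have rho0 : 0 < e / 2 by rewrite divr_gt0.
have cX w : continuous (fun u => X u w) by exact: (@smooth_continuous R _ 0 (smooth_path (w:=w) hX)).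
have T0 : 0 < T by exact: lt_le_trans T1.
have mA := measurable_zeros n hX T0.
apply: (le_trans _ (near_target hX Zorth rho0 z1 mA _)); last first.
  move=> w Hw; apply/le_countingP.
  have close (i : 'I_n.+1) : `|X (t i) w - f (t i)| <= e / 2.
    rewrite (recon (fun u => X u w) i) (recon f i) -sumrB.
    under eq_bigr do rewrite -mulrBr.
    exact: weighted_sum_le.
  have [||s [us ss sz]] := @alternation_zeros R t (fun u => X u w) n (cX w).
  - by move=> i _; rewrite /t ltr_pM2r ?invr_gt0// ltr_nat.
  - move=> i iN; have := close (Ordinal (iN : (i < n.+1)%N)); rewrite /= ft.
    rewrite -signr_odd; case: (odd i); rewrite ?expr1 ?expr0 ler_norml => /andP[]; lra.
  exists s; split => // x /sz[/andP[x0 xn] Xx]; split => //.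
  rewrite in_itv/=; move: x0; rewrite /t mul0r => -> /=.
  apply: (le_trans xn); apply: le_trans T1; rewrite /t ler_pdivrMr// mul1r ler_peMl ?ler1n//.
rewrite lee_fin.
have e2 : (e / 2) ^+ 2 = (4 * n.+1%:R ^+ 2 * L ^+ 2)^-1.
  by rewrite /e; field; rewrite !gt_eqF//= ltr0n.
have key : 1 + 4 * n.+2%:R / (e / 2) ^+ 2 <= (n%:R ^+ 6 * L) ^+ 2.
  have n63 : (n%:R ^+ 6) ^+ 2 = n%:R ^+ 9 * n%:R ^+ 3 :> R by rewrite -exprM -exprD.
  rewrite e2 invrK exprMn n63.
  have p3 : 1 <= n%:R ^+ 3 :> R by rewrite exprn_ege1.
  have p9 : 2 ^+ 9 <= n%:R ^+ 9 :> R by rewrite lerXn2r ?nnegrE.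
  have s1 : n.+2%:R <= 2 * n%:R :> R by rewrite -natrM ler_nat mul2n -addnn -[n.+2]addn2 leq_add2l.
  have s2 : n.+1%:R <= 2 * n%:R :> R by apply: le_trans s1; rewrite ler_nat.
  have s3 : n.+1%:R ^+ 2 <= (2 * n%:R) ^+ 2 :> R by rewrite lerXn2r ?nnegrE ?mulr_ge0.
  have s4 : n.+2%:R * n.+1%:R ^+ 2 <= 8 * n%:R ^+ 3 :> R.
    apply: le_trans (ler_pM _ _ s1 s3) _; rewrite ?exprn_ge0//.
    by rewrite le_eqVlt; apply/orP; left; apply/eqP; ring.
  have L21 : 1 <= L ^+ 2 by rewrite exprn_ege1.
  set a := n%:R ^+ 3 in p3 s4 *; set l := L ^+ 2 in L21 *.
  have al : 1 <= a * l by rewrite mulr_ege1.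
  have s5 : n.+2%:R * n.+1%:R ^+ 2 * l <= 8 * a * l by rewrite ler_wpM2r// (le_trans ler01).
  have s6 : 2 ^+ 9 * (a * l) <= n%:R ^+ 9 * (a * l) by rewrite ler_wpM2r// (le_trans ler01).
  rewrite (_ : 4 * n.+2%:R * (4 * n.+1%:R ^+ 2 * l) = 16 * (n.+2%:R * n.+1%:R ^+ 2 * l)); last by ring.
  have e9 : n%:R ^+ 9 * a * l = n%:R ^+ 9 * (a * l) by rewrite mulrA.
  have e8 : 8 * a * l = 8 * (a * l) by rewrite mulrA.
  move: s5 s6 al; rewrite e9 e8 (_ : 2 ^+ 9 = 512 :> R); last by rewrite -natrX.
  set u := a * l; set v := n.+2%:R * _ * l; set y := n%:R ^+ 9 * u; lra.
have q0 : 0 < n%:R ^+ 6 * L by rewrite mulr_gt0 ?exprn_gt0.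
have sK : Num.sqrt (1 + 4 * n.+2%:R / (e / 2) ^+ 2) <= n%:R ^+ 6 * L.
  by rewrite -[leRHS]gtr0_norm// -sqrtr_sqr ler_sqrt// sqr_ge0.
have sK0 : 0 < Num.sqrt (1 + 4 * n.+2%:R / (e / 2) ^+ 2).
  by rewrite sqrtr_gt0 ltr_wpDr// divr_ge0 ?sqr_ge0.
apply: (@le_trans _ _ (n%:R ^- 3 * (n%:R ^+ 6 * L)^-1 ^+ n.+1)).
  rewrite /L -exprD exprVn -exprM -invfM -exprD lef_pV2 ?posrE ?exprn_gt0//.
  apply: ler_weXn2l => //.
  have a1 : (3 <= n ^ 2)%N by apply: leq_trans (_ : 2 ^ 2 <= _)%N => //; rewrite leq_exp2r.
  have a2 : (n.+1 <= 2 * n)%N by rewrite mul2n -addnn -addn1 leq_add2l.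
  have a3 : (n.+1 * n.+1 <= 2 * n * (2 * n))%N by rewrite leq_mul.
  have a4 : (2 * n <= n * n)%N by rewrite leq_mul2r n2 orbT.
  have a5 : (C * (n.+1 * n.+1) <= C * (2 * n * (2 * n)))%N by rewrite leq_mul2l a3 orbT.
  rewrite mulnDl -[(C * n.+1 * n.+1)%N]mulnA.
  apply: (@leq_trans (n ^ 2 + (6 * (n * n) + C * (2 * n * (2 * n)))))%N.
    by rewrite leq_add// leq_add// leq_mul2l (leq_trans a2 a4) orbT.
  by rewrite -!mulnn; apply/eq_leq; ring.
apply: ler_pM; rewrite ?invr_ge0 ?exprn_ge0 ?invr_ge0 ?(ltW q0)//.
  rewrite lef_pV2 ?posrE ?exprn_gt0//; apply: le_trans (_ : 2 ^+ 3 <= _).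
    by rewrite -natrX.
  by rewrite lerXn2r ?nnegrE.
rewrite lerXn2r ?nnegrE ?invr_ge0 ?(ltW q0) ?sqrtr_ge0//.
by rewrite lef_pV2 ?posrE.
Qed.

End LowerProbability.

Section CosineBound.
Context {R : realType}.
Implicit Types (x : R).

Lemma increasing_from0 (F f : R -> R) x : (forall t : R, is_derive t 1 F (f t)) ->
  F 0 = 0 -> 0 <= x -> (forall t, 0 <= t -> 0 <= f t) -> 0 <= F x.
Proof.
move=> dF F0; rewrite le_eqVlt => /predU1P[<-|x0] f0; first by rewrite F0.
have cF : {within `[0, x], continuous F}.
  by apply: derivable_within_continuous => t _; have [] := dF t.
have [c] := @MVT _ F f 0 x x0 (fun t _ => dF t) cF.
rewrite in_itv/= => /andP[c0 _]; rewrite F0 !subr0 => ->.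
by rewrite mulr_ge0 ?f0// ltW.
Qed.

Lemma sin_ge_cubic x : 0 <= x -> x - x ^+ 3 / 6 <= sin x.
Proof.
move=> x0; rewrite -subr_ge0.
apply: (@increasing_from0 (fun t => sin t - (t - t ^+ 3 / 6)) (fun t => cos t - 1 + t ^+ 2 / 2)) => //.
- by move=> t; apply: is_derive_eq; rewrite ?scaler0 /GRing.scale/= ; field.
- by rewrite sin0; ring.
- by move=> t _; have := cosB1_le t; lra.
Qed.

Lemma cos_le_quartic x : cos x <= 1 - x ^+ 2 / 2 + x ^+ 4 / 24.
Proof.
wlog x0 : x / 0 <= x => [H|].
  have [/H//|/ltW x0] := leP 0 x.
  have e4 : (- x) ^+ 4 = x ^+ 4 by rewrite (exprM _ 2 2) sqrrN -exprM.
  by have := H (- x); rewrite oppr_ge0 cosN sqrrN e4; apply.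
rewrite -subr_ge0.
apply: (@increasing_from0 (fun t => 1 - t ^+ 2 / 2 + t ^+ 4 / 24 - cos t) (fun t => sin t - t + t ^+ 3 / 6)) => //.
- by move=> t; apply: is_derive_eq; rewrite ?scaler0 /GRing.scale/= ; field.
- by rewrite cos0; ring.
- by move=> t t0; have := sin_ge_cubic t0; lra.
Qed.

End CosineBound.

Section GaussWeight.
Context {R : realType} (mu : probability (measurableTypeR R) R)
  (d : measure_display) (Omega : measurableType d) (P : probability Omega R)
  (X : R -> {RV P >-> R}).
Hypothesis hX : smooth_stationary_gaussian mu X.
Local Notation rv := (rv X).
Local Notation cov := (cov mu).

Let wgt s (t : R) w := expR (- (s * X t w ^+ 2)).

Let measurable_wgt s t : measurable_fun setT (wgt s t).
Proof.
apply: measurableT_comp => //; apply: measurableT_comp => //.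
by apply: measurable_funM => //; apply: measurable_funX.
Qed.

Let wgt_ge0 s t w : 0 <= wgt s t w. Proof. exact: expR_ge0. Qed.

Let wgt_le1 s t w : 0 <= s -> wgt s t w <= 1.
Proof.
by move=> s0; rewrite -[leRHS]expR0 ler_expR oppr_le0 mulr_ge0// sqr_ge0.
Qed.

Lemma weight_cos s t W : 0 <= s -> cov [:: (1, t)] W = 0 ->
  \int[P]_w (expR (- (s * X t w ^+ 2)) * cos (rv W w)) =
  (Num.sqrt (1 + 2 * s))^-1 * expR (- cov W W / 2).
Proof.
move=> s0 tW.
have orth (i j : unit) : cov [:: (1, t)] [:: (1, t)] = (i == j)%:R.
  by rewrite cov1 expr1n; case: i; case: j.
have := gker_cos hX (fun=> 0) s0 orth (l := [:: tt]) isT (fun _ _ => tW) 0.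
rewrite big_seq1 cos0 mulr1 expr0n/= mulr0 oppr0 mul0r expR0 mulr1 => <-.
apply: eq_Rintegral => w _.
by rewrite /gker big_seq1 addr0 subr0 /rv lin1 mul1r.
Qed.

Lemma integrable_rv4 W : P.-integrable setT (EFin \o (fun w => rv W w ^+ 4)).
Proof.
pose c := cov W W + 1.
have c0 : 0 < c by rewrite ltr_wpDl// cov_ge0.
have := rv_exp_sqr hX (_ : cov W W <= c) c0 => /(_ _).
rewrite lerDl ler01 => /(_ isT) He.
have me : measurable_fun setT (fun w => expR (rv W w ^+ 2 / (4 * c))).
  apply: measurableT_comp => //; apply: measurable_funM => //.
  by apply: measurable_funX; exact: measurable_rv.
have Hi : P.-integrable setT (EFin \o (fun w => expR (rv W w ^+ 2 / (4 * c)))).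
  apply/integrableP; split; first exact/measurable_EFinP.
  under eq_integral => w _ do rewrite /= ger0_norm ?expR_ge0//.
  by apply: le_lt_trans He _; rewrite ltry.
have := integrableZl measurableT (64 * c ^+ 2) Hi; apply: le_integrable => //.
  by apply/measurable_EFinP; apply: measurable_funX; exact: measurable_rv.
move=> w _ /=; rewrite lee_fin ger0_norm; last by rewrite (exprM _ 2 2) sqr_ge0.
rewrite ger0_norm; last by rewrite mulr_ge0 ?expR_ge0// mulr_ge0 ?sqr_ge0.
set y := rv W w ^+ 2 / (4 * c).
have -> : rv W w ^+ 4 = 16 * c ^+ 2 * y ^+ 2 by rewrite /y; field; rewrite gt_eqF.
have y0 : 0 <= y by rewrite divr_ge0 ?sqr_ge0// mulr_ge0// ltW.
have ey : y ^+ 2 / 4 <= expR y.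
  have h1 : 1 + y / 2 <= expR (y / 2) by exact: expR_ge1Dx.
  have h2 : (1 + y / 2) ^+ 2 <= expR (y / 2) ^+ 2.
    by rewrite lerXn2r ?nnegrE ?expR_ge0// addr_ge0// divr_ge0.
  have e2 : expR (y / 2) ^+ 2 = expR y by rewrite expr2 -expRD -splitr.
  rewrite -e2; apply: le_trans h2; rewrite -subr_ge0.
  by rewrite (_ : _ - _ = 1 + y) ?addr_ge0//; field.
have c2 : 0 <= c ^+ 2 by exact: sqr_ge0.
have := ler_wpM2l c2 ey; lra.
Qed.

Lemma weight_abs W t s tau : 0 <= s -> 0 < tau -> cov [:: (1, t)] W = 0 ->
  cov W W <= tau ^+ 2 ->
  \int[P]_w (`|rv W w| * expR (- (s * X t w ^+ 2))) <= tau * (Num.sqrt (1 + 2 * s))^-1.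
Proof.
move=> s0 tau0 tW Wtau.
set q := (Num.sqrt (1 + 2 * s))^-1.
have q0 : 0 <= q by rewrite invr_ge0 sqrtr_ge0.
have mW := measurable_rv X W.
have iw : P.-integrable setT (EFin \o wgt s t).
  by apply: (@integrable_bounded _ _ _ _ _ 1) => // w; rewrite ger0_norm ?wgt_le1.
have i2 : P.-integrable setT (EFin \o (fun w => rv W w ^+ 2 * wgt s t w)).
  have := rv_integrable_sqr hX W; apply: le_integrable => //.
    by apply/measurable_EFinP; apply: measurable_funM => //; exact: measurable_funX.
  by move=> w _ /=; rewrite lee_fin normrM ler_piMr// ger0_norm ?wgt_le1.
have i4 := integrable_rv4 W.
have ic u : P.-integrable setT (EFin \o (fun w => wgt s t w * cos (rv (scaleL u W) w))).
  apply: (@integrable_bounded _ _ _ _ _ 1).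
    apply: measurable_funM => //; apply: measurableT_comp.
      exact: (continuous_measurable_fun (@continuous_cos R)).
    exact: measurable_rv.
  by move=> w; rewrite normrM mulr_ile1 ?cos_max// ger0_norm ?wgt_le1.
have Ew : \int[P]_w wgt s t w = q.
  have := @weight_cos s t (scaleL 0 W) s0.
  rewrite covC cov_scalel mul0r => /(_ erefl).
  rewrite cov_scalel mul0r oppr0 mul0r expR0 mulr1 -/q => <-.
  by apply: eq_Rintegral => w _; rewrite rv_scale mul0r cos0 mulr1.
set K := \int[P]_w (rv W w ^+ 4).
have bound u : 0 < u -> \int[P]_w (rv W w ^+ 2 * wgt s t w) <= tau ^+ 2 * q + u ^+ 2 * K.
  move=> u0.
  have u2 : 0 < u ^+ 2 by rewrite exprn_gt0.
  have i1 := integrableB measurableT iw (ic u).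
  have i3 := integrableZl measurableT (2 / u ^+ 2) i1.
  have i5 := integrableZl measurableT (u ^+ 2) i4.
  apply: (@le_trans _ _ (\int[P]_w (2 / u ^+ 2 * (wgt s t w - wgt s t w * cos (rv (scaleL u W) w)) + u ^+ 2 * rv W w ^+ 4))).
    apply: le_Rintegral => //; first exact: (integrableD measurableT i3 i5).
    move=> w _; rewrite rv_scale; set x := rv W w; set g := wgt s t w.
    have g0 : 0 <= g by exact: wgt_ge0.
    have g1 : g <= 1 by exact: wgt_le1.
    have x4 : 0 <= x ^+ 4 by rewrite (exprM _ 2 2) sqr_ge0.
    have h1 : x ^+ 2 <= 2 / u ^+ 2 * (1 - cos (u * x)) + u ^+ 2 * x ^+ 4.
      have := cos_le_quartic (u * x); rewrite !exprMn => h.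
      have E1 : u ^+ 2 * (2 / u ^+ 2 * (1 - cos (u * x))) = 2 * (1 - cos (u * x)) by field; rewrite gt_eqF.
      have E2 : u ^+ 2 * (u ^+ 2 * x ^+ 4) = u ^+ 4 * x ^+ 4 by ring.
      rewrite -(ler_pM2l u2) mulrDr E1 E2.
      have : 0 <= u ^+ 4 * x ^+ 4 by rewrite mulr_ge0// (exprM _ 2 2) sqr_ge0.
      move: h; lra.
    have h2 : x ^+ 2 * g <= (2 / u ^+ 2 * (1 - cos (u * x)) + u ^+ 2 * x ^+ 4) * g by rewrite ler_wpM2r.
    apply: (le_trans h2); rewrite mulrDl lerD//.
      by rewrite le_eqVlt; apply/orP; left; apply/eqP; ring.
    by rewrite ler_piMr// mulr_ge0// ltW.
  rewrite RintegralD// RintegralZl// RintegralZl// RintegralB// -/K lerD2r.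
  rewrite Ew weight_cos//; last by rewrite covC cov_scalel covC tW mulr0.
  rewrite cov_scalel covC cov_scalel mulrA -expr2 -/q.
  have v0 := cov_ge0 mu W.
  have e1 : 1 + (- (u ^+ 2 * cov W W) / 2) <= expR (- (u ^+ 2 * cov W W) / 2) by exact: expR_ge1Dx.
  apply: (@le_trans _ _ (2 / u ^+ 2 * (q * (u ^+ 2 * cov W W / 2)))).
    rewrite ler_pM2l ?divr_gt0// -[X in X - _]mulr1 -mulrBr ler_wpM2l//.
    by move: e1; lra.
  rewrite (_ : 2 / u ^+ 2 * (q * (u ^+ 2 * cov W W / 2)) = cov W W * q); last by field; rewrite gt_eqF.
  by rewrite ler_wpM2r.
have K0 : 0 <= K by apply: Rintegral_ge0 => w _; rewrite (exprM _ 2 2) sqr_ge0.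
have sq : \int[P]_w (rv W w ^+ 2 * wgt s t w) <= tau ^+ 2 * q.
  apply/ler_addgt0Pr => e e0.
  have K1 : 0 < K + 1 by rewrite ltr_wpDl.
  have r0 : 0 < Num.sqrt (e / (K + 1)) by rewrite sqrtr_gt0 divr_gt0.
  apply: (le_trans (bound _ r0)); rewrite lerD2l sqr_sqrtr ?divr_ge0 ?(ltW K1) ?(ltW e0)//.
  by rewrite mulrAC ler_pdivrMr// ler_pM2l// lerDl.
have j2 := integrableZl measurableT (2 * tau)^-1 i2.
have j1 := integrableZl measurableT (tau / 2) iw.
apply: (@le_trans _ _ (\int[P]_w ((2 * tau)^-1 * (rv W w ^+ 2 * wgt s t w) + tau / 2 * wgt s t w))).
  have am w : `|rv W w| * wgt s t w <= (2 * tau)^-1 * (rv W w ^+ 2 * wgt s t w) + tau / 2 * wgt s t w.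
    rewrite mulrA -mulrDl ler_wpM2r ?wgt_ge0// -(real_normK (num_real (rv W w))).
    rewrite -subr_ge0 (_ : _ - _ = (2 * tau)^-1 * (`|rv W w| - tau) ^+ 2); last by field; rewrite gt_eqF.
    by rewrite mulr_ge0 ?sqr_ge0// invr_ge0 mulr_ge0// ltW.
  apply: le_Rintegral => //; last exact: (integrableD measurableT j2 j1).
  have := integrableD measurableT j2 j1; apply: le_integrable => //.
    apply/measurable_EFinP; apply: measurable_funM; last exact: measurable_wgt.
    rewrite (_ : (fun w => `|rv W w|) = (@Num.norm R R) \o rv W)//; exact: measurableT_comp.
  move=> w _ /=; rewrite lee_fin ger0_norm ?mulr_ge0//.
  by apply: le_trans (am w) _; exact: ler_norm.
rewrite RintegralD// RintegralZl// RintegralZl// Ew.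
have h : (2 * tau)^-1 * \int[P]_w (rv W w ^+ 2 * wgt s t w) <= (2 * tau)^-1 * (tau ^+ 2 * q).
  by rewrite ler_wpM2l// invr_ge0 mulr_ge0// ltW.
apply: le_trans (lerD h (lexx _)) _.
by rewrite le_eqVlt; apply/orP; left; apply/eqP; field; rewrite gt_eqF.
Qed.

End GaussWeight.

Section Ramp.
Context {R : realType}.
Implicit Types (a b u : R).

Definition clip u : R := Num.max (- 1) (Num.min u 1).

Definition ramp a : R := clip a - 2 / 3 * clip a ^+ 3 + clip a ^+ 5 / 5.

Lemma clipP a : [\/ -1 <= a <= 1 /\ clip a = a, 1 <= a /\ clip a = 1 | a <= -1 /\ clip a = -1].
Proof.
rewrite /clip; have [a1|a1] := leP 1 a.
  by constructor 2; split => //; rewrite max_r// (le_trans _ ler01)// oppr_le0.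
have [a2|a2] := leP (-1) a.
  by constructor 1; split; [exact: ltW|].
by constructor 3; split; [exact: ltW|].
Qed.

Lemma clip_range a : -1 <= clip a <= 1.
Proof. by have [[? ->]|[? ->]|[? ->]] := clipP a => //; rewrite ?lexx ?andbT; lra. Qed.

Lemma clip_contract a b : `|clip b - clip a| <= `|b - a|.
Proof.
suff H (x y : R) : x <= y -> `|clip y - clip x| <= `|y - x|.
  by have [/H//|/ltW/H] := leP a b; rewrite distrC (distrC a).
move=> xy; rewrite (ger0_norm (_ : 0 <= y - x)) ?subr_ge0// ler_norml.
by move: (clipP x) (clipP y) => -[[/andP[? ?] ->]|[? ->]|[? ->]] [[/andP[? ?] ->]|[? ->]|[? ->]];
  apply/andP; split; lra.
Qed.

Lemma ramp_weight a : (1 - clip a ^+ 2) ^+ 2 <= expR (- (2 * a ^+ 2)).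
Proof.
have [[/andP[a1 a2] ->]|[a1 ->]|[a1 ->]] := clipP a.
- have a21 : 0 <= 1 - a ^+ 2.
    have : 0 <= (1 - a) * (1 + a) by apply: mulr_ge0; lra.
    by rewrite (_ : (1 - a) * (1 + a) = 1 - a ^+ 2)//; ring.
  have h : 1 - a ^+ 2 <= expR (- a ^+ 2) by exact: expR_ge1Dx.
  rewrite (_ : - (2 * a ^+ 2) = - a ^+ 2 + - a ^+ 2); last by ring.
  by rewrite expRD -expr2 lerXn2r ?nnegrE ?expR_ge0.
- by rewrite expr1n subrr expr0n/= expR_ge0.
- by rewrite sqrrN expr1n subrr expr0n/= expR_ge0.
Qed.

Lemma ramp_diff a b : `|ramp b - ramp a| <= `|b - a| * expR (- (2 * a ^+ 2)) + 16 * (b - a) ^+ 2.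
Proof.
have /andP[u1 u2] := clip_range a; have /andP[v1 v2] := clip_range b.
have ub : `|clip a| <= 1 by rewrite ler_norml u1.
have D := clip_contract a b; have W := ramp_weight a.
rewrite /ramp; set u := clip a in u1 u2 ub D W *; set v := clip b in v1 v2 D *.
have d2 : `|v - u| <= 2 by rewrite ler_norml; apply/andP; split; lra.
pose r := - 2 * u + 2 * u ^+ 3 + (- (2 / 3) + 2 * u ^+ 2) * (v - u) + u * (v - u) ^+ 2 + (v - u) ^+ 3 / 5.
have -> : v - 2 / 3 * v ^+ 3 + v ^+ 5 / 5 - (u - 2 / 3 * u ^+ 3 + u ^+ 5 / 5) =
   (v - u) * (1 - u ^+ 2) ^+ 2 + r * (v - u) ^+ 2 by rewrite /r; field.
have pw k (x M : R) : `|x| <= M -> `|x ^+ k| <= M ^+ k.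
  by move=> xM; rewrite normrX lerXn2r ?nnegrE// (le_trans _ xM).
have r16 : `|r| <= 16.
  have h1 := pw 3%N _ _ ub; have h2 := pw 2%N _ _ ub.
  have h3 := pw 2%N _ _ d2; have h4 := pw 3%N _ _ d2; rewrite expr1n in h1 h2.
  have n0 x : `|2 * x| = 2 * `|x| :> R by rewrite normrM ger0_norm.
  have n1 : `|- 2 * u| <= 2 * 1 by rewrite mulNr normrN n0 ler_pM2l.
  have n2 : `|2 * u ^+ 3| <= 2 * 1 by rewrite n0 ler_pM2l.
  have n3 : `|(- (2 / 3) + 2 * u ^+ 2) * (v - u)| <= 2 * 2.
    rewrite normrM ler_pM//; move: h2 (sqr_ge0 u); rewrite !ler_norml => /andP[_ h2] h2'.
    by apply/andP; split; lra.
  have n4 : `|u * (v - u) ^+ 2| <= 1 * 2 ^+ 2 by rewrite normrM ler_pM.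
  have n5 : `|(v - u) ^+ 3 / 5| <= 2 ^+ 3 / 5 by rewrite normrM (@ger0_norm _ 5^-1) ?invr_ge0// ler_wpM2r ?invr_ge0.
  move: n1 n2 n3 n4 n5; rewrite /r; move: (- 2 * u) (2 * u ^+ 3) (_ * (v - u)) (u * _) ((v - u) ^+ 3 / 5) => A1 A2 A3 A4 A5.
  rewrite !ler_norml => /andP[? ?] /andP[? ?] /andP[? ?] /andP[? ?] /andP[? ?].
  by apply/andP; split; lra.
apply: le_trans (ler_normD _ _) _; apply: lerD; rewrite normrM.
  apply: ler_pM => //; apply: le_trans W; rewrite ger0_norm// sqr_ge0//.
apply: ler_pM => //; rewrite normrX -[leRHS]real_normK ?num_real//.
by rewrite lerXn2r ?nnegrE.
Qed.

Lemma ramp_le a : `|ramp a| <= `|a|.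
Proof.
have := clip_contract 0 a; rewrite subr0 (_ : clip 0 = 0) ?subr0; last first.
  by rewrite /clip min_l// max_r// oppr_le0.
have /andP[u1 u2] := clip_range a; rewrite /ramp; set u := clip a in u1 u2 *.
apply: le_trans; have -> : u - 2 / 3 * u ^+ 3 + u ^+ 5 / 5 = u * (1 - 2 / 3 * u ^+ 2 + u ^+ 4 / 5) by field.
have h : u ^+ 2 <= 1 by rewrite -real_normK ?num_real// exprn_ile1// ler_norml u1.
have h0 := sqr_ge0 u.
have h4 : u ^+ 4 <= u ^+ 2 by rewrite (exprM _ 2 2) expr2 ler_piMr.
have h5 : 0 <= u ^+ 4 by rewrite (exprM _ 2 2) sqr_ge0.
by rewrite normrM ler_piMr// ler_norml; apply/andP; split; lra.
Qed.

Lemma ramp_saturated a : 1 <= `|a| -> `|ramp a| = 8 / 15.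
Proof.
have e : clip a = 1 \/ clip a = -1 -> `|ramp a| = 8 / 15.
  rewrite /ramp => -[->|->].
    by rewrite !expr1n ger0_norm; lra.
  by rewrite (_ : -1 - _ + _ = - (8 / 15)) ?normrN ?ger0_norm//; field.
rewrite ler_normr => /orP[a1|a1]; apply: e.
  by left; rewrite /clip min_r// max_r// (le_trans _ ler01)// oppr_le0.
by right; rewrite /clip min_l ?max_l//; lra.
Qed.

Lemma measurable_ramp : measurable_fun setT ramp.
Proof.
have mc : measurable_fun setT clip.
  by apply: measurable_maxr => //; apply: measurable_minr.
by apply: measurable_funD; [apply: measurable_funB => //|];
  apply: measurable_funM => //; apply: measurable_funX.
Qed.

End Ramp.

Section Crossings.
Context {R : realType}.
Implicit Types (f : R -> R) (T : R).

Definition crossings T f (K : nat) : R :=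
  let h := T / (K.+1 ^ 4)%:R in
  \sum_(i < K.+1 ^ 4) `|ramp (K.+1%:R * f (i.+1%:R * h)) - ramp (K.+1%:R * f (i%:R * h))|.

Lemma variation_coarsen (g : nat -> R) (k : nat -> nat) m N :
  (forall j, (j < m)%N -> (k j <= k j.+1)%N) -> (k m <= N)%N ->
  \sum_(j < m) `|g (k j.+1) - g (k j)| <= \sum_(i < N) `|g i.+1 - g i|.
Proof.
move=> kmono kN.
apply: (@le_trans _ _ (\sum_(0 <= i < k m) `|g i.+1 - g i|)); last first.
  rewrite -(big_mkord predT (fun i => `|g i.+1 - g i|)) (big_cat_nat (leq0n _) kN)//=.
  by rewrite lerDl sumr_ge0.
elim: m kmono {kN} => [|m IH] kmono; first by rewrite big_ord0 sumr_ge0.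
rewrite big_ord_recr/= (big_cat_nat (leq0n _) (kmono m _))//=; apply: lerD.
  by apply: IH => j jm; apply: kmono; exact: ltnW.
by rewrite -telescope_sumr ?kmono//; exact: ler_norm_sum.
Qed.

Lemma smooth_lipschitz f T : smooth f -> 0 < T -> exists2 L : R, 0 < L &
  forall x y, 0 <= x <= T -> 0 <= y <= T -> `|f x - f y| <= L * `|x - y|.
Proof.
move=> sf T0.
have cnf : {within `[0, T], continuous (fun x => `|derive1n 1 f x|)}.
  apply: continuous_subspaceT => x.
  by apply: (cvg_comp (derive1n 1 f) (fun y => `|y|));
    [exact: (@smooth_continuous R f 1 sf)|exact: norm_continuous].
have [c _ cmax] := EVT_max (ltW T0) cnf.
exists (`|derive1n 1 f c| + 1); first by rewrite ltr_wpDl.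
suff H x y : x < y -> 0 <= x <= T -> 0 <= y <= T ->
    `|f x - f y| <= (`|derive1n 1 f c| + 1) * `|x - y|.
  move=> x y xT yT; have [xy|xy|->] := ltgtP x y; first exact: H.
    by rewrite distrC (distrC x); exact: H.
  by rewrite !subrr normr0 mulr0.
move=> xy /andP[x0 xT] /andP[y0 yT].
have [u uxy E] := @MVT _ f (derive1n 1 f) x y xy
  (fun t _ => @smooth_is_derive R f 0 t sf)
  (continuous_subspaceT (@smooth_continuous R f 0 sf)).
rewrite distrC E normrM (distrC x) ler_wpM2r//.
have uT : u \in `[0, T].
  move: uxy; rewrite !in_itv/= => /andP[xu uy].
  by rewrite (le_trans x0 (ltW xu)) (le_trans (ltW uy) yT).
by apply: (le_trans (cmax u uT)); rewrite lerDl.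
Qed.

Lemma finite_lower_bound (g : nat -> R) m : (forall j, (j < m)%N -> 0 < g j) ->
  exists2 c, 0 < c & forall j, (j < m)%N -> c <= g j.
Proof.
elim: m => [|m IH] g0; first by exists 1.
have [j jm|c c0 H] := IH; first by apply: g0; exact: ltnW.
exists (Num.min c (g m)); first by rewrite lt_min c0 g0.
move=> j; rewrite ltnS leq_eqVlt => /predU1P[->|/H h]; first by rewrite ge_min lexx orbT.
by rewrite ge_min h.
Qed.

Lemma crossings_ge f T (s : seq R) (e : R) : smooth f -> 0 < T -> 0 < e -> uniq s ->
  (forall x, x \in s -> 0 <= x <= T) -> (forall x, x \in s -> f x = 0) ->
  (forall q : rat, f (ratr q) != 0) ->
  \forall K \near \oo, (size s).-1%:R * (16 / 15) - e <= crossings T f K.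
Proof.
move=> sf T0 e0 us sT sz fq; set n := (size s).-1.
have [s0|s0] := posnP (size s).
  apply: nearW => K; rewrite /n s0 mul0r sub0r; apply: (@le_trans _ _ 0).
    by rewrite oppr_le0 ltW.
  by apply: sumr_ge0.
have sE : size s = n.+1 by rewrite prednK.
pose z j := nth 0 (sort <=%R s) j.
have zin j : (j <= n)%N -> z j \in s.
  by move=> jn; rewrite -(mem_sort <=%R) mem_nth// size_sort sE ltnS.
have zlt j : (j < n)%N -> z j < z j.+1.
  move=> jn; have : sorted <%R (sort <=%R s).
    by rewrite lt_sorted_uniq_le sort_uniq us sort_le_sorted.
  by move=> /(sortedP 0)/(_ j); apply; rewrite size_sort sE ltnS.
have /choice[q Hq] j : exists q : R, (j < n)%N -> z j < q < z j.+1 /\ f q != 0.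
  have [jn|_] := ltnP j n; last by exists 0.
  have [r] := rat_in_itvoo (zlt j jn); rewrite in_itv/= => rz.
  by exists (ratr r) => _; split => //; exact: fq.
have fq0 j : (j < n)%N -> 0 < `|f (q j)| by move=> /Hq[_]; rewrite normr_gt0.
have [c c0 Hc] := finite_lower_bound fq0.
have [L L0 HL] := smooth_lipschitz sf T0.
pose y j := if odd j then q j./2 else z j./2.
have half j : (j < n.*2)%N -> (j./2 < n)%N by rewrite ltn_half_double.
have half_le j : (j <= n.*2)%N -> (j./2 <= n)%N by move=> /half_leq; rewrite doubleK.
have ylt j : (j < n.*2)%N -> y j < y j.+1.
  move=> jn; have /Hq[/andP[a b] _] := half j jn.
  by rewrite /y /=; case: ifP => oj /=; rewrite uphalf_half oj.
have yT j : (j <= n.*2)%N -> 0 <= y j <= T.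
  move=> jn; have zT i : (i <= n)%N -> 0 <= z i <= T by move/zin/sT.
  rewrite /y; case: ifP => oj; last by apply: zT; exact: half_le.
  have jn' : (j < n.*2)%N.
    by rewrite ltn_neqAle jn andbT; apply: contraTneq oj => ->; rewrite odd_double.
  have /Hq[/andP[a b] _] := half j jn'.
  have /andP[p1 p2] := zT _ (ltnW (half j jn')); have /andP[p3 p4] := zT _ (half j jn').
  by rewrite (le_trans p1 (ltW a)) (le_trans (ltW b) p4).
pose B := n.*2%:R * (L * T) / e + 2 * (L * T) / c + 2 / c.
have LT : 0 <= L * T by rewrite mulr_ge0 ?ltW.
have [t1 t2 t3] : [/\ 0 <= n.*2%:R * (L * T) / e, 0 <= 2 * (L * T) / c & 0 <= 2 / c].
  by split; rewrite divr_ge0 ?(ltW e0) ?(ltW c0)// mulr_ge0.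
exists (Num.bound B) => // K /= BK.
have KB : B <= K.+1%:R.
  have : B < (Num.bound B)%:R by apply: archi_boundP; rewrite !addr_ge0.
  by move/ltW/le_trans; apply; rewrite ler_nat ltnW.
set lam : R := K.+1%:R in KB *; have lam0 : 0 < lam by rewrite /lam.
have lam1 : 1 <= lam by rewrite /lam ler1n.
have B1 : n.*2%:R * (L * T) / e <= lam by apply: le_trans KB; rewrite /B -addrA lerDl addr_ge0.
have B2 : 2 * (L * T) / c <= lam by apply: le_trans KB; rewrite /B -addrA addrCA lerDl addr_ge0.
have B3 : 2 / c <= lam by apply: le_trans KB; rewrite /B lerDr addr_ge0.
rewrite /crossings; set N := (K.+1 ^ 4)%N; set h := T / N%:R.
have N0 : (0 < N)%N by rewrite /N expn_gt0.
have NR : 0 < N%:R :> R by rewrite ltr0n.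
have h0 : 0 < h by rewrite divr_gt0.
have hN : N%:R * h = T by rewrite /h mulrC divfK ?gt_eqF.
have NE : N%:R = lam ^+ 4 :> R by rewrite /N natrX.
have hlam : L * h * lam <= (L * T) / lam.
  rewrite /h NE ler_pdivlMr// (_ : L * (T / lam ^+ 4) * lam * lam = L * T / lam ^+ 2); last by field; rewrite gt_eqF.
  by rewrite ler_pdivrMr ?exprn_gt0// ler_peMr// exprn_ege1.
have hl : L * h <= (L * T) / lam.
  by apply: le_trans hlam; rewrite ler_peMr// mulr_ge0 ?ltW.
pose k j := Num.truncn (y j / h).
have kin j : (j <= n.*2)%N -> (k j)%:R * h <= y j < (k j).+1%:R * h.
  move=> /yT/andP[y0 _].
  have u0 : 0 <= y j / h by rewrite divr_ge0// ltW.
  have /andP[i1 i2] := truncn_itv u0.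
  by rewrite -ler_pdivlMr// i1 -ltr_pdivrMr.
have kN j : (j <= n.*2)%N -> (k j <= N)%N.
  move=> jn; have /andP[a _] := kin j jn; have /andP[_ b] := yT j jn.
  by rewrite -(ler_nat R) -(ler_pM2r h0) hN (le_trans a).
have kmono j : (j < n.*2)%N -> (k j <= k j.+1)%N.
  move=> jn; have /andP[a _] := kin j (ltnW jn); have /andP[_ b] := kin j.+1 jn.
  by rewrite -ltnS -(ltr_nat R) -(ltr_pM2r h0) (le_lt_trans a)// (lt_trans (ylt j jn)).
have := @variation_coarsen (fun i => ramp (lam * f (i%:R * h))) k n.*2 N kmono (kN _ (leqnn _)).
apply: le_trans.
have close j : (j <= n.*2)%N -> `|f ((k j)%:R * h) - f (y j)| <= L * h.
  move=> jn; have /andP[a b] := kin j jn.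
  have kT : 0 <= (k j)%:R * h <= T.
    rewrite mulr_ge0 ?(ltW h0)//= -hN ler_wpM2r ?(ltW h0)// ler_nat; exact: kN.
  apply: (le_trans (HL _ _ kT (yT j jn))); rewrite ler_pM2l// distrC ger0_norm ?subr_ge0//.
  by move: b; rewrite -natr1 mulrDl mul1r => /ltW; rewrite lerBlDl.
pose eps := L * T / lam.
have even_small j : (j <= n.*2)%N -> ~~ odd j -> `|ramp (lam * f ((k j)%:R * h))| <= eps.
  move=> jn oj; have := close j jn; rewrite /y (negbTE oj).
  rewrite (sz (z j./2)) ?zin ?half_le// subr0 => H.
  apply: (le_trans (ramp_le _)); rewrite normrM (gtr0_norm lam0); apply: le_trans hlam.
  by rewrite mulrC ler_wpM2r// ltW.
have odd_big j : (j <= n.*2)%N -> odd j -> `|ramp (lam * f ((k j)%:R * h))| = 8 / 15.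
  move=> jn oj; apply: ramp_saturated; rewrite normrM (gtr0_norm lam0).
  have jn' : (j < n.*2)%N.
    by rewrite ltn_neqAle jn andbT; apply: contraTneq oj => ->; rewrite odd_double.
  have := close j jn; rewrite /y oj => H.
  have := Hc _ (half j jn') => H1.
  have H2 : c / 2 <= `|f ((k j)%:R * h)|.
    have H3 : L * h <= c / 2.
      apply: (le_trans hl); rewrite ler_pdivrMr//.
      by move: B2; rewrite ler_pdivrMr//; lra.
    have := lerB_dist (f (q j./2)) (f ((k j)%:R * h)); rewrite distrC.
    by move: H H3 H1; set a1 := `|_ - _|; lra.
  have H3 : 1 <= lam * (c / 2) by move: B3; rewrite ler_pdivrMr//; lra.
  by apply: (le_trans H3); rewrite ler_pM2l.
have step j : (j < n.*2)%N ->
    8 / 15 - eps <= `|ramp (lam * f ((k j.+1)%:R * h)) - ramp (lam * f ((k j)%:R * h))|.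
  move=> jn; have [oj|oj] := boolP (odd j).
    rewrite distrC; apply: le_trans (lerB_dist _ _).
    by rewrite odd_big ?(ltnW jn)// lerD2l lerN2; apply: even_small => //=; rewrite negbK.
  apply: le_trans (lerB_dist _ _).
  by rewrite odd_big//= lerD2l lerN2; apply: even_small => //; exact: ltnW.
apply: (@le_trans _ _ (\sum_(j < n.*2) (8 / 15 - eps))); last first.
  by apply: ler_sum => j _; exact: step.
rewrite sumr_const card_ord -[_ *+ n.*2]mulr_natl mulrBr.
have H1 : n.*2%:R * eps <= e.
  by rewrite /eps mulrA ler_pdivrMr// [e * lam]mulrC -ler_pdivrMr.
by rewrite -mul2n natrM in H1 *; lra.
Qed.

End Crossings.

Section Rice.
Context {R : realType} (mu : probability (measurableTypeR R) R)
  (d : measure_display) (Omega : measurableType d) (P : probability Omega R)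
  (X : R -> {RV P >-> R}).
Hypothesis hX : smooth_stationary_gaussian mu X.
Local Notation rv := (rv X).
Local Notation cov := (cov mu).
Local Notation path w := (fun t : R => X t w).

Let wgt s (t : R) w := expR (- (s * X t w ^+ 2)).

Lemma increment_decorrelated (t h M : R) : (abs_moment mu 2 <= M%:E)%E ->
  exists (W : seq (R * R)) (c : R), [/\ cov [:: (1, t)] W = 0,
    cov W W <= h ^+ 2 * M, `|c| <= h ^+ 2 * M / 2 &
    forall w, X (t + h) w - X t w = c * X t w + rv W w].
Proof.
move=> HM; pose A : seq (R * R) := [:: (1, t)].
pose D := diffL h 1 t.
have DM : cov D D <= h ^+ 2 * M by exact: (@cov_diff_le _ _ _ 1).
have rvD w : rv D w = X (t + h) w - X t w.
  by rewrite /rv lin_diffS lin_diff_shift /= !lin1 !mul1r.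
have DE L : cov D L = cov [:: (1, t + h)] L - cov A L.
  by rewrite (_ : D = [:: (1, t + h)] ++ scaleL (- 1) A)// cov_catl cov_scalel mulN1r.
have A1 : cov A A = 1 by rewrite cov1 expr1n.
have B1 : cov [:: (1, t + h)] [:: (1, t + h)] = 1 by rewrite cov1 expr1n.
pose c := cov A D.
have cE : c = - cov D D / 2.
  have e1 : cov A D = cov [:: (1, t + h)] A - 1 by rewrite covC DE A1.
  have e2 : cov [:: (1, t + h)] D = 1 - cov [:: (1, t + h)] A.
    by rewrite covC DE B1 (covC mu A).
  by rewrite /c (DE D) e2 e1; field.
pose W := D ++ scaleL (- c) A.
have AW : cov A W = 0.
  by rewrite covC /W cov_catl cov_scalel A1 (covC mu D) -/c; ring.
exists W, c; split.
- exact: AW.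
- rewrite {1}/W cov_catl cov_scalel AW (covC mu D W) /W cov_catl cov_scalel -/c.
  have := sqr_ge0 c; move: DM; rewrite expr2; lra.
- rewrite cE mulNr normrN ger0_norm; last by rewrite divr_ge0// cov_ge0.
  by rewrite ler_wpM2r.
- move=> w; rewrite -rvD /W rv_cat rv_scale.
  have -> : rv A w = X t w by rewrite /rv lin1 mul1r.
  by ring.
Qed.

Lemma ramp_increment (t h lam M : R) : (abs_moment mu 2 <= M%:E)%E -> 0 < M ->
  0 < h -> 1 <= lam ->
  (\int[P]_w (`|ramp (lam * X (t + h) w) - ramp (lam * X t w)|)%:E <=
    (h * Num.sqrt M / 2 + 17 * (lam * h) ^+ 2 * M)%:E)%E.
Proof.
move=> HM M0 h0 lam1; have lam0 : 0 < lam by exact: lt_le_trans lam1.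
have [W [c [tW WM cM XE]]] := increment_decorrelated t h HM.
pose s := 2 * lam ^+ 2.
have s0 : 0 <= s by rewrite mulr_ge0 ?sqr_ge0.
pose tau := h * Num.sqrt M.
have tau0 : 0 < tau by rewrite mulr_gt0// sqrtr_gt0.
have Wtau : cov W W <= tau ^+ 2 by rewrite exprMn sqr_sqrtr// ltW.
pose D := diffL h 1 t.
have DM : cov D D <= h ^+ 2 * M by exact: (@cov_diff_le _ _ _ 1).
have rvD w : rv D w = X (t + h) w - X t w.
  by rewrite /rv lin_diffS lin_diff_shift /= !lin1 !mul1r.
have mX u : measurable_fun setT (X u : Omega -> R) by exact: measurable_funP.
have mW := measurable_rv X W.
have mwgt : measurable_fun setT (wgt s t).
  apply: measurableT_comp => //; apply: measurableT_comp => //.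
  by apply: measurable_funM => //; exact: measurable_funX.
have wgt1 w : wgt s t w <= 1.
  by rewrite -[leRHS]expR0 ler_expR oppr_le0 mulr_ge0// sqr_ge0.
have wgt0 w : 0 <= wgt s t w by exact: expR_ge0.
have mnW : measurable_fun setT (fun w => `|rv W w|).
  rewrite (_ : (fun w => _) = (@Num.norm R R) \o rv W)//; exact: measurableT_comp.
have i1 : P.-integrable setT (EFin \o (cst 1 : Omega -> R)) by exact: finite_measure_integrable_cst.
have iW : P.-integrable setT (EFin \o (fun w => `|rv W w| * wgt s t w)).
  have := integrableD measurableT i1 (rv_integrable_sqr hX W); apply: le_integrable => //.
    by apply/measurable_EFinP; apply: measurable_funM.
  move=> w _ /=; rewrite lee_fin normrM normr_id (ger0_norm (wgt0 w)).
  rewrite [leRHS]ger0_norm ?addr_ge0 ?sqr_ge0//.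
  apply: (@le_trans _ _ `|rv W w|); first by rewrite ler_piMr.
  rewrite -[X in _ <= 1 + X]real_normK ?num_real// -subr_ge0.
  rewrite (_ : _ - _ = (`|rv W w| - 2^-1) ^+ 2 + 3 / 4); last by field.
  by rewrite addr_ge0 ?sqr_ge0.
have rvA w : rv [:: (1, t)] w = X t w by rewrite /rv lin1 mul1r.
have iA : P.-integrable setT (EFin \o (fun w => X t w ^+ 2)).
  have := rv_integrable_sqr hX [:: (1, t)].
  by congr (P.-integrable _ _); apply/funext => w /=; rewrite rvA.
have EA : \int[P]_w (X t w ^+ 2) = 1.
  have := rv_sqr hX [:: (1, t)]; rewrite cov1 expr1n => <-.
  by apply: eq_Rintegral => w _; rewrite rvA.
have iD := rv_integrable_sqr hX D.
pose F w := lam * (`|rv W w| * wgt s t w) + (lam * `|c| / 2 * (1 + X t w ^+ 2) + 16 * lam ^+ 2 * rv D w ^+ 2).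
have j1 := integrableD measurableT i1 iA.
have j2 := integrableZl measurableT (lam * `|c| / 2) j1.
have j3 := integrableZl measurableT (16 * lam ^+ 2) iD.
have j4 := integrableD measurableT j2 j3.
have j5 := integrableZl measurableT lam iW.
have iF : P.-integrable setT (EFin \o F) by exact: (integrableD measurableT j5 j4).
have FE : \int[P]_w F w <= h * Num.sqrt M / 2 + 17 * (lam * h) ^+ 2 * M.
  rewrite RintegralD// RintegralZl// RintegralD// RintegralZl// RintegralZl// RintegralD//.
  rewrite Rintegral_prob_cst EA (rv_sqr hX).
  have B1 : lam * \int[P]_w (`|rv W w| * wgt s t w) <= tau / 2.
    apply: (@le_trans _ _ (lam * (tau * (Num.sqrt (1 + 2 * s))^-1))).
      by rewrite ler_pM2l//; exact: (weight_abs hX).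
    have q2 : 2 * lam <= Num.sqrt (1 + 2 * s).
      rewrite -[leLHS]ger0_norm ?mulr_ge0 ?(ltW lam0)// -sqrtr_sqr ler_wsqrtr//.
      by rewrite /s; lra.
    have l20 : 0 < 2 * lam by rewrite mulr_gt0.
    have q0 : 0 < Num.sqrt (1 + 2 * s) by exact: lt_le_trans q2.
    by rewrite mulrCA ler_pM2l// ler_pdivrMr//; lra.
  have B2 : lam * `|c| / 2 * (1 + 1) <= (lam * h) ^+ 2 * M.
    have e1 : lam * `|c| <= lam * (h ^+ 2 * M / 2) by rewrite ler_pM2l.
    have e2 : lam * (h ^+ 2 * M) <= (lam * h) ^+ 2 * M.
      rewrite exprMn mulrA ler_pM2r// ler_pM2r ?exprn_gt0// expr2 ler_peMr// ltW//.
    have e3 : 0 <= lam * (h ^+ 2 * M) by rewrite mulr_ge0 ?mulr_ge0 ?sqr_ge0 ?ltW.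
    move: e1 e2 e3; lra.
  have B3 : 16 * lam ^+ 2 * cov D D <= 16 * ((lam * h) ^+ 2 * M).
    have h16 : 0 < 16 * lam ^+ 2 by rewrite mulr_gt0// exprn_gt0.
    by move: DM; rewrite -(ler_pM2l h16) exprMn -!mulrA.
  by move: B1 B2 B3; rewrite /tau; lra.
apply: (@le_trans _ _ (\int[P]_w (F w)%:E)%E); last by rewrite EFin_Rintegral.
have le w : `|ramp (lam * X (t + h) w) - ramp (lam * X t w)| <= F w.
  apply: (le_trans (ramp_diff _ _)); rewrite -mulrBr normrM (gtr0_norm lam0).
  have -> : expR (- (2 * (lam * X t w) ^+ 2)) = wgt s t w by rewrite /wgt /s exprMn mulrA.
  rewrite exprMn.
  rewrite /F addrA; apply: lerD; last by rewrite rvD mulrA.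
  rewrite XE; apply: (@le_trans _ _ (lam * (`|c * X t w + rv W w| * wgt s t w))); first by rewrite mulrA.
  have h1 : `|c * X t w + rv W w| * wgt s t w <= `|c| * `|X t w| + `|rv W w| * wgt s t w.
    apply: (@le_trans _ _ ((`|c| * `|X t w| + `|rv W w|) * wgt s t w)).
      by rewrite ler_wpM2r// -normrM ler_normD.
    by rewrite mulrDl lerD2r ler_piMr// mulr_ge0.
  have h2 : `|c| * `|X t w| <= `|c| * ((1 + X t w ^+ 2) / 2).
    rewrite ler_wpM2l// -[X in 1 + X]real_normK ?num_real// -subr_ge0.
    rewrite (_ : _ - _ = (`|X t w| - 1) ^+ 2 / 2); last by field.
    by rewrite divr_ge0 ?sqr_ge0.
  have h3 := le_trans h1 (lerD h2 (lexx _)).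
  apply: (le_trans (ler_wpM2l (ltW lam0) h3)).
  by rewrite le_eqVlt; apply/orP; left; apply/eqP; field.
apply: ge0_le_integral => //.
- apply/measurable_EFinP.
  rewrite (_ : (fun w => _) = (@Num.norm R R) \o (fun w => ramp (lam * X (t + h) w) - ramp (lam * X t w)))//.
  apply: measurableT_comp => //; apply: measurable_funB;
    apply: (measurableT_comp measurable_ramp); exact: measurable_funM.
- exact: measurable_int iF.
- by move=> w _; rewrite lee_fin.
Qed.

Let measurable_ramp_increment u v lam :
  measurable_fun setT (fun w => `|ramp (lam * X u w) - ramp (lam * X v w)|).
Proof.
rewrite (_ : (fun w => _) = (@Num.norm R R) \o (fun w => ramp (lam * X u w) - ramp (lam * X v w)))//.
apply: measurableT_comp => //; apply: measurable_funB;
  apply: (measurableT_comp measurable_ramp); exact: measurable_funM.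
Qed.

Lemma measurable_crossings T K : measurable_fun setT (fun w => crossings T (path w) K).
Proof. by apply: measurable_sum => i; exact: measurable_ramp_increment. Qed.

Lemma crossings_mean (T M : R) K : (abs_moment mu 2 <= M%:E)%E -> 0 < M -> 0 < T ->
  (\int[P]_w (crossings T (path w) K)%:E <=
    (T * Num.sqrt M / 2 + 17 * T ^+ 2 * M / K.+1%:R)%:E)%E.
Proof.
move=> HM M0 T0; rewrite /crossings; set N := (K.+1 ^ 4)%N; set h := T / N%:R.
have NR : 0 < N%:R :> R by rewrite ltr0n expn_gt0.
have h0 : 0 < h by rewrite divr_gt0.
under eq_integral => w _ do rewrite -sumEFin.
rewrite ge0_integral_sum//; last first.
  by move=> i; apply/measurable_EFinP; exact: measurable_ramp_increment.
pose b := h * Num.sqrt M / 2 + 17 * (K.+1%:R * h) ^+ 2 * M.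
apply: (@le_trans _ _ (\sum_(i < N) b%:E)%E).
  apply: lee_sum => i _; have := @ramp_increment (i%:R * h) h K.+1%:R M HM M0 h0.
  rewrite ler1n (_ : i%:R * h + h = i.+1%:R * h); first by apply.
  by rewrite -natr1 mulrDl mul1r.
rewrite sumEFin lee_fin sumr_const card_ord -[_ *+ N]mulr_natl /b mulrDr; apply: lerD.
  by rewrite /h le_eqVlt; apply/orP; left; apply/eqP; field; rewrite gt_eqF.
have K0 : 0 < K.+1%:R :> R by [].
have -> : N%:R * (17 * (K.+1%:R * h) ^+ 2 * M) = 17 * T ^+ 2 * M / K.+1%:R ^+ 2.
  by rewrite /h /N natrX; field; rewrite gt_eqF.
rewrite ler_pM2l; last by rewrite mulr_gt0// mulr_gt0// exprn_gt0.
by rewrite lef_pV2 ?posrE ?exprn_gt0// expr2 ler_peMr ?ler1n.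
Qed.

Lemma zero_null (t : R) : P [set w | X t w = 0] = 0%E.
Proof.
have mE : measurable [set w | X t w = 0].
  by rewrite (_ : [set w | _] = X t @^-1` [set 0]).
apply/eqP; rewrite eq_le measure_ge0 andbT.
have orth (i j : 'I_1) : cov [:: (1, t)] [:: (1, t)] = (i == j)%:R.
  by rewrite !ord1 eqxx cov1 expr1n.
apply/lee_addgt0Pr => e e0; rewrite add0e.
have e20 : 0 < e / 2 by rewrite divr_gt0.
have := small_ball hX orth e20 mE; rewrite expr1 (_ : 2 * (e / 2) = e); last by field.
apply.
by move=> w /= Xw i; rewrite /rv lin1 mul1r Xw normr0 ltW.
Qed.

Lemma rational_zero_null : measurable [set w | exists q : rat, X (ratr q) w = 0] /\
  P [set w | exists q : rat, X (ratr q) w = 0] = 0%E.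
Proof.
have mE t : measurable [set w | X t w = 0].
  by rewrite (_ : [set w | _] = X t @^-1` [set 0]).
have mZ : measurable [set w | exists q : rat, X (ratr q) w = 0].
  rewrite (_ : [set w | _] = \bigcup_(q : rat) [set w | X (ratr q) w = 0]).
    exact: bigcupT_measurable_rat.
  by apply/seteqP; split => w /= [q]; [exists q|move=> _ h; exists q].
split=> //; apply: measure_negligible => //.
rewrite (_ : [set w | _] = \bigcup_(n : nat)
    oapp (fun q : rat => [set w | X (ratr q) w = 0]) set0 (unpickle n)).
  apply: negligible_bigcup => n; case: unpickle => [q|] /=; last exact: negligible_set0.
  by exists [set w | X (ratr q) w = 0]; split => //; exact: zero_null.
apply/seteqP; split => w /=; last by move=> [n _]; case: unpickle => [q|//] h; exists q.
move=> [q h]; exists (pickle q); first exact: I.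
by rewrite pickleK.
Qed.

Lemma zeros_prob_rice (T M : R) n : (abs_moment mu 2 <= M%:E)%E -> 0 < M ->
  0 < T -> (2 <= n)%N ->
  (P [set w | (n%:R%:E <= nb_zeros X T w)%E] <=
    (15 / 32 * (T * Num.sqrt M) / n.-1%:R)%:E)%E.
Proof.
move=> HM M0 T0 n2; set A := [set w | _].
have mA : measurable A by exact: measurable_zeros hX T0.
pose Z := [set w | exists q : rat, X (ratr q) w = 0].
have [mZ PZ] := rational_zero_null.
have mAZ : measurable (A `\` Z) by exact: measurableD.
apply: (@le_trans _ _ (P (A `\` Z))).
  rewrite -[leRHS]adde0 -PZ; apply: le_trans (measureU2 _ mAZ mZ).
  apply: le_measure; rewrite ?inE//; first exact: measurableU.
  by move=> w Aw; have [wZ|wZ] := pselect (Z w); [right|left].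
set p := P (A `\` Z).
have pfin : p \is a fin_num by exact: fin_num_measure.
have p1 : fine p <= 1 by rewrite -lee_fin fineK// probability_le1.
have n1 : 0 < n.-1%:R :> R by rewrite ltr0n -subn1 subn_gt0.
set a := n.-1%:R * (16 / 15) : R.
have a0 : 0 < a by rewrite mulr_gt0.
have key e : 0 < e -> e < a -> fine p * (a - e) <= T * Num.sqrt M / 2 + e.
  move=> e0 ea; have ae : 0 < a - e by rewrite subr_gt0.
  rewrite -ler_pdivlMr// -lee_fin fineK//.
  apply: (@eventually_measure_le _ _ _ P (fun K => [set w | a - e <= crossings T (path w) K])) => //.
  - move=> K; rewrite (_ : [set w | _] = (fun w => crossings T (path w) K) @^-1` `[a - e, +oo[); last first.
      by apply/seteqP; split => w /=; rewrite in_itv/= andbT.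
    by rewrite -[X in measurable X]setTI; exact: measurable_crossings.
  - move=> w [/le_countingP[s [us ss sz]] wZ].
    have := @crossings_ge R (path w) T s e (smooth_path hX) T0 e0 us.
    rewrite ss; apply.
    + by move=> x /sz[+ _]; rewrite in_itv.
    + by move=> x /sz[].
    + by move=> q; apply/eqP => q0; apply: wZ; exists q.
  - exists (Num.bound (17 * T ^+ 2 * M / e)) => // K /= BK.
    rewrite mulrC EFinM; apply: (@markov_ge0 _ _ _ _ (fun w => (crossings T (path w) K)%:E)) => //.
    + rewrite (_ : [set w | _] = (fun w => crossings T (path w) K) @^-1` `[a - e, +oo[); last first.
        by apply/seteqP; split => w /=; rewrite in_itv/= andbT.
      by rewrite -[X in measurable X]setTI; exact: measurable_crossings.
    + by apply/measurable_EFinP; exact: measurable_crossings.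
    + by move=> w; rewrite lee_fin; apply: sumr_ge0.
    apply: (le_trans (crossings_mean K HM M0 T0)); rewrite lee_fin lerD2l.
    have t0 : 0 <= 17 * T ^+ 2 * M / e by rewrite divr_ge0 ?mulr_ge0 ?sqr_ge0 ?ltW.
    rewrite ler_pdivrMr// [leRHS]mulrC -ler_pdivrMr//; have := archi_boundP t0.
    by move/ltW/le_trans; apply; rewrite ler_nat ltnW.
rewrite -[p]fineK// lee_fin ler_pdivlMr//.
have H : fine p * a <= T * Num.sqrt M / 2.
  apply/ler_addgt0Pr => e e0.
  have e10 : 0 < Num.min (e / 2) (a / 2) by rewrite lt_min !divr_gt0.
  have e1a : Num.min (e / 2) (a / 2) < a by rewrite gt_min; apply/orP; right; move: a0; lra.
  have e1e : Num.min (e / 2) (a / 2) <= e / 2 by rewrite ge_min lexx.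
  have := key _ e10 e1a; rewrite mulrBr; set e1 := Num.min _ _ in e10 e1e *.
  have : fine p * e1 <= e1 by rewrite ler_piMl// ltW.
  by move: e1e; lra.
by move: H; rewrite /a; lra.
Qed.

End Rice.

Section SplitBound.
Context {R : realType} (mu : probability (measurableTypeR R) R)
  (d : measure_display) (Omega : measurableType d) (P : probability Omega R)
  (X : R -> {RV P >-> R}).
Hypothesis hX : smooth_stationary_gaussian mu X.
Local Notation rv := (rv X).
Local Notation cov := (cov mu).
Local Notation path w := (fun t : R => X t w).

Lemma zeros_prob_split (T M eta L : R) (n B m : nat) (b : 'I_m -> 'I_m -> R) :
  1 <= T -> 0 < M -> 0 < eta -> 0 < L -> (0 < n)%N -> (0 < B)%N -> (m <= n.+1)%N ->
  (abs_moment mu (2 * n) <= M%:E)%E ->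
  (forall i j, cov (grid_functional B n (b i)) (grid_functional B n (b j)) = (i == j)%:R) ->
  (forall i, \sum_j `|b i j| <= L) ->
  (P [set w | (n%:R%:E <= nb_zeros X T w)%E] <=
    ((2 * (L * eta)) ^+ m +
     expR (- ((eta * n.-1`!%:R / T ^+ n.-1 / 2) ^+ 2 / (4 * (T ^+ 2 * M)))) * Num.sqrt 2)%:E)%E.
Proof.
move=> T1 M0 eta0 L0 n0 B0 mn HM orth bL; set A := [set w | _].
have T0 : 0 < T by exact: lt_le_trans T1.
have mA : measurable A by exact: measurable_zeros hX T0.
pose t (i : 'I_m) : R := i%:R / (B%:R * n%:R).
have tT i : 0 <= t i <= T.
  have BN : 0 < B%:R * n%:R :> R by rewrite mulr_gt0 ?ltr0n.
  rewrite divr_ge0 ?(ltW BN)//=; apply: le_trans T1; rewrite ler_pdivrMr// mul1r -natrM ler_nat.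
  by rewrite (@leq_trans n) ?leq_pmull// -ltnS (leq_trans (ltn_ord i)).
pose S := [set w | forall i, `|X (t i) w| <= eta].
have mS : measurable S.
  rewrite (_ : S = \bigcap_(i in [set: 'I_m]) [set w | `|X (t i) w| <= eta]); last first.
    by apply/seteqP; split => w /= H i; [move=> _; exact: H|exact: H].
  apply: fin_bigcap_measurable => // i _.
  rewrite (_ : [set w | _] = ((@Num.norm R R) \o X (t i)) @^-1` `]-oo, eta]); last first.
    by apply/seteqP; split => w /=; rewrite in_itv.
  rewrite -[Y in measurable Y]setTI.
  by apply: measurableT_comp => //; exact: measurable_itv.
have mAS : measurable (A `\` S) by exact: measurableD.
apply: (@le_trans _ _ (P S + P (A `\` S))%E).
  apply: le_trans (measureU2 _ mS mAS).
  apply: le_measure; rewrite ?inE//; first exact: measurableU.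
  by move=> w Aw; have [wS|wS] := pselect (S w); [left|right].
rewrite EFinD; apply: leeD.
  apply: (small_ball hX orth _ mS); first exact: mulr_gt0.
  move=> w Sw i; rewrite /rv lin_grid; apply: le_trans (ler_norm_sum _ _ _) _.
  apply: (@le_trans _ _ (\sum_j `|b i j| * eta)).
    by apply: ler_sum => j _; rewrite normrM ler_wpM2l//; exact: Sw.
  by rewrite -mulr_suml ler_wpM2r ?(ltW eta0).
set V := eta * _ / _ / 2.
have V0 : 0 < V by rewrite divr_gt0// divr_gt0 ?exprn_gt0// mulr_gt0// ltr0n fact_gt0.
apply: (grid_variation_tail hX T0 M0 n0 (ltW V0) HM mAS).
move=> w [/le_countingP[s [us ss sz]]] wS.
have [i Hi] : exists i, eta < `|X (t i) w|.
  by apply: contrapT => h; apply: wS => i; rewrite leNgt; apply/negP => hi; apply: h; exists i.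
have s0 : (0 < size s)%N by rewrite ss.
have := @zeros_variation R (path w) T s (t i) V (smooth_path hX) T0 V0 us s0.
move=> /(_ _ _ (tT i)); rewrite ss.
have h1 z : z \in s -> 0 <= z <= T by move=> /sz[+ _]; rewrite in_itv.
have h2 z : z \in s -> X z w = 0 by move=> /sz[].
move=> /(_ h1 h2); apply: filterS => N; apply: le_trans.
have q0 : 0 < n.-1`!%:R / T ^+ n.-1 by rewrite divr_gt0 ?exprn_gt0// ltr0n fact_gt0.
have : eta * (n.-1`!%:R / T ^+ n.-1) <= `|X (t i) w| * (n.-1`!%:R / T ^+ n.-1).
  by rewrite ler_wpM2r ?(ltW q0)// ltW.
have -> : V = eta * (n.-1`!%:R / T ^+ n.-1) / 2 by rewrite /V mulrA.
lra.
Qed.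

End SplitBound.

Section Estimates.
Context {R : realType}.

Lemma expR_ln_nat (n : nat) : (0 < n)%N -> expR (ln n%:R) = n%:R :> R.
Proof. by move=> n0; rewrite lnK// posrE ltr0n. Qed.

Lemma two_le_expR1 : 2 <= expR 1 :> R.
Proof. exact: (expR_ge1Dx 1). Qed.

Lemma ln_nat_le (n : nat) : (0 < n)%N -> ln n%:R <= n%:R :> R.
Proof. by move=> n0; rewrite ltW// ln_sublinear// ltr0n. Qed.

Lemma factorial_lower (n : nat) : (0 < n)%N ->
  expR (n%:R * ln n%:R - n%:R - ln n%:R) <= n.-1`!%:R :> R.
Proof.
move=> n0; have x0 : 0 < n%:R :> R by rewrite ltr0n.
have := expR_ge1Dxn n.-1 (ltW x0); rewrite prednK// => h.
have h1 : n%:R ^+ n <= n`!%:R * expR n%:R :> R.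
  rewrite -ler_pdivrMl ?ltr0n ?fact_gt0// mulrC.
  by apply: le_trans h; rewrite lerDr.
rewrite !expRD !expRN expRM_natl expR_ln_nat// ler_pdivrMr// ler_pdivrMr ?expR_gt0//.
apply: (le_trans h1); rewrite ler_pM2r ?expR_gt0//.
by rewrite -{1}(prednK n0) factS prednK// mulnC natrM.
Qed.

Lemma small_ball_exponent (n m C : nat) (e eta : R) : (2 <= n)%N -> (0 < C)%N ->
  4 * C%:R / e <= n%:R -> 0 < e ->
  eta = expR (- (e * n%:R * ln n%:R)) ->
  m = Num.truncn (e * n%:R / (2 * C%:R)) ->
  (2 * (n%:R ^+ (C * m) * eta)) ^+ m <=
    expR (- (e ^+ 2 / (16 * C%:R) * (n%:R ^+ 2 * ln n%:R))) :> R.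
Proof.
move=> n2 C0 nC e0 -> mE; set x : R := n%:R; set l : R := ln n%:R; set c : R := C%:R.
have n0 : (0 < n)%N by exact: ltn_trans n2.
have x0 : 0 < x by rewrite ltr0n.
have c1 : 1 <= c by rewrite ler1n.
have c0 : 0 < c by exact: lt_le_trans c1.
have l0 : 0 <= l by rewrite ln_ge0// ler1n.
have u0 : 0 <= e * x / (2 * c) by rewrite divr_ge0 ?mulr_ge0 ?ltW.
have /andP[m1 m2] := truncn_itv u0; rewrite -mE in m1 m2.
set k : R := m%:R in m1.
have k0 : 0 <= k by [].
have ck : c * k <= e * x / 2.
  by move: m1; rewrite ler_pdivlMr ?mulr_gt0//; lra.
have ex : 4 * c <= e * x by move: nC; rewrite ler_pdivrMr// -/x -/c (mulrC e).
have kl : e * x / (4 * c) <= k.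
  move: m2; rewrite -natr1 -/k ltr_pdivrMr ?mulr_gt0// => m2.
  by rewrite ler_pdivrMr ?mulr_gt0//; move: m2 ex; lra.
have le2 : 2 <= expR l by rewrite expR_ln_nat// ler_nat.
have b1 : 2 * (x ^+ (C * m) * expR (- (e * x * l))) <= expR (- (e * x / 4 * l)).
  have xe : x ^+ (C * m) = expR (c * k * l) by rewrite /x -(expR_ln_nat n0) -/l -expRM_natl natrM.
  rewrite xe -expRD.
  apply: (@le_trans _ _ (expR l * expR (c * k * l - e * x * l))).
    by rewrite ler_wpM2r ?expR_ge0.
  rewrite -expRD ler_expR -subr_ge0.
  rewrite (_ : _ - _ = l * (e * x - 1 - c * k - e * x / 4)); last by ring.
  by rewrite mulr_ge0//; move: ck ex c1; lra.
apply: (@le_trans _ _ (expR (- (e * x / 4 * l)) ^+ m)).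
  by rewrite lerXn2r ?nnegrE ?expR_ge0 ?mulr_ge0 ?exprn_ge0 ?expR_ge0// ltW.
rewrite -expRM_natl -/k ler_expR mulrN lerN2.
apply: (@le_trans _ _ (e * x / (4 * c) * (e * x / 4 * l))).
  by rewrite le_eqVlt; apply/orP; left; apply/eqP; field; rewrite gt_eqF.
by rewrite ler_wpM2r// mulr_ge0// divr_ge0// mulr_ge0 ?ltW.
Qed.

Lemma variation_exponent (n : nat) (T kappa alpha e M eta : R) : (2 <= n)%N ->
  1 <= T -> T <= n%:R `^ kappa -> 0 < e -> 2 * e = 1 - kappa - alpha ->
  0 < alpha -> alpha < 1 -> 0 < kappa ->
  13 <= 2 * e * ln n%:R ->
  M = (2 * n)%:R `^ (alpha * (2 * n)%:R) ->
  eta = expR (- (e * n%:R * ln n%:R)) ->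
  n%:R ^+ 3 <= (eta * n.-1`!%:R / T ^+ n.-1 / 2) ^+ 2 / (4 * (T ^+ 2 * M)).
Proof.
move=> n2 T1 Tk e0 eE a0 a1 k0 lbig ME ->; set x : R := n%:R; set l : R := ln n%:R in lbig *.
have n0 : (0 < n)%N by exact: ltn_trans n2.
have x2 : 2 <= x by rewrite ler_nat.
have x0 : 0 < x by rewrite ltr0n.
have l0 : 0 <= l by rewrite ln_ge0// ler1n.
have lx : l <= x by exact: ln_nat_le.
have T0 : 0 < T by exact: lt_le_trans T1.
have two : 2 <= expR 1 :> R := two_le_expR1.
have fl := factorial_lower n0; rewrite -/x -/l in fl.
have Tl : T <= expR (kappa * l).
  by apply: (le_trans Tk); rewrite /powR gt_eqF.
have MEx : M <= expR (2 * alpha * x * (1 + l)).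
  rewrite ME /powR gt_eqF ?ltr0n ?muln_gt0// ler_expR natrM -/x.
  rewrite lnM ?posrE// -/l.
  have h : ln 2 + l <= 1 + l by rewrite lerD2r; move: two; rewrite -ler_ln ?posrE ?expR_gt0// expRK.
  have ax : 0 <= alpha * (2 * x) by rewrite mulr_ge0 ?mulr_ge0 ?ltW.
  have := ler_wpM2l ax h; lra.
have M0 : 0 < M by rewrite ME powR_gt0// ltr0n muln_gt0.
pose w := expR (- (e * x * l)) * n.-1`!%:R / T ^+ n / 2.
have wE : (expR (- (e * x * l)) * n.-1`!%:R / T ^+ n.-1 / 2) ^+ 2 / (4 * (T ^+ 2 * M)) = w ^+ 2 / (4 * M).
  have Tn : T ^+ n = T * T ^+ n.-1 by rewrite -exprS prednK.
  have : 0 < T ^+ n.-1 by rewrite exprn_gt0.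
  rewrite /w Tn; move: (T ^+ n.-1) (expR _ * _) => p q p0; field.
  by rewrite !gt_eqF.
rewrite wE.
have wl : expR (- (e * x * l) + (x * l - x - l) - kappa * l * x - 1) <= w.
  rewrite expRD expRD /w.
  have w1 : expR (- (e * x * l) + (x * l - x - l)) <= expR (- (e * x * l)) * n.-1`!%:R.
    by rewrite expRD ler_wpM2l ?expR_ge0.
  have w2 : expR (- (kappa * l * x)) <= (T ^+ n)^-1.
    rewrite expRN expRM_natr lef_pV2 ?posrE ?exprn_gt0 ?expR_gt0//.
    by rewrite lerXn2r ?nnegrE ?expR_ge0// ltW.
  have w3 : expR (- 1) <= 2^-1 :> R by rewrite expRN lef_pV2 ?posrE ?expR_gt0.
  by do 2?apply: ler_pM; rewrite ?mulr_ge0 ?expR_ge0.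
have M4 : 4 * M <= expR (2 + 2 * alpha * x * (1 + l)).
  rewrite expRD; apply: ler_pM => //; first exact: ltW.
  have -> : expR 2 = expR 1 * expR 1 :> R by rewrite -expRD.
  have -> : 4 = 2 * 2 :> R by rewrite -natrM.
  by apply: ler_pM.
rewrite ler_pdivlMr ?mulr_gt0//.
apply: (@le_trans _ _ (expR (3 * l) * expR (2 + 2 * alpha * x * (1 + l)))).
  apply: ler_pM => //; rewrite ?exprn_ge0 ?mulr_ge0 ?(ltW x0) ?(ltW M0)//.
  by rewrite expRM_natl expR_ln_nat.
apply: (@le_trans _ _ (expR (- (e * x * l) + (x * l - x - l) - kappa * l * x - 1) ^+ 2)); last first.
  by rewrite lerXn2r ?nnegrE ?expR_ge0// (le_trans _ wl)// expR_ge0.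
rewrite -expRD -expRM_natl ler_expR.
have xl : 13 * x <= 2 * e * l * x by rewrite ler_wpM2r// ltW.
have ax : alpha * x <= x by rewrite ler_piMl// ltW.
have kE : kappa = 1 - alpha - 2 * e by rewrite eE; lra.
rewrite kE -subr_ge0.
rewrite [X in 0 <= X](_ : _ = 2 * e * l * x - 5 * l - 2 * x - 2 * (alpha * x) - 4); last by ring.
by move: xl ax lx x2; lra.
Qed.

End Estimates.

Section UpperProbability.
Context {R : realType} (mu : probability (measurableTypeR R) R)
  (alpha kappa : R).
Hypothesis hac : nontrivial_ac_part mu.
Hypotheses (halpha0 : 0 < alpha) (halpha1 : alpha < 1).
Hypothesis hC : forall n : nat, (1 <= n)%N ->
  (abs_moment mu n <= (n%:R `^ (alpha * n%:R))%:E)%E.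
Hypotheses (hkappa0 : 0 < kappa) (hkappa1 : kappa < 1 - alpha).

Lemma zeros_prob_upper_large : exists (c : R) (n0 : nat), 0 < c /\
  forall (d : measure_display) (Omega : measurableType d)
    (P : probability Omega R) (X : R -> {RV P >-> R}),
  smooth_stationary_gaussian mu X ->
  forall (n : nat) (T : R), (2 <= n)%N -> (n0 <= n)%N -> 1 <= T -> T <= n%:R `^ kappa ->
  (P [set w | (n%:R%:E <= nb_zeros X T w)%E] <=
    (expR (- (c * (n%:R ^+ 2 * ln n%:R))))%:E)%E.
Proof.
have [B [C [B0 H]]] := orthonormal_grid hac.
pose e : R := (1 - kappa - alpha) / 2.
have e0 : 0 < e by rewrite divr_gt0//; move: hkappa1; lra.
have e12 : e <= 2^-1 by rewrite /e; move: hkappa0 halpha0; lra.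
have eE : 2 * e = 1 - kappa - alpha by rewrite /e mulrC divfK.
clearbody e; pose D := C.+1; pose c0 : R := e ^+ 2 / (16 * D%:R).
have D1 : 1 <= D%:R :> R by rewrite ler1n.
have c00 : 0 < c0 by rewrite divr_gt0 ?exprn_gt0// mulr_gt0.
pose b := 4 * D%:R / e + 2 / c0 + expR (13 / (2 * e)) + 3.
have t1 : 0 <= 4 * D%:R / e by rewrite divr_ge0 ?mulr_ge0 ?(ltW e0)//.
have t2 : 0 <= 2 / c0 by rewrite divr_ge0 ?(ltW c00)//.
have t3 := expR_ge0 (13 / (2 * e)).
have b0 : 0 <= b by rewrite /b !addr_ge0.
exists (c0 / 2), (Num.bound b); split; first by rewrite divr_gt0.
move=> d Omega P X hX n T n2 nb T1 Tk.
set x : R := n%:R; set l : R := ln n%:R.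
have bx : b <= x.
  by have := archi_boundP b0; move/ltW/le_trans; apply; rewrite ler_nat.
have n0 : (0 < n)%N by exact: ltn_trans n2.
have x0 : 0 < x by rewrite ltr0n.
have l0 : 0 <= l by rewrite ln_ge0// ler1n.
have lx : l <= x by exact: ln_nat_le.
have xD : 4 * D%:R / e <= x by move: bx t1 t2 t3; rewrite /b; lra.
have xc : 2 / c0 <= x by move: bx t1 t2 t3; rewrite /b; lra.
have xe : expR (13 / (2 * e)) <= x by move: bx t1 t2 t3; rewrite /b; lra.
have x3 : 3 <= x by move: bx t1 t2 t3; rewrite /b; lra.
have le13 : 13 <= 2 * e * l.
  move: xe; rewrite -ler_ln ?posrE ?expR_gt0// expRK ler_pdivrMr ?mulr_gt0// -/l.
  by rewrite mulrC.
have l1 : 1 <= l by move: le13 (ler_wpM2r l0 e12); lra.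
pose m := Num.truncn (e * n%:R / (2 * D%:R)).
have mn : (m <= n.+1)%N.
  rewrite leqW// -(ler_nat R); apply: (@le_trans _ _ (e * n%:R / (2 * D%:R))).
    by have /andP[] := @truncn_itv R (e * n%:R / (2 * D%:R)) ltac:(by rewrite divr_ge0 ?mulr_ge0 ?(ltW e0)//).
  rewrite ler_pdivrMr ?mulr_gt0// -/x.
  have : e * x <= 2^-1 * x by rewrite ler_wpM2r// ltW.
  have : x <= x * D%:R by rewrite ler_peMr// ltW.
  by lra.
have [bb [cc [orth bL _ _]]] := H n m n2 mn.
pose eta := expR (- (e * n%:R * ln n%:R)).
pose M := (2 * n)%:R `^ (alpha * (2 * n)%:R).
have M0 : 0 < M by rewrite powR_gt0// ltr0n muln_gt0.
have HM : (abs_moment mu (2 * n) <= M%:E)%E by apply: hC; rewrite muln_gt0.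
have L0 : 0 < n%:R ^+ (C * m) :> R by rewrite exprn_gt0.
have := zeros_prob_split hX T1 M0 (expR_gt0 _ : 0 < eta) L0 n0 B0 mn HM orth bL.
move=> /le_trans; apply; rewrite lee_fin.
have s1 : (2 * (n%:R ^+ (C * m) * eta)) ^+ m <= expR (- (c0 * (x ^+ 2 * l))).
  have := @small_ball_exponent R n m D e eta n2 isT xD e0 erefl erefl.
  apply: le_trans; rewrite lerXn2r ?nnegrE ?mulr_ge0 ?exprn_ge0 ?expR_ge0//.
  rewrite ler_pM2l// ler_pM2r ?expR_gt0//; apply: ler_weXn2l; first by rewrite ler1n.
  by rewrite leq_mul2r leqnSn orbT.
have s2 := variation_exponent n2 T1 Tk e0 eE halpha0 halpha1 hkappa0 le13 (erefl : M = _) (erefl : eta = _).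
set V := (_ ^+ 2 / (4 * (T ^+ 2 * M))) in s2 *.
set u := x ^+ 2 * l in s1 *.
have u0 : x <= u.
  rewrite /u expr2 -mulrA ler_peMr ?(ltW x0)//.
  by rewrite mulr_ege1//; move: x3; lra.
have ux : u <= x ^+ 3 by rewrite /u [leRHS]exprSr ler_wpM2l ?sqr_ge0.
have c01 : c0 <= 1.
  rewrite /c0 ler_pdivrMr ?mulr_gt0// mul1r; apply: (@le_trans _ _ 1).
    by rewrite exprn_ile1 ?(ltW e0)//; move: e12; lra.
  by move: D1; lra.
have cu : 2 <= c0 * u.
  move: xc; rewrite ler_pdivrMr// => xc.
  have : c0 * x <= c0 * u by rewrite ler_pM2l.
  by lra.
have q1 : expR (- (c0 * u)) <= 2^-1 * expR (- (c0 / 2 * u)).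
  rewrite (_ : - (c0 * u) = - (c0 * u / 2) + - (c0 / 2 * u)); last by field.
  rewrite expRD ler_wpM2r ?expR_ge0// expRN lef_pV2 ?posrE ?expR_gt0//.
  by apply: le_trans (expR_ge1Dx _); lra.
have q2 : expR (- V) * Num.sqrt 2 <= 2^-1 * expR (- (c0 / 2 * u)).
  have sq2 : Num.sqrt 2 <= 2 :> R.
    by rewrite -[leRHS]ger0_norm// -sqrtr_sqr ler_sqrt// expr2; lra.
  have Vu : 3 + c0 / 2 * u <= V.
    have h1 : x ^+ 3 <= V := s2.
    have h2 : c0 * u <= u by rewrite ler_piMl// (le_trans (ltW x0)).
    have h3 : 3 * x ^+ 2 <= x ^+ 3 by rewrite [leRHS]exprS ler_wpM2r ?sqr_ge0.
    have h4 : 3 * x <= x ^+ 2 by rewrite expr2 ler_wpM2r// ltW.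
    by move: h1 h2 h3 h4 ux x3; lra.
  have e3 : 4 <= expR 3 :> R by apply: le_trans (expR_ge1Dx _); lra.
  have h : expR (- V) <= expR (- 3) * expR (- (c0 / 2 * u)).
    by rewrite -expRD ler_expR; move: Vu; lra.
  apply: (le_trans (ler_pM _ _ h sq2)); rewrite ?expR_ge0 ?sqrtr_ge0//.
  rewrite mulrAC ler_wpM2r ?expR_ge0// expRN.
  by rewrite ler_pdivrMl ?expR_gt0//; move: e3; lra.
by move: s1 q1 q2; lra.
Qed.

Lemma zeros_prob_upper : exists c : R, 0 < c /\
  forall (d : measure_display) (Omega : measurableType d)
    (P : probability Omega R) (X : R -> {RV P >-> R}),
  smooth_stationary_gaussian mu X ->
  forall (n : nat) (T : R), (2 <= n)%N -> 1 <= T -> T <= n%:R `^ kappa ->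
  (P [set w | (n%:R%:E <= nb_zeros X T w)%E] <=
    (expR (- (c * (n%:R ^+ 2 * ln n%:R))))%:E)%E.
Proof.
have [c [n0 [c0 H]]] := zeros_prob_upper_large.
pose c' := Num.min c (16 * n0.+1%:R ^+ 3)^-1.
have p0 : 0 < 16 * n0.+1%:R ^+ 3 :> R by rewrite mulr_gt0// exprn_gt0.
exists c'; split; first by rewrite lt_min c0 invr_gt0.
move=> d Omega P X hX n T n2 T1 Tk.
have n1 : (0 < n)%N by exact: ltn_trans n2.
have nR : 0 < n%:R :> R by rewrite ltr0n.
have l0 : 0 <= ln n%:R :> R by rewrite ln_ge0// ler1n.
have u0 : 0 <= n%:R ^+ 2 * ln n%:R :> R by rewrite mulr_ge0// sqr_ge0.
have [nn|nn] := leqP n0 n.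
  apply: (le_trans (H _ _ _ _ hX n T n2 nn T1 Tk)); rewrite lee_fin ler_expR lerN2.
  by rewrite ler_wpM2r// /c' ge_min lexx.
pose M : R := 2 `^ (alpha * 2).
have M0 : 0 < M by rewrite powR_gt0.
have HM : (abs_moment mu 2 <= M%:E)%E by exact: hC.
have T0 : 0 < T by exact: lt_le_trans T1.
apply: (le_trans (zeros_prob_rice hX HM M0 T0 n2)); rewrite lee_fin.
have sM : Num.sqrt M = expR (alpha * ln 2).
  rewrite /M /powR gt_eqF// (_ : alpha * 2 * ln 2 = alpha * ln 2 + alpha * ln 2); last by ring.
  by rewrite expRD -expr2 sqrtr_sqr ger0_norm ?expR_ge0.
have TM : T * Num.sqrt M <= n%:R.
  apply: (@le_trans _ _ (expR (kappa * ln n%:R) * expR (alpha * ln n%:R))).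
    apply: ler_pM; rewrite ?sqrtr_ge0 ?(ltW T0)//.
      by apply: (le_trans Tk); rewrite /powR gt_eqF.
    by rewrite sM ler_expR ler_pM2l// ler_ln ?posrE// ler_nat.
  rewrite -expRD -[leRHS]expR_ln_nat// ler_expR -mulrDl ler_piMl//.
  by move: hkappa1; lra.
have nm : n%:R <= 2 * n.-1%:R :> R.
  by rewrite -natrM ler_nat -{1}(prednK n1) mul2n -addnn -addn1 leq_add2l -subn1 subn_gt0.
have nm0 : 0 < n.-1%:R :> R by rewrite ltr0n -subn1 subn_gt0.
apply: (@le_trans _ _ (1 - 16^-1)).
  rewrite ler_pdivrMr//; move: TM nm; lra.
apply: (@le_trans _ _ (expR (- 16^-1))); first exact: expR_ge1Dx.
rewrite ler_expR lerN2.
have un : n%:R ^+ 2 * ln n%:R <= n0.+1%:R ^+ 3 :> R.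
  apply: (@le_trans _ _ (n%:R ^+ 3)).
    by rewrite [leRHS]exprSr ler_wpM2l ?sqr_ge0// ln_nat_le.
  by rewrite lerXn2r ?nnegrE// ler_nat ltnW// ltnS ltnW.
apply: (@le_trans _ _ ((16 * n0.+1%:R ^+ 3)^-1 * n0.+1%:R ^+ 3)).
  apply: ler_pM => //; first by rewrite le_min (ltW c0) invr_ge0 ltW.
  by rewrite /c' ge_min lexx orbT.
rewrite invfM -mulrA mulVf ?mulr1// expf_neq0//.
Qed.

End UpperProbability.

Section Moments.
Context {R : realType}.

Lemma moment_decay (b : R) (m k : nat) : 0 < b -> (0 < m)%N -> (0 < k)%N ->
  k%:R ^+ m * expR (- (b * k%:R ^+ 2)) <=
    Num.sqrt (m%:R / b) ^+ m * expR (- (b / 2)) ^+ k.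
Proof.
move=> b0 m0 k0; set x : R := k%:R.
have m1 : 0 < m%:R :> R by rewrite ltr0n.
have x1 : 1 <= x by rewrite ler1n.
have x0 : 0 < x by rewrite ltr0n.
have xx : x <= x ^+ 2 by rewrite expr2 ler_peMr// ltW.
have E : expR (- (b * x ^+ 2)) = expR (- (b / 2 * x ^+ 2 / m%:R)) ^+ m * expR (- (b / 2 * x ^+ 2)).
  by rewrite -expRM_natl -expRD; congr expR; field; rewrite gt_eqF.
rewrite E mulrA -exprMn; apply: ler_pM; rewrite ?exprn_ge0 ?mulr_ge0 ?expR_ge0 ?(ltW x0)//; last first.
  by rewrite -expRM_natl ler_expR -/x mulrN lerN2 mulrC ler_pM2l ?divr_gt0.
rewrite lerXn2r ?nnegrE ?mulr_ge0 ?expR_ge0 ?sqrtr_ge0 ?(ltW x0)//.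
have mb : 0 < m%:R / b by rewrite divr_gt0.
set y := x * _; apply: (@le_trans _ _ (Num.sqrt (y ^+ 2))); first by rewrite sqrtr_sqr ler_norm.
apply: ler_wsqrtr; rewrite /y exprMn.
rewrite -expRM_natl mulrN expRN ler_pdivrMr ?expR_gt0// -ler_pdivrMl//.
apply: le_trans (expR_ge1Dx _); rewrite ler_wpDl//.
by rewrite le_eqVlt; apply/orP; left; apply/eqP; field; rewrite !gt_eqF.
Qed.

Lemma geometric_sum_le (q : R) n : 0 <= q -> q < 1 ->
  \sum_(0 <= i < n) q ^+ i <= (1 - q)^-1.
Proof.
move=> q0 q1; have q1' : 0 < 1 - q by rewrite subr_gt0.
rewrite -[leRHS]mul1r ler_pdivlMr// mulrC big_mkord -opprB mulNr -subrX1 opprB.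
by rewrite lerBlDr lerDl exprn_ge0.
Qed.

Context (d : measure_display) (Omega : measurableType d) (P : probability Omega R)
  (X : R -> {RV P >-> R}).

Lemma nb_zeros_cases T w : nb_zeros X T w = +oo%E \/
  exists j : nat, nb_zeros X T w = j%:R%:E.
Proof.
rewrite /nb_zeros /counting; case: asboolP => _; last by left.
by right; eexists.
Qed.

Hypothesis mE : forall (T : R) n, 0 < T -> measurable [set w | (n%:R%:E <= nb_zeros X T w)%E].

Lemma expe_pinfty m : (0 < m)%N -> ((+oo : \bar R) ^+ m = +oo)%E.
Proof.
by case: m => // m _; elim: m => [|m IH]; rewrite ?expe1// expeS IH mulyy.
Qed.

Lemma le_nb_zeros_pow T m (x : R) : (0 < m)%N -> exists n : nat, forall w,
  (x%:E <= nb_zeros X T w ^+ m)%E <-> (n%:R%:E <= nb_zeros X T w)%E.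
Proof.
move=> m0.
have ex : exists n : nat, x <= n%:R ^+ m.
  exists (Num.bound `|x|).+1; apply: (le_trans (ler_norm x)).
  apply: (@le_trans _ _ (Num.bound `|x|).+1%:R).
    by apply: ltW; apply: lt_trans (archi_boundP (normr_ge0 x)) _; rewrite ltr_nat.
  by rewrite -natrX ler_nat -[leqLHS]expn1 leq_pexp2l.
case: (ex_minnP ex) => n xn nmin; exists n => w.
have [->|[j ->]] := nb_zeros_cases T w; first by rewrite expe_pinfty// !leey.
rewrite -EFin_expe !lee_fin ler_nat; split; first exact: nmin.
by move=> nj; apply: (le_trans xn); rewrite lerXn2r ?nnegrE// ler_nat.
Qed.

Lemma measurable_nb_zeros_pow T m : 0 < T -> (0 < m)%N ->
  measurable_fun setT (fun w => nb_zeros X T w ^+ m)%E.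
Proof.
move=> T0 m0 mD; apply: (measurability _ (ErealGenCInfty.measurableE R)) => //.
move=> _ [_ [x ->] <-]; rewrite setTI.
have [n Hn] := le_nb_zeros_pow T x m0.
rewrite (_ : _ @^-1` _ = [set w | (n%:R%:E <= nb_zeros X T w)%E]); first exact: mE.
apply/seteqP; split => w /=; rewrite in_itv/= andbT.
  by move/Hn.
by move/Hn.
Qed.

Lemma nb_zeros_pow_le T m K w : (0 < m)%N ->
  (nb_zeros X T w ^+ m <= (K%:R ^+ m)%:E +
    \sum_(0 <= k <oo) ((k + K)%:R ^+ m * \1_[set v | ((k + K)%:R%:E <= nb_zeros X T v)%E] w)%:E)%E.
Proof.
move=> m0; pose u (k : nat) : \bar R :=
  ((k + K)%:R ^+ m * \1_[set v | ((k + K)%:R%:E <= nb_zeros X T v)%E] w)%:E.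
rewrite -/(\sum_(0 <= k <oo) u k)%E.
have u0 k : (0 <= u k)%E by rewrite /u lee_fin mulr_ge0 ?exprn_ge0.
have uS k : (u k <= \sum_(0 <= k <oo) u k)%E.
  apply: le_trans (nneseries_lim_ge (k.+1) (fun n _ _ => u0 n)).
  rewrite big_nat_recr//=; apply: leeDr; apply: sume_ge0 => i _; exact: u0.
have K0 : (0 <= (K%:R ^+ m)%:E :> \bar R)%E by rewrite lee_fin exprn_ge0.
have S0 : (0 <= \sum_(0 <= k <oo) u k)%E by exact: le_trans (uS 0%N).
have ge1 : (forall k : nat, ((k + K)%:R%:E <= nb_zeros X T w)%E ->
    (((k + K)%:R ^+ m)%:E <= \sum_(0 <= k <oo) u k)%E).
  move=> k kw; apply: le_trans (uS k); rewrite /u indicE mem_set// mulr1//.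
have [E|[j E]] := nb_zeros_cases T w.
  suff -> : (\sum_(0 <= k <oo) u k = +oo)%E by rewrite addey ?leey// -ltNye (lt_le_trans _ K0).
  apply/eqyP => A A0; pose k := (Num.bound A).+1.
  apply: le_trans (ge1 k _); last by rewrite E leey.
  rewrite lee_fin; apply: (@le_trans _ _ k%:R).
    by apply: ltW; apply: lt_trans (archi_boundP (ltW A0)) _; rewrite ltr_nat.
  rewrite -natrX ler_nat; apply: (@leq_trans (k + K)); first exact: leq_addr.
  by rewrite -[leqLHS]expn1 leq_pexp2l// addSn.
rewrite E -EFin_expe; have [jK|Kj] := leqP j K.
  apply: (@le_trans _ _ (K%:R ^+ m)%:E); last exact: leeDl.
  by rewrite lee_fin lerXn2r ?nnegrE// ler_nat.
apply: (@le_trans _ _ (\sum_(0 <= k <oo) u k)%E); last exact: leeDr.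
have := ge1 (j - K)%N; rewrite subnK ?(ltnW Kj)// E; exact.
Qed.

End Moments.

Section MomentBound.
Context {R : realType} (d : measure_display) (Omega : measurableType d)
  (P : probability Omega R) (X : R -> {RV P >-> R}) (c kappa : R).
Hypotheses (c0 : 0 < c) (kappa0 : 0 < kappa).
Hypothesis mE : forall (T : R) n, 0 < T -> measurable [set w | (n%:R%:E <= nb_zeros X T w)%E].
Hypothesis tail : forall (n : nat) (T : R), (2 <= n)%N -> 1 <= T -> T <= n%:R `^ kappa ->
  (P [set w | (n%:R%:E <= nb_zeros X T w)%E] <=
    (expR (- (c * (n%:R ^+ 2 * ln n%:R))))%:E)%E.

Let b := c * ln 2.
Let b0 : 0 < b. Proof. by rewrite mulr_gt0// ln_gt0// ltr1n. Qed.
Let q := expR (- (b / 2)).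
Let q1 : q < 1. Proof. by rewrite -[ltRHS]expR0 ltr_expR oppr_lt0 divr_gt0. Qed.
Let G := (1 - q)^-1.

Let tail_term (T : R) (m k : nat) : (0 < m)%N -> (2 <= k)%N -> 1 <= T -> T <= k%:R `^ kappa ->
  (\int[P]_w (k%:R ^+ m * \1_[set v | (k%:R%:E <= nb_zeros X T v)%E] w)%:E <=
   (Num.sqrt (m%:R / b) ^+ m * q ^+ k)%:E)%E.
Proof.
move=> m0 k2 T1 Tk.
have k0 : (0 < k)%N by exact: ltn_trans k2.
have T0 : 0 < T by exact: lt_le_trans T1.
under eq_integral do rewrite EFinM.
rewrite ge0_integralZl//; last first.
  by apply/measurable_EFinP; apply: measurable_indic; exact: mE.
rewrite integral_indic ?setIT//; last exact: mE.
have := moment_decay b0 m0 k0; rewrite -lee_fin; apply: le_trans.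
rewrite [leRHS]EFinM; apply: lee_wpmul2l; first by rewrite lee_fin exprn_ge0.
apply: (le_trans (tail k2 T1 Tk)); rewrite lee_fin ler_expR lerN2 /b.
rewrite -mulrA ler_pM2l// mulrC ler_wpM2l ?sqr_ge0// ler_ln ?posrE ?ltr0n//.
by rewrite ler_nat.
Qed.

Lemma moment_bound (T : R) (m : nat) : 1 <= T -> (1 <= m)%N ->
  ((\int[P]_(w in [set: Omega]) (nb_zeros X T w ^+ m)) `^ (m%:R^-1) <=
   ((1 + G) * Num.max 3 (Num.sqrt b)^-1 * Num.max (T `^ kappa^-1) (Num.sqrt m%:R))%:E)%E.
Proof.
move=> T1 m0; have T0 : 0 < T by exact: lt_le_trans T1.
set t := T `^ kappa^-1.
have t1 : 1 <= t.
  have : 1 `^ kappa^-1 <= t.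
    by apply: ge0_ler_powR; rewrite ?nnegrE ?invr_ge0// ltW.
  by rewrite powR1.
have t0 : 0 <= t by exact: le_trans t1.
pose K := (Num.truncn t).+2.
have /andP[K1 K2] := truncn_itv t0.
have Kt : K%:R <= 3 * t by rewrite /K -!natr1; move: K1 t1; lra.
have TK k : T <= (k + K)%:R `^ kappa.
  have -> : T = t `^ kappa by rewrite /t -powRrM mulVf ?gt_eqF// powRr1// ltW.
  apply: ge0_ler_powR; rewrite ?nnegrE ?(ltW kappa0)//.
  by rewrite (le_trans (ltW K2))// ler_nat /K addnS leqW// leq_addl.
have K2' k : (2 <= k + K)%N by rewrite /K !addnS.
pose s := Num.sqrt (m%:R / b).
have s0 : 0 <= s by exact: sqrtr_ge0.
have G0 : 0 <= G by rewrite invr_ge0 subr_ge0 ltW.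
have q0 : 0 <= q by exact: expR_ge0.
have mu k : measurable_fun setT (fun w => ((k + K)%:R ^+ m *
    \1_[set v | ((k + K)%:R%:E <= nb_zeros X T v)%E] w)%:E).
  by apply/measurable_EFinP; apply: measurable_funM => //; apply: measurable_indic; exact: mE.
have u0 k w : (0 <= ((k + K)%:R ^+ m *
    \1_[set v | ((k + K)%:R%:E <= nb_zeros X T v)%E] w)%:E)%E.
  by rewrite lee_fin mulr_ge0 ?exprn_ge0.
have I1 : (\int[P]_w (nb_zeros X T w ^+ m) <= (K%:R ^+ m + G * s ^+ m)%:E)%E.
  apply: (@le_trans _ _ (\int[P]_w ((K%:R ^+ m)%:E +
    \sum_(0 <= k <oo) ((k + K)%:R ^+ m * \1_[set v | ((k + K)%:R%:E <= nb_zeros X T v)%E] w)%:E))%E).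
    apply: ge0_le_integral => //.
    - by move=> w _; apply: expe_ge0; have [->|[j ->]] := nb_zeros_cases X T w;
        rewrite ?leey// lee_fin.
    - exact: measurable_nb_zeros_pow.
    - apply: emeasurable_funD => //; apply: ge0_emeasurable_sum => //.
    - by move=> w _; exact: nb_zeros_pow_le.
  rewrite ge0_integralD//; last 2 first.
  - by move=> w _; exact: nneseries_ge0.
  - by apply: ge0_emeasurable_sum.
  rewrite integral_cst// [X in (_ * X + _)%E]probability_setT mule1 integral_nneseries// EFinD.
  apply: leeD => //.
  apply: lime_le.
    by apply: is_cvg_nneseries => k _ _; apply: integral_ge0 => w _; exact: u0.
  apply: nearW => n; apply: (@le_trans _ _ (\sum_(0 <= k < n) (s ^+ m * q ^+ k)%:E)%E).
    apply: lee_sum => k _; apply: le_trans (tail_term m0 (K2' k) T1 (TK k)) _.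
    rewrite lee_fin ler_wpM2l ?exprn_ge0// ler_wiXn2l ?(ltW q1)//; exact: leq_addr.
  rewrite sumEFin lee_fin -mulr_sumr mulrC ler_wpM2r ?exprn_ge0//.
  exact: geometric_sum_le.
set A := Num.max t (Num.sqrt m%:R); set D := Num.max 3 (Num.sqrt b)^-1.
have A0 : 0 <= A by rewrite le_max t0.
have D0 : 0 <= D by rewrite le_max ler0n.
have KA : K%:R <= D * A.
  apply: (le_trans Kt); apply: ler_pM => //; first by rewrite /D le_max lexx.
  by rewrite /A le_max lexx.
have sE : s = (Num.sqrt b)^-1 * Num.sqrt m%:R.
  by rewrite [RHS]mulrC /s sqrtrM// sqrtrV// ltW.
have sA : s <= D * A.
  rewrite sE; apply: ler_pM; rewrite ?invr_ge0 ?sqrtr_ge0//.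
    by rewrite /D le_max lexx orbT.
  by rewrite /A le_max lexx orbT.
have I2 : K%:R ^+ m + G * s ^+ m <= ((1 + G) * D * A) ^+ m.
  rewrite -mulrA exprMn.
  apply: (@le_trans _ _ ((1 + G) * (D * A) ^+ m)).
    rewrite mulrDl mul1r; apply: lerD.
      by rewrite lerXn2r ?nnegrE ?mulr_ge0.
    by rewrite ler_wpM2l// lerXn2r ?nnegrE ?mulr_ge0.
  rewrite ler_wpM2r ?exprn_ge0 ?mulr_ge0// -[leLHS]expr1.
  by rewrite ler_weXn2l// lerDl.
have B0 : 0 <= (1 + G) * D * A by rewrite !mulr_ge0 ?addr_ge0.
have I3 := le_trans I1 (_ : (_ <= (((1 + G) * D * A) ^+ m)%:E)%E).
have mi : 0 <= m%:R^-1 :> R by rewrite invr_ge0.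
apply: (@le_trans _ _ (((((1 + G) * D * A) ^+ m)%:E) `^ (m%:R^-1))%E).
  apply: gt0_ler_poweR => //.
  - rewrite in_itv/= leey andbT; apply: integral_ge0 => w _; apply: expe_ge0.
    by have [->|[j ->]] := nb_zeros_cases X T w; rewrite ?leey// lee_fin.
  - by rewrite in_itv/= leey andbT lee_fin exprn_ge0.
  - by apply: I3; rewrite lee_fin.
rewrite poweR_EFin lee_fin -powR_mulrn// -powRrM mulfV ?powRr1//.
by rewrite pnatr_eq0 -lt0n.
Qed.

End MomentBound.

Theorem mainTheorem4 (R : realType) (mu : probability (measurableTypeR R) R)
    (hsym : symmetric_measure mu) (hac : nontrivial_ac_part mu)
    (alpha : R) (halpha0 : 0 < alpha) (halpha1 : alpha < 1)
    (hC : forall n : nat, (1 <= n)%N ->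
       (abs_moment mu n <= (n%:R `^ (alpha * n%:R))%:E)%E)
    (kappa : R) (hkappa0 : 0 < kappa) (hkappa1 : kappa < 1 - alpha) :
  (exists c1 c2 : R, [/\ 0 < c1, c1 <= c2 &
     forall (d : measure_display) (Omega : measurableType d)
       (P : probability Omega R) (X : R -> {RV P >-> R}),
       smooth_stationary_gaussian mu X ->
       forall (n : nat) (T : R), (2 <= n)%N -> 1 <= T -> T <= n%:R `^ kappa ->
       ((c1 * n%:R ^+ 2 * ln n%:R)%:E
          <= - lne (P [set w | n%:R%:E <= nb_zeros X T w]) /\
        - lne (P [set w | n%:R%:E <= nb_zeros X T w])
          <= (c2 * n%:R ^+ 2 * ln n%:R)%:E)%E]) /\
  (exists c' : R, 0 < c' /\
     forall (d : measure_display) (Omega : measurableType d)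
       (P : probability Omega R) (X : R -> {RV P >-> R}),
       smooth_stationary_gaussian mu X ->
       forall (T : R) (m : nat), 1 <= T -> (1 <= m)%N ->
       ((\int[P]_(w in [set: Omega]) (nb_zeros X T w ^+ m)) `^ (m%:R^-1)
          <= (c' * Num.max (T `^ (kappa^-1)) (Num.sqrt m%:R))%:E)%E).
Proof.
have [c1 [c10 Hup]] := zeros_prob_upper hac halpha0 halpha1 hC hkappa0 hkappa1.
have [C Hlow] := zeros_prob_lower hac.
split.
- exists c1, (Num.max c1 C%:R); split => //; first by rewrite le_max lexx.
  move=> d Omega P X hX n T n2 T1 Tk.
  have T0 : 0 < T by exact: lt_le_trans T1.
  have mA := measurable_zeros n hX T0.
  have := Hup d Omega P X hX n T n2 T1 Tk.
  have := Hlow d Omega P X hX n T n2 T1.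
  have pfin : P [set w | (n%:R%:E <= nb_zeros X T w)%E] \is a fin_num by exact: fin_num_measure.
  rewrite -(fineK pfin) !lee_fin; set p := fine _ => lo up.
  have n0 : (0 < n)%N by exact: ltn_trans n2.
  have nR : 0 < n%:R :> R by rewrite ltr0n.
  have l0 : 0 <= ln n%:R :> R by rewrite ln_ge0// ler1n.
  have p0 : 0 < p by apply: lt_le_trans lo; rewrite invr_gt0 exprn_gt0.
  rewrite lne_EFin// -EFinN !lee_fin; split.
    rewrite lerNr -(expRK (- _)) ler_ln ?posrE ?expR_gt0//.
    by rewrite -mulrA.
  rewrite lerNl -(expRK (- _)) ler_ln ?posrE ?expR_gt0//.
  apply: le_trans lo.
  rewrite -{3}(expR_ln_nat n0) -expRM_natl -expRN ler_expR lerN2 natrM natrX.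
  by rewrite !ler_wpM2r ?sqr_ge0// le_max lexx orbT.
- exists ((1 + (1 - expR (- (c1 * ln 2 / 2)))^-1) * Num.max 3 (Num.sqrt (c1 * ln 2))^-1).
  have b0 : 0 < c1 * ln 2 by rewrite mulr_gt0// ln_gt0// ltr1n.
  split.
    apply: mulr_gt0; last by rewrite lt_max ltr0n.
    rewrite ltr_wpDr// invr_ge0 subr_ge0 -[leRHS]expR0 ler_expR oppr_le0.
    by rewrite divr_ge0// ltW.
  move=> d Omega P X hX T m T1 m1.
  apply: moment_bound => //.
  - by move=> T' n T'0; exact: measurable_zeros hX T'0.
  - by move=> n T' n2 T'1 T'k; exact: (Hup d Omega P X hX).
Qed.
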